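(* Let $\Omega\subset\mathbb{R}^2$ be a smooth, bounded domain. There exists $\alpha_0>0$ such that for every $\alpha\in(0,\alpha_0)$ and every optimizer $u_*\in\mathcal{M}_\alpha(\Omega)\cap\mathcal{S}_1$, $$\lambda_1(\alpha)<\Lambda_1(\alpha)<\lambda_2(\alpha).$$ In particular, $\Lambda_1(\alpha)$ is not an eigenvalue of the linearized problem $-\Delta\phi=\lambda(1+2\alpha u_*^2)e^{\alpha u_*^2}\phi$ in $\Omega$, $\phi=0$ on $\partial\Omega$.
   Context: For $\alpha\in(0,4\pi]$ set $\mathscr{E}_{\alpha,\Omega}(u)=\int_\Omega e^{\alpha u^2}dx$ and $\mathrm{TM}(\alpha,\Omega)=\sup\{\mathscr{E}_{\alpha,\Omega}(u):u\in W^{1,2}_0(\Omega),\|\nabla u\|_{L^2(\Omega)}\le1\}<\infty$. $\mathcal{S}_1=\{u\in W^{1,2}_0(\Omega):\|\nabla u\|_{L^2(\Omega)}=1\}$. $\mathcal{M}_\alpha(\Omega)$ is the set of optimizers, i.e. of $v\in W^{1,2}_0(\Omega)$ with $\|\nabla v\|_{L^2(\Omega)}\le1$ and $\mathscr{E}_{\alpha,\Omega}(v)=\mathrm{TM}(\alpha,\Omega)$. Given an optimizer $u_*\in\mathcal{M}_\alpha(\Omega)\cap\mathcal{S}_1$: $\lambda_1(\alpha)\le\lambda_2(\alpha)\le\dots$ are the eigenvalues, counted with multiplicity, of $-\Delta\phi=\lambda(1+2\alpha u_*^2)e^{\alpha u_*^2}\phi$ in $\Omega$, $\phi=0$ on $\partial\Omega$;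 in particular $\lambda_1(\alpha)=\inf_{\phi\in W^{1,2}_0(\Omega)\setminus\{0\}}\frac{\int_\Omega|\nabla\phi|^2dx}{\int_\Omega\phi^2(1+2\alpha u_*^2)e^{\alpha u_*^2}dx}$. Also $\Lambda_1(\alpha)=\inf_{v\in W^{1,2}_0(\Omega)\setminus\{0\}}\frac{\int_\Omega|\nabla v|^2dx}{\int_\Omega v^2e^{\alpha u_*^2}dx}$. *)

(* Defs.v *)
From HB Require Import structures.
From mathcomp Require Import all_boot all_order all_algebra.
From mathcomp Require Import all_classical all_reals all_analysis.
Import Order.TTheory GRing.Theory Num.Theory.
Import numFieldNormedType.Exports.

Set Implicit Arguments.
Unset Strict Implicit.
Unset Printing Implicit Defensive.

Local Open Scope classical_set_scope.
Local Open Scope ring_scope.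

(* Functions on Omega are represented by total functions on the plane of which
   only the values on Omega matter; elements of Lebesgue and Sobolev spaces are
   representatives, identified up to equality almost everywhere on Omega. *)

(* Lebesgue measure on the plane; measurableTypeR R is R with its Borel sets. *)
Definition mu2 (R : realType) :
    {measure set (measurableTypeR R * measurableTypeR R) -> \bar R} :=
  ((@lebesgue_measure R) \x (@lebesgue_measure R))%E.

Definition dir (R : realType) (i : bool) : R * R :=
  if i then (0, 1) else (1, 0).

(* All iterated directional derivatives exist and are Frechet differentiable
   everywhere; this is C^infinity. *)
Definition smooth (R : realType) (V : normedModType R) (f : V -> R) : Prop :=
  forall (s : seq V) (x : V), differentiable (foldr (fun v g => 'D_v g) f s) x.

(* Near each boundary point p, in the orthonormal coordinates
   (y1, y2) = (x . e^perp, x . e), Omega is the region y2 > gam y1 lying above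
   the graph of a smooth function. *)
Definition smooth_boundary (R : realType) (Omega : set (R * R)) : Prop :=
  forall p, (closure Omega `\` Omega) p ->
  exists (e : R * R) (gam : R -> R),
    [/\ e.1 ^+ 2 + e.2 ^+ 2 = 1, smooth (gam : R^o -> R) &
        \forall x \near p,
          Omega x <-> gam (x.1 * e.2 - x.2 * e.1) < x.1 * e.1 + x.2 * e.2].

Definition smooth_bounded_domain (R : realType) (Omega : set (R * R)) : Prop :=
  [/\ open Omega, connected Omega, Omega !=set0, bounded_set Omega &
      smooth_boundary Omega].

Definition test_fun (R : realType) (Omega : set (R * R)) (f : R * R -> R) :
    Prop :=
  [/\ smooth f, compact (closure [set x | f x != 0]) &
      closure [set x | f x != 0] `<=` Omega].

Definition L2 (R : realType) (Omega : set (R * R)) (u : R * R -> R) : Prop :=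
  measurable_fun Omega (u : measurableTypeR R * measurableTypeR R -> R) /\
  (\int[@mu2 R]_(x in Omega) ((u x) ^+ 2)%:E < +oo)%E.

Definition is_weak_partial (R : realType) (Omega : set (R * R)) (i : bool)
    (u g : R * R -> R) : Prop :=
  L2 Omega g /\
  forall f, test_fun Omega f ->
    \int[@mu2 R]_(x in Omega) (u x * 'D_(dir R i) f x) =
    - \int[@mu2 R]_(x in Omega) (g x * f x).

(* The L^2 weak derivative is unique up to a null set; this picks a
   representative, and returns 0 if there is none. *)
Definition weak_partial (R : realType) (Omega : set (R * R)) (i : bool)
    (u : R * R -> R) : R * R -> R :=
  xget (cst 0) [set g | is_weak_partial Omega i u g].

Definition W12 (R : realType) (Omega : set (R * R)) : set (R * R -> R) :=
  [set u | L2 Omega u /\ forall i, exists g, is_weak_partial Omega i u g].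

Definition grad_dot (R : realType) (Omega : set (R * R)) (u v : R * R -> R)
    (x : R * R) : R :=
  weak_partial Omega false u x * weak_partial Omega false v x +
  weak_partial Omega true u x * weak_partial Omega true v x.

Definition dirichlet (R : realType) (Omega : set (R * R)) (u : R * R -> R) :
    \bar R :=
  (\int[@mu2 R]_(x in Omega) (grad_dot Omega u u x)%:E)%E.

Definition grad_norm (R : realType) (Omega : set (R * R)) (u : R * R -> R) :
    \bar R :=
  (dirichlet Omega u `^ 2^-1)%E.

Definition sobolev_norm (R : realType) (Omega : set (R * R))
    (u : R * R -> R) : \bar R :=
  ((\int[@mu2 R]_(x in Omega) ((u x) ^+ 2)%:E + dirichlet Omega u) `^ 2^-1)%E.

Definition W012 (R : realType) (Omega : set (R * R)) : set (R * R -> R) :=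
  [set u | W12 Omega u /\
    forall eps : R, 0 < eps -> exists2 f, test_fun Omega f &
      (sobolev_norm Omega (u \- f)%R < eps%:E)%E].

Definition ae_zero (R : realType) (Omega : set (R * R)) (u : R * R -> R) :
    Prop :=
  {ae @mu2 R, forall x, Omega x -> u x = 0}.

Definition TM_energy (R : realType) (a : R) (Omega : set (R * R))
    (u : R * R -> R) : \bar R :=
  (\int[@mu2 R]_(x in Omega) (expR (a * (u x) ^+ 2))%:E)%E.

Definition TM (R : realType) (a : R) (Omega : set (R * R)) : \bar R :=
  ereal_sup [set TM_energy a Omega u | u in
    [set u | W012 Omega u /\ (grad_norm Omega u <= 1)%E]].

Definition unit_sphere (R : realType) (Omega : set (R * R)) :
    set (R * R -> R) :=
  [set u | W012 Omega u /\ grad_norm Omega u = 1%E].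

Definition optimizers (R : realType) (a : R) (Omega : set (R * R)) :
    set (R * R -> R) :=
  [set v | [/\ W012 Omega v, (grad_norm Omega v <= 1)%E &
               TM_energy a Omega v = TM a Omega]].

(* Weak form of - Laplacian phi = l w phi in Omega, phi = 0 on the boundary. *)
Definition weak_solution (R : realType) (Omega : set (R * R))
    (w : R * R -> R) (l : R) (phi : R * R -> R) : Prop :=
  W012 Omega phi /\
  forall psi, W012 Omega psi ->
    \int[@mu2 R]_(x in Omega) grad_dot Omega phi psi x =
    l * \int[@mu2 R]_(x in Omega) (w x * phi x * psi x).

Definition is_eigenvalue (R : realType) (Omega : set (R * R))
    (w : R * R -> R) (l : R) : Prop :=
  exists2 phi, weak_solution Omega w l phi & ~ ae_zero Omega phi.

Definition lin_indep (R : realType) (Omega : set (R * R)) (k : nat)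
    (phi : 'I_k -> R * R -> R) : Prop :=
  forall c : 'I_k -> R,
    ae_zero Omega (fun x => \sum_(i < k) c i * phi i x) -> forall i, c i = 0.

(* The k-th eigenvalue (k >= 1) in nondecreasing order counted with
   multiplicity: the least t such that the multiplicities of the eigenvalues
   not exceeding t add up to at least k, that is, such that there are k linearly
   independent eigenfunctions with eigenvalues at most t; +oo if there is none. *)
Definition eigenvalue_nth (R : realType) (Omega : set (R * R))
    (w : R * R -> R) (k : nat) : \bar R :=
  ereal_inf [set t%:E | t in [set t : R |
    exists2 phi : 'I_k -> R * R -> R, lin_indep Omega phi &
      forall i, exists2 l : R, l <= t & weak_solution Omega w l (phi i)]].

Definition lin_weight (R : realType) (a : R) (u : R * R -> R) (x : R * R) : R :=
  (1 + 2 * a * (u x) ^+ 2) * expR (a * (u x) ^+ 2).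

Definition lambda (R : realType) (a : R) (Omega : set (R * R))
    (u : R * R -> R) (k : nat) : \bar R :=
  eigenvalue_nth Omega (lin_weight a u) k.

Definition Lambda1 (R : realType) (a : R) (Omega : set (R * R))
    (u : R * R -> R) : \bar R :=
  ereal_inf [set (dirichlet Omega v /
      \int[@mu2 R]_(x in Omega) ((v x) ^+ 2 * expR (a * (u x) ^+ 2))%:E)%E |
    v in [set v | W012 Omega v /\ ~ ae_zero Omega v]].

(* Main.v *)
(** By optimality of u and convexity of the exponential,
    int e^{a u^2} v^2 <= T D(v) for all v, where D is the Dirichlet form and
    T = int e^{a u^2} u^2; hence Lambda_1 >= 1/T.  The weight w of the linearised
    problem exceeds e^{a u^2}, so testing with u itself gives
    lambda_1 <= 1 / int w u^2 < 1/T.  On the other side all weights are at least 1,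
    so Lambda_1 is at most the first Dirichlet eigenvalue of Omega, and
    int (w - 1) v^2 <= K a D(v) by an exponential integrability estimate.  Two
    eigenfunctions of the linearised problem have a combination orthogonal in L^2
    to the first Dirichlet eigenfunction, so lambda_2 is, up to O(a), at least the
    second Dirichlet eigenvalue.  The latter is strictly larger than the first:
    an eigenfunction for the first eigenvalue has constant sign, by a strong
    maximum principle for nonnegative supersolutions, proved with the logarithm
    of the supersolution and a Poincare inequality on squares. *)

(* Throughout, [S], [S1], [S2] and [T] stand for maxima of a zeroth order form over the Dirichlet
   form, that is, for reciprocals of eigenvalues; this orientation keeps denominators equal to the
   Dirichlet energy whatever the weight. Maximisers are found without weak compactness:
   approximating sequences are chosen so that successive differences decay geometrically in energy,
   and completeness of L^2 does the rest. Chain rules are used for test functions only, where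
   derivatives are classical. Truncation, absolute value and logarithm are therefore applied to
   smooth approximants, and each estimate is arranged so that its bound does not depend on the
   approximant. This is why the test function of the logarithmic estimate must make sense where the
   approximant is negative. The exponential estimate holds uniformly over the unit ball of the
   Dirichlet norm, with constants depending on Omega alone; hence one threshold [a0] serves all
   optimizers at once. Comparing T with the first maximum [S] needs no spectral gap; the gap of
   Omega enters only in the comparison of Lambda_1 with lambda_2, where it has to beat an error
   linear in a. *)
Require Import Defs.
From HB Require Import structures.
From mathcomp Require Import all_boot all_order all_algebra.
From mathcomp Require Import all_classical all_reals all_analysis.
From mathcomp Require Import measurable_realfun ring lra.
Import Order.TTheory GRing.Theory Num.Theory.
Import numFieldNormedType.Exports.

Set Implicit Arguments.
Unset Strict Implicit.
Unset Printing Implicit Defensive.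

Local Open Scope classical_set_scope.
Local Open Scope ring_scope.

(* Locked: otherwise unification unfolds the integral in every form estimate. *)
HB.lock Definition ip d (T : measurableType d) (R : realType)
  (mu : {measure set T -> \bar R}) (D : set T) (u v : T -> R) : R :=
  \int[mu]_(x in D) (u x * v x).
Arguments ip {d T R} mu D u v.

(** * Square integrable functions over a general measure: inner product and completeness *)

Section L2_theory.
Context d (T : measurableType d) (R : realType).
Variable mu : {measure set T -> \bar R}.
Variable D : set T.
Hypothesis mD : measurable D.
Implicit Types u v w : T -> R.

(** Kept general because it is applied to Omega, to intervals of the line and to square cells;
    [L2 Omega] is the instance for Omega, by conversion. *)
Definition sqint u := measurable_fun D u /\
  (\int[mu]_(x in D) ((u x) ^+ 2)%:E < +oo)%E.

Local Notation ip := (ip mu D).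

Lemma ge0_integrable (f : T -> R) : measurable_fun D f ->
  (forall x, D x -> 0 <= f x) ->
  mu.-integrable D (EFin \o f) <-> (\int[mu]_(x in D) (f x)%:E < +oo)%E.
Proof.
move=> mf f0; split => [/integrableP[_]|lty].
  by under eq_integral => x /set_mem Dx do rewrite /= ger0_norm ?f0//.
apply/integrableP; split; first exact/measurable_EFinP.
by under eq_integral => x /set_mem Dx do rewrite /= ger0_norm ?f0//.
Qed.

Lemma dom_integrable (f g : T -> R) : measurable_fun D f ->
  (forall x, D x -> `|f x| <= g x) -> mu.-integrable D (EFin \o g) ->
  mu.-integrable D (EFin \o f).
Proof.
move=> mf fg ig; apply: (le_integrable mD _ _ ig); first exact/measurable_EFinP.
by move=> x Dx /=; rewrite lee_fin (le_trans (fg x Dx))// ler_norm.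
Qed.

Lemma sqintP u : sqint u <->
  measurable_fun D u /\ mu.-integrable D (EFin \o (fun x => u x ^+ 2)).
Proof.
split=> -[mu_ h]; split=> //.
  by apply/ge0_integrable => //; [exact: measurable_funX|move=> *; exact: sqr_ge0].
by move: h => /ge0_integrable; apply; [exact: measurable_funX|move=> *; exact: sqr_ge0].
Qed.

Lemma sqint_mul u v : sqint u -> sqint v ->
  mu.-integrable D (EFin \o (fun x => u x * v x)).
Proof.
move=> /sqintP[mu_ iu] /sqintP[mv iv].
apply: (@dom_integrable _ (fun x => u x ^+ 2 + v x ^+ 2)).
- exact: measurable_funM.
- move=> x _; rewrite ler_norml.
  have := sqr_ge0 (u x - v x); have := sqr_ge0 (u x + v x).
  by have := sqr_ge0 (u x); have := sqr_ge0 (v x); nra.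
- by have := integrableD mD iu iv; apply: eq_integrable.
Qed.

Lemma sqintD u v : sqint u -> sqint v -> sqint (fun x => u x + v x).
Proof.
move=> hu hv; have /sqintP[mu_ iu] := hu; have /sqintP[mv iv] := hv.
apply/sqintP; split; first exact: measurable_funD.
apply: (@dom_integrable _ (fun x => 2 * u x ^+ 2 + 2 * v x ^+ 2)).
- by apply: measurable_funX; exact: measurable_funD.
- by move=> x _; rewrite ger0_norm ?sqr_ge0//; have := sqr_ge0 (u x - v x); nra.
- have := integrableD mD (integrableZl mD 2 iu) (integrableZl mD 2 iv).
  exact: eq_integrable.
Qed.

Lemma sqintZ c u : sqint u -> sqint (fun x => c * u x).
Proof.
move=> /sqintP[mu_ iu]; apply/sqintP; split.
  by apply: measurable_funM => //; exact: measurable_cst.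
have := integrableZl mD (c ^+ 2) iu; apply: eq_integrable => // x _ /=.
by rewrite -EFinM exprMn.
Qed.

Lemma sqintN u : sqint u -> sqint (fun x => - u x).
Proof.
by move=> /(sqintZ (-1)); under eq_fun do rewrite mulN1r.
Qed.

Lemma sqintB u v : sqint u -> sqint v -> sqint (fun x => u x - v x).
Proof. by move=> hu /sqintN hv; exact: sqintD. Qed.

Lemma ipC u v : ip u v = ip v u.
Proof. by rewrite ip.unlock; apply: eq_Rintegral => x _; rewrite mulrC. Qed.

Lemma ipDl u v w : sqint u -> sqint v -> sqint w ->
  ip (fun x => u x + v x) w = ip u w + ip v w.
Proof.
move=> hu hv hw; rewrite ip.unlock -RintegralD//; [|exact: sqint_mul..].
by apply: eq_Rintegral => x _; rewrite mulrDl.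
Qed.

Lemma ipZl c u w : sqint u -> sqint w ->
  ip (fun x => c * u x) w = c * ip u w.
Proof.
move=> hu hw; rewrite ip.unlock -RintegralZl//; last exact: sqint_mul.
by apply: eq_Rintegral => x _; rewrite mulrA.
Qed.

Lemma ipNl u w : sqint u -> sqint w -> ip (fun x => - u x) w = - ip u w.
Proof.
move=> hu hw; rewrite -mulN1r -ipZl//; congr ip.
by apply/funext => x; rewrite mulN1r.
Qed.

Lemma ipBl u v w : sqint u -> sqint v -> sqint w ->
  ip (fun x => u x - v x) w = ip u w - ip v w.
Proof. by move=> hu hv hw; rewrite ipDl ?ipNl//; exact: sqintN. Qed.

Lemma ip_ge0 u : 0 <= ip u u.
Proof. by rewrite ip.unlock; apply: Rintegral_ge0 => x _; rewrite -expr2 sqr_ge0. Qed.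

Lemma ip_EFin u : sqint u ->
  (ip u u)%:E = (\int[mu]_(x in D) ((u x) ^+ 2)%:E)%E.
Proof.
move=> hu; rewrite ip.unlock /Rintegral fineK.
  by apply: eq_integral => x _; rewrite expr2.
by have := integrable_fin_num mD (sqint_mul hu hu).
Qed.

Lemma ae_eq_Rintegral (f g : T -> R) : measurable_fun D f -> measurable_fun D g ->
  {ae mu, forall x, D x -> f x = g x} ->
  \int[mu]_(x in D) f x = \int[mu]_(x in D) g x.
Proof.
move=> mf mg fg; congr fine; apply: ae_eq_integral => //.
- exact/measurable_EFinP.
- exact/measurable_EFinP.
- by apply: filterS fg => x h Dx; rewrite h.
Qed.

Lemma ip_eq0 u : sqint u -> ip u u = 0 -> {ae mu, forall x, D x -> u x = 0}.
Proof.
move=> hu u0; have := ip_EFin hu; rewrite u0 => /esym i0.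
have /ae_eq_integral_abs : measurable_fun D (fun x => ((u x) ^+ 2)%:E).
  by apply/measurable_EFinP; apply: measurable_funX; exact: hu.1.
move=> /(_ mu mD)[+ _].
under eq_integral do rewrite gee0_abs ?lee_fin ?sqr_ge0//.
move=> /(_ i0); apply: filterS => x h Dx.
by have /eqP := h Dx; rewrite eqe sqrf_eq0 => /eqP.
Qed.

Lemma ae0_ip u : sqint u -> {ae mu, forall x, D x -> u x = 0} -> ip u u = 0.
Proof.
move=> hu u0.
rewrite ip.unlock (@ae_eq_Rintegral _ (cst 0)).
- by rewrite Rintegral_cst// mul0r.
- by apply: measurable_funM => //; exact: hu.1.
- exact: measurable_cst.
- by apply: filterS u0 => x h Dx; rewrite h// mulr0.
Qed.

Lemma ipDD u v : sqint u -> sqint v ->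
  ip (fun x => u x + v x) (fun x => u x + v x) = ip u u + 2 * ip u v + ip v v.
Proof.
move=> hu hv; have huv := sqintD hu hv.
rewrite ipDl// (ipC u (fun x => u x + v x)) (ipC v (fun x => u x + v x)) !ipDl// (ipC v u).
by ring.
Qed.

Lemma ipZZ c u : sqint u ->
  ip (fun x => c * u x) (fun x => c * u x) = c ^+ 2 * ip u u.
Proof.
move=> hu; have hcu := sqintZ c hu.
by rewrite ipZl// (ipC u) ipZl// mulrA expr2.
Qed.

Lemma cauchy_schwarz u v : sqint u -> sqint v ->
  (ip u v) ^+ 2 <= ip u u * ip v v.
Proof.
move=> hu hv.
have key t : 0 <= ip u u + 2 * (t * ip u v) + t ^+ 2 * ip v v.
  have htv := sqintZ t hv.
  have := ip_ge0 (fun x => u x + t * v x).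
  by rewrite ipDD// ipZZ// (ipC u (fun x => t * v x)) ipZl// (ipC v u).
have v0 := ip_ge0 v; have u0 := ip_ge0 u.
have [vz|vz] := eqVneq (ip v v) 0.
  rewrite vz mulr0; have [->|uv0] := eqVneq (ip u v) 0; first by rewrite expr0n.
  (* In this degenerate case the quadratic in t is affine; this t gives it the value -1. *)
  have := key (- (ip u u + 1) / (2 * ip u v)).
  rewrite vz mulr0 addr0.
  have -> : 2 * (- (ip u u + 1) / (2 * ip u v) * ip u v) = - (ip u u + 1) by field.
  by lra.
have vp : 0 < ip v v by rewrite lt_neqAle eq_sym vz.
have := key (- ip u v / ip v v).
have -> : ip u u + 2 * (- ip u v / ip v v * ip u v) +
  (- ip u v / ip v v) ^+ 2 * ip v v = (ip u u * ip v v - ip u v ^+ 2) / ip v v.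
  by field.
by rewrite pmulr_lge0 ?invr_gt0// subr_ge0.
Qed.

(** The increments are at most H 2^-n, so the tail from N on is at most 2 H 2^-N. Everything is
    stated with squares because both hypothesis and conclusion are integrated later. *)
Lemma geometric_steps_cvg (x_ : nat -> R) (H : R) : 0 <= H ->
  (forall n, 4 ^+ n * (x_ n.+1 - x_ n) ^+ 2 <= H ^+ 2) ->
  exists2 l, x_ n @[n --> \oo] --> l &
    forall N, (x_ N - l) ^+ 2 <= 4 * 4^-1 ^+ N * H ^+ 2.
Proof.
move=> H0 hx.
have p2 n : 0 < (2^-1 : R) ^+ n by rewrite exprn_gt0.
have step n : `|x_ n.+1 - x_ n| <= H * 2^-1 ^+ n.
  rewrite -(@ler_pXn2r _ 2) ?nnegrE ?mulr_ge0 ?(ltW (p2 n))//.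
  rewrite real_normK ?num_real// -(@ler_pM2l _ (4 ^+ n)) ?exprn_gt0//.
  rewrite [leRHS](_ : _ = H ^+ 2) ?hx//.
  rewrite exprMn mulrCA -exprM mulnC exprM -exprMn.
  by rewrite (_ : 4 * 2^-1 ^+ 2 = 1) ?expr1n ?mulr1//; field.
(* The subtracted term is the part of the tail not yet spent; with it the induction on [k]
   closes. *)
have dist N k : `|x_ (N + k)%N - x_ N| <= 2 * H * 2^-1 ^+ N - 2 * H * 2^-1 ^+ (N + k).
  elim: k => [|k IH]; first by rewrite addn0 !subrr normr0.
  rewrite addnS (le_trans (ler_distD (x_ (N + k)%N) _ _))//.
  have := step (N + k)%N; rewrite [in _ ^+ (N + k).+1]exprS => h.
  by have := lerD h IH; lra.
have dist' N k : `|x_ (N + k)%N - x_ N| <= 2 * H * 2^-1 ^+ N.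
  rewrite (le_trans (dist N k))// lerBlDr lerDl.
  by rewrite !mulr_ge0// ltW.
have cx : cvgn x_.
  apply/cauchy_cvgP/cauchy_exP => e e0.
  have : (2 * H) * 2^-1 ^+ n @[n --> \oo] --> (2 * H) * 0.
    by apply: cvgMr; apply: cvg_expr; rewrite ger0_norm//; lra.
  rewrite mulr0 => /cvgrPdist_lt /(_ _ e0) [N _ hN].
  exists (x_ N); exists N => // n /= Nn; rewrite /ball /=.
  rewrite distrC -(subnKC Nn); apply: le_lt_trans (dist' _ _) _.
  have := hN N (leqnn N); rewrite /= sub0r normrN ger0_norm//.
  by rewrite !mulr_ge0// ltW.
exists (limn x_) => // N.
have : `|x_ N - limn x_| <= 2 * H * 2^-1 ^+ N.
  have c1 : `|x_ N - x_ n| @[n --> \oo] --> `|x_ N - limn x_|.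
    by apply: cvg_norm; apply: cvgB => //; exact: cvg_cst.
  rewrite -(cvg_lim _ c1)//; apply: limr_le; first by apply/cvg_ex; eexists; exact: c1.
  exists N => // n /= Nn; rewrite distrC -(subnKC Nn); exact: dist'.
move=> h; have := h; rewrite -(@ler_pXn2r _ 2) ?nnegrE ?mulr_ge0 ?(ltW (p2 N))//.
rewrite real_normK ?num_real// => /le_trans; apply.
rewrite !exprMn -exprM mulnC exprM.
rewrite (_ : 2^-1 ^+ 2 = 4^-1 :> R); last by field.
by rewrite le_eqVlt; apply/orP; left; apply/eqP; ring.
Qed.

(** Riesz-Fischer with a rate. Weighting the squared increments by 4^n leaves a series with integral
    at most the sum of 2^-n, so its sum [h] is finite almost everywhere; there [geometric_steps_cvg]
    yields a limit with error 4 * 4^-N * h, and integrating gives the factor 8. *)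
Lemma sqint_complete (u_ : nat -> T -> R) : (forall n, sqint (u_ n)) ->
  (forall n, ip (fun x => u_ n.+1 x - u_ n x) (fun x => u_ n.+1 x - u_ n x)
     <= 8^-1 ^+ n) ->
  exists2 u, sqint u &
    forall N, ip (fun x => u_ N x - u x) (fun x => u_ N x - u x)
      <= 8 * 4^-1 ^+ N.
Proof.
move=> hu hd.
pose t n x := 4 ^+ n * (u_ n.+1 x - u_ n x) ^+ 2.
have sd n : sqint (fun x => u_ n.+1 x - u_ n x) by exact: sqintB.
have t0 n x : 0 <= t n x by rewrite mulr_ge0 ?sqr_ge0// exprn_ge0.
have mt n : measurable_fun D (fun x => (t n x)%:E).
  apply/measurable_EFinP; apply: measurable_funM; first exact: measurable_cst.
  by apply: measurable_funX; exact: (sd n).1.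
pose h x := (\sum_(n <oo) (t n x)%:E)%E.
have h0 x : (0 <= h x)%E by apply: nneseries_ge0 => n _ _; rewrite lee_fin.
have mh : measurable_fun D h.
  by apply: ge0_emeasurable_sum => // n x _ _; rewrite lee_fin.
have ih : (\int[mu]_(x in D) h x <= 2%:E)%E.
  rewrite integral_nneseries//; last by move=> n x _; rewrite lee_fin.
  have -> : 2%:E = (\sum_(n <oo) ((2^-1 : R) ^+ n)%:E)%E.
    have : [series (2^-1 : R) ^+ n]_n @ \oo --> (2 : R).
      have := @cvg_geometric_series R 1 2^-1; rewrite mul1r.
      have -> : (1 - 2^-1)^-1 = 2 :> R by field.
      rewrite (_ : geometric 1 2^-1 = (fun n => 2^-1 ^+ n)); last first.
        by apply/funext => n; rewrite /geometric /= mul1r.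
      by apply; rewrite ger0_norm//; lra.
    move=> cs; apply/esym; apply: cvg_lim => //.
    apply/fine_cvgP; split; first by apply: nearW => n; rewrite sumEFin.
    by under eq_fun do rewrite /= sumEFin /=.
  apply: lee_nneseries => [n _ _|n _].
    by apply: integral_ge0 => x _; rewrite lee_fin.
  under eq_integral do rewrite EFinM.
  rewrite (@ge0_integralZl_EFin _ _ _ _ _ mD (fun x => ((u_ n.+1 x - u_ n x) ^+ 2)%:E)); last 3 first.
  - move=> x _; exact: sqr_ge0.
  - by apply/measurable_EFinP; apply: measurable_funX; exact: (sd n).1.
  - by rewrite exprn_ge0.
  rewrite -ip_EFin// -EFinM lee_fin.
  apply: (le_trans (ler_wpM2l _ (hd n))); first by rewrite exprn_ge0.
  rewrite -exprMn (_ : 4 * 8^-1 = 2^-1 :> R)//; by field.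
have inth : mu.-integrable D h.
  apply/integrableP; split => //.
  under eq_integral do rewrite gee0_abs//.
  by rewrite (le_lt_trans ih)// ltry.
pose A := D `&` [set x | (h x < +oo)%E].
have mA : measurable A by apply: emeasurable_fun_infty_o.
have cvg_x x : exists l : R, A x -> u_ n x @[n --> \oo] --> l /\
    forall N, ((u_ N x - l) ^+ 2 <= 4 * 4^-1 ^+ N * fine (h x)).
  have [[Dx hx]|] := pselect (A x); last by exists 0.
  have fh : h x \is a fin_num by rewrite ge0_fin_numE.
  have [] := @geometric_steps_cvg (u_^~ x) (Num.sqrt (fine (h x))).
  - exact: sqrtr_ge0.
  - move=> n; rewrite sqr_sqrtr ?fine_ge0// -lee_fin fineK//.
    apply: le_trans (nneseries_lim_ge n.+1 _); last by move=> k _ _; rewrite lee_fin.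
    rewrite big_nat_recr//= leeDr//; apply: sume_ge0 => k _; exact: t0.
  - move=> l cl hl; exists l => _; split => // N.
    by have := hl N; rewrite sqr_sqrtr ?fine_ge0.
have [l hl] := choice cvg_x.
(* Off [A] the limit is set to 0; the pointwise error bound survives there because [h] is
   infinite. *)
pose u x := l x * \1_A x.
have mul : measurable_fun D u.
  apply: (@measurable_fun_cvg _ _ _ _ (fun n x => u_ n x * \1_A x)).
    by move=> n; apply: measurable_funM; [exact: (hu n).1|exact: measurable_indic].
  move=> x Dx; rewrite /u indicE; have [Ax|nAx] := boolP (x \in A).
    by apply: cvgMl; exact: (hl x (set_mem Ax)).1.
  by rewrite /= mulr0; under eq_fun do rewrite mulr0; exact: cvg_cst.
have key N x : D x ->
    (((u_ N x - u x) ^+ 2)%:E <= (4 * 4^-1 ^+ N)%:E * h x)%E.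
  move=> Dx; have [hx|] := boolP (h x < +oo)%E; last first.
    rewrite -leNgt leye_eq => /eqP ->.
    by rewrite gt0_muley ?leey// lte_fin mulr_gt0// exprn_gt0.
  have Ax : A x by [].
  rewrite -[h x]fineK ?ge0_fin_numE// -EFinM lee_fin.
  by rewrite /u indicE mem_set// mulr1; exact: (hl x Ax).2.
have iN N : (\int[mu]_(x in D) ((u_ N x - u x) ^+ 2)%:E <= (8 * 4^-1 ^+ N)%:E)%E.
  apply: (@le_trans _ _ (\int[mu]_(x in D) ((4 * 4^-1 ^+ N)%:E * h x))%E).
    apply: ge0_le_integral => //.
    - by move=> x _; rewrite lee_fin sqr_ge0.
    - apply/measurable_EFinP; apply: measurable_funX.
      by apply: measurable_funB => //; exact: (hu N).1.
    - by apply: measurable_funeM.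
    - exact: key.
  have p4 : 0 <= 4 * 4^-1 ^+ N :> R by rewrite mulr_ge0// exprn_ge0.
  rewrite (@ge0_integralZl_EFin _ _ _ _ _ mD h)//.
  apply: le_trans (lee_wpmul2l _ ih) _; first by rewrite lee_fin.
  by rewrite -EFinM lee_fin; lra.
have sN N : sqint (fun x => u_ N x - u x).
  split; last by rewrite (le_lt_trans (iN N))// ltry.
  by apply: measurable_funB => //; exact: (hu N).1.
exists u => [|N]; last by rewrite -lee_fin ip_EFin.
have := sqintB (hu 0%N) (sN 0%N).
by under eq_fun do rewrite subKr.
Qed.

End L2_theory.

(** * Stability of smooth functions, and flat functions *)

Section smooth_closure.
Variables (R : realType) (V : normedModType R).
Implicit Types f g : V -> R.

Lemma smooth_differentiable f : smooth f -> forall x, differentiable f x.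
Proof. by move=> h x; exact: (h [::] x). Qed.

Lemma smooth_derive f v : smooth f -> smooth ('D_v f : V -> R).
Proof. by move=> h s x; have := h (rcons s v) x; rewrite foldr_rcons. Qed.

(** Iterated derivatives never leave [P], so induction on the list of directions suffices. Each
    smoothness proof below consists in finding a class that is stable under differentiation. *)
Lemma smooth_class (P : (V -> R) -> Prop) :
  (forall f, P f -> (forall x, differentiable f x) /\
     forall v, P ('D_v f : V -> R)) ->
  forall f, P f -> smooth f.
Proof.
move=> hP f Pf s x; suff : P (foldr (fun v g => 'D_v g : V -> R) f s).
  by move=> /hP[+ _]; exact.
by elim: s => //= v s /hP[_]; exact.
Qed.

End smooth_closure.

Section smooth_gen.
Variables (R : realType) (V : normedModType R).
Implicit Types f g : V -> R.

(** The algebra generated by the smooth functions and one further function [G]. For G = 1/f and G =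
    sqrt f the derivatives of [G] are polynomials in [G] with smooth coefficients, so they stay in
    it. *)
Inductive smooth_gen (G : V -> R) : (V -> R) -> Prop :=
| SGbase f : smooth f -> smooth_gen G f
| SGgen : smooth_gen G G
| SGadd f g : smooth_gen G f -> smooth_gen G g ->
    smooth_gen G (fun x => f x + g x)
| SGmul f g : smooth_gen G f -> smooth_gen G g ->
    smooth_gen G (fun x => f x * g x)
| SGcomp (F : R -> R) f : smooth F -> smooth_gen G f ->
    smooth_gen G (fun x => F (f x)).

Lemma derive_comp1 (F : R -> R) f x v : differentiable f x ->
  differentiable F (f x) ->
  'D_v (fun y => F (f y)) x = 'D_1 F (f x) * 'D_v f x.
Proof.
move=> df dF.
rewrite -[fun y => F (f y)]/(F \o f) deriveE; last exact: differentiable_comp.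
rewrite diff_comp//= -!deriveE// -[X in 'D_X F _](mulr1).
rewrite -[X in 'D_X F _]/('D_v f x *: (1 : R)) deriveE// linearZ /= -deriveE//.
by rewrite mulrC.
Qed.

Lemma smooth_genP G : (forall x, differentiable G x) ->
  (forall v, smooth_gen G ('D_v G : V -> R)) ->
  forall f, smooth_gen G f -> smooth f.
Proof.
move=> dG hG; apply: smooth_class => f; elim => {f}.
- move=> f sf; split; first exact: smooth_differentiable.
  by move=> v; apply: SGbase; exact: smooth_derive.
- by [].
- move=> f g hf [df If] hg [dg Ig]; split => [x|v]; first exact: differentiableD.
  rewrite (_ : 'D_v _ = fun x => 'D_v f x + 'D_v g x); first exact: SGadd.
  by apply/funext => x; rewrite deriveD//; exact: diff_derivable.
- move=> f g hf [df If] hg [dg Ig]; split => [x|v]; first exact: differentiableM.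
  rewrite (_ : 'D_v _ = fun x => f x * 'D_v g x + g x * 'D_v f x).
    by apply: SGadd; exact: SGmul.
  by apply/funext => x; rewrite deriveM//; exact: diff_derivable.
- move=> F f sF hf [df If]; have dF := smooth_differentiable sF; split=> [x|v].
    by apply: (@differentiable_comp _ _ _ _ f F).
  rewrite (_ : 'D_v _ = fun x => 'D_1 F (f x) * 'D_v f x).
    by apply: SGmul => //; apply: (@SGcomp _ ('D_1 F)) => //; exact: smooth_derive.
  by apply/funext => x; rewrite derive_comp1.
Qed.

Lemma smooth_cst (c : R) : smooth (fun _ : V => c).
Proof.
apply: (@smooth_class _ _ (fun f => exists c, f = cst c)); last by exists c.
move=> f [k ->]; split => [x|v]; first exact: differentiable_cst.
by exists 0; apply/funext => x; rewrite derive_cst.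
Qed.

(** With the trivial generator 0 the class reduces to sums, products and compositions of smooth
    functions, whose smoothness then comes out all at once. *)
Lemma smooth_gen0 f : smooth_gen (fun=> 0) f -> smooth f.
Proof.
apply: smooth_genP; first by move=> x; exact: (@differentiable_cst _ _ _ 0).
move=> v; apply: SGbase; exact: smooth_derive (smooth_cst 0).
Qed.

Lemma smoothD f g : smooth f -> smooth g -> smooth (fun x => f x + g x).
Proof. by move=> hf hg; apply: smooth_gen0; apply: SGadd; exact: SGbase. Qed.

Lemma smoothM f g : smooth f -> smooth g -> smooth (fun x => f x * g x).
Proof. by move=> hf hg; apply: smooth_gen0; apply: SGmul; exact: SGbase. Qed.

Lemma smooth_comp (F : R -> R) f : smooth F -> smooth f ->
  smooth (fun x => F (f x)).
Proof. by move=> hF hf; apply: smooth_gen0; apply: SGcomp => //; exact: SGbase. Qed.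

Lemma smoothZ c f : smooth f -> smooth (fun x => c * f x).
Proof. by move=> hf; apply: smoothM => //; exact: smooth_cst. Qed.

Lemma smoothN f : smooth f -> smooth (fun x => - f x).
Proof. by move=> /(smoothZ (-1)); under eq_fun do rewrite mulN1r. Qed.

Lemma smoothB f g : smooth f -> smooth g -> smooth (fun x => f x - g x).
Proof. by move=> hf hg; apply: smoothD => //; exact: smoothN. Qed.

Lemma smoothX n f : smooth f -> smooth (fun x => f x ^+ n).
Proof.
move=> sf; elim: n => [|n IH].
  by under eq_fun do rewrite expr0; exact: smooth_cst.
by under eq_fun do rewrite exprS; exact: smoothM.
Qed.

Lemma smooth_linear (f : {linear V -> R}) : continuous f -> smooth f.
Proof.
move=> cf; apply: (@smooth_class _ _ (fun g => g = f \/ exists c, g = cst c)); last by left.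
move=> g [->|[c ->]]; (split; [move=> x|move=> v]).
- exact: linear_differentiable.
- right; exists (f v); apply/funext => x.
  by rewrite deriveE ?diff_lin//; exact: linear_differentiable.
- exact: differentiable_cst.
- by right; exists 0; apply/funext => x; rewrite derive_cst.
Qed.

Lemma smoothV f : smooth f -> (forall x, f x != 0) -> smooth (fun x => (f x)^-1).
Proof.
move=> sf f0; set G := fun x => _.
have dG x : differentiable G x.
  apply: (@differentiable_comp _ _ _ _ f (@GRing.inv R)).
    exact: smooth_differentiable.
  by apply/derivable1_diffP/derivableV => //.
apply: (@smooth_genP G) => //; last exact: SGgen.
move=> v; rewrite (_ : 'D_v G = fun x => (fun x => G x * G x) x * (- 'D_v f x)).
  apply: SGmul; first by apply: SGmul; exact: SGgen.
  apply: SGbase; apply: smoothN; exact: smooth_derive.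
apply/funext => x; have df := smooth_differentiable sf x.
rewrite /G deriveV//; last exact: diff_derivable.
by rewrite -exprVn expr2 /GRing.scale /= mulrN mulNr.
Qed.

Lemma smooth_sqrt f : smooth f -> (forall x, 0 < f x) ->
  smooth (fun x => Num.sqrt (f x)).
Proof.
move=> sf f0; set G := fun x => _.
have dS x : is_derive (f x) 1 (@Num.sqrt R) (2 * Num.sqrt (f x))^-1.
  exact: is_derive1_sqrt.
have dG x : differentiable G x.
  apply: (@differentiable_comp _ _ _ _ f (@Num.sqrt R)).
    exact: smooth_differentiable.
  by apply/derivable1_diffP; have := dS x => -[].
apply: (@smooth_genP G) => //; last exact: SGgen.
move=> v.
rewrite (_ : 'D_v G = fun x => (2^-1 * 'D_v f x * (f x)^-1) * G x).
  apply: SGmul; last exact: SGgen.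
  apply: SGbase; apply: smoothM; last first.
    by apply: smoothV => // x; rewrite gt_eqF.
  by apply: smoothZ; exact: smooth_derive.
apply/funext => x; have df := smooth_differentiable sf x.
rewrite /G derive_comp1//; last by apply/derivable1_diffP; have := dS x => -[].
have := dS x => -[_ ->].
have s0 : Num.sqrt (f x) != 0 by rewrite gt_eqF// sqrtr_gt0.
rewrite -[in (f x)^-1](@sqr_sqrtr _ (f x)) ?ltW//.
by field.
Qed.

End smooth_gen.

Section plane_coordinates.
Variable R : realType.

Lemma smooth_fst : smooth (fst : R * R -> R).
Proof. by apply: (@smooth_linear _ _ fst) => x; exact: cvg_fst. Qed.

Lemma smooth_snd : smooth (snd : R * R -> R).
Proof. by apply: (@smooth_linear _ _ snd) => x; exact: cvg_snd. Qed.

Lemma smooth_id : smooth (id : R -> R).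
Proof. by apply: (@smooth_linear _ R idfun) => x. Qed.

End plane_coordinates.

Section bump.
Variable R : realType.
Implicit Types x y t : R.

(** The flat function exp(-1/x), extended by 0 and multiplied by x^-n: the powers are there because
    differentiation raises them. *)
Definition expinv (n : nat) (x : R) : R :=
  if 0 < x then x^-1 ^+ n * expR (- x^-1) else 0.

Lemma expinv_ge0 n x : 0 <= expinv n x.
Proof.
rewrite /expinv; case: ifPn => // x0.
by rewrite mulr_ge0 ?expR_ge0// exprn_ge0// invr_ge0 ltW.
Qed.

Lemma expinv_gt0 n x : 0 < x -> 0 < expinv n x.
Proof.
by move=> x0; rewrite /expinv x0 mulr_gt0 ?expR_gt0// exprn_gt0// invr_gt0.
Qed.

Lemma expinv_le0 n x : x <= 0 -> expinv n x = 0.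
Proof. by rewrite /expinv leNgt => /negbTE ->. Qed.

(** With y = 1/x this is y^n <= n! e^y. *)
Lemma expinv_le n x : expinv n x <= n`!%:R.
Proof.
rewrite /expinv; case: ifPn => // x0.
have y0 : 0 <= x^-1 by rewrite invr_ge0 ltW.
rewrite expRN ler_pdivrMr ?expR_gt0//.
case: n => [|n].
  by rewrite expr0 fact0 mul1r; have := expR_ge1Dx x^-1; lra.
have := expR_ge1Dxn n y0; rewrite -ler_pdivrMl ?ltr0n ?fact_gt0//.
by rewrite mulrC; lra.
Qed.

Lemma expinvS n x : 0 < x -> expinv n x = x * expinv n.+1 x.
Proof.
by move=> x0; rewrite /expinv x0 exprS !mulrA mulfV ?mul1r// gt_eqF.
Qed.

Lemma is_derive_expinv n x :
  is_derive x 1 (expinv n) (expinv n.+2 x - n%:R * expinv n.+1 x).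
Proof.
have [x0|x0|->] := ltgtP x 0.
- rewrite !expinv_le0 ?ltW// mulr0 subr0.
  apply: (@near_eq_is_derive _ _ _ (cst 0)).
    near=> y; rewrite expinv_le0//; apply: ltW; near: y; exact: lt_nbhsl.
- rewrite /expinv x0.
  have xn0 : x != 0 by rewrite gt_eqF.
  apply: (@near_eq_is_derive _ _ _ (fun x => x^-1 ^+ n * expR (- x^-1))).
    near=> y; rewrite ifT//; near: y; exact: lt_nbhsr.
  have dV : is_derive x 1 (fun x => x^-1) (- x^-1 ^+ 2).
    apply: is_derive_eq; first exact: (@is_deriveV R id x 1 1 xn0 _).
    by rewrite -exprVn /GRing.scale /= mulr1.
  have dX : is_derive x 1 (fun x => x^-1 ^+ n) (- (n%:R * x^-1 ^+ n.+1)).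
    have := @is_deriveX R R (fun x => x^-1) n x 1 _ dV.
    rewrite (_ : (fun x => x^-1) ^+ n = (fun x => x^-1 ^+ n)); last first.
      by apply/funext => z; rewrite fctE.
    move=> h; apply: is_derive_eq.
    rewrite /GRing.scale /= -mulr_natl; case: (n) => [|m]; first by rewrite !mul0r oppr0.
    by rewrite /= !exprS expr0; ring.
  have dE : is_derive x 1 (fun x => expR (- x^-1)) (x^-1 ^+ 2 * expR (- x^-1)).
    have h := @is_derive1_comp R expR (fun x => - x^-1) x _ _
      (is_derive_expR (- x^-1)) (is_deriveN dV).
    by rewrite opprK mulrC in h.
  refine (@is_derive_eq _ _ _ _ _ _ _ _ (is_deriveM dX dE) _).
  by rewrite /GRing.scale /= !exprS expr0; ring.
rewrite !expinv_le0// mulr0 subr0.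
(* At 0 the difference quotient for h > 0 is h times [expinv n.+2 h], hence at most (n+2)! h. *)
have key : h^-1 *: (expinv n (h + 0) - expinv n 0) @[h --> 0^'] --> (0 : R).
  apply: (@squeeze_cvgr _ _ _ _ (fun h : R => - ((n.+2)`!%:R * `|h|))
     (fun h : R => (n.+2)`!%:R * `|h|)).
  - near=> h; rewrite addr0 (expinv_le0 n (lexx _)) subr0 -ler_norml.
    rewrite /GRing.scale /= normrM normfV.
    have [h0|h0] := ltP 0 h; last by rewrite expinv_le0// normr0 mulr0 mulr_ge0.
    rewrite (ger0_norm (expinv_ge0 _ _)) (gtr0_norm h0) ler_pdivrMl//.
    rewrite expinvS// ler_pM2l// expinvS// mulrC ler_pM2r//.
    exact: expinv_le.
  - rewrite -[X in _ --> X]oppr0 -[X in _ --> - X](mulr0 ((n.+2)`!%:R)).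
    apply: cvgN; apply: cvgMr; rewrite -[X in _ --> X](@normr0 _ R).
    by apply: cvg_norm; exact: nbhs_dnbhs.
  - rewrite -[X in _ --> X](mulr0 ((n.+2)`!%:R)).
    apply: cvgMr; rewrite -[X in _ --> X](@normr0 _ R).
    by apply: cvg_norm; exact: nbhs_dnbhs.
have key' : h^-1 *: (expinv n (h *: 1 + 0) - expinv n 0) @[h --> 0^'] --> (0 : R).
  by under eq_fun do rewrite [_ *: 1]mulr1.
apply: DeriveDef; first by apply/cvg_ex; exists 0; exact: key'.
exact: cvg_lim key'.
Unshelve. all: by end_near. Qed.

Inductive expinv_span : (R -> R) -> Prop :=
| ESbase n : expinv_span (expinv n)
| ESadd f g : expinv_span f -> expinv_span g -> expinv_span (fun x => f x + g x)
| ESscale c f : expinv_span f -> expinv_span (fun x => c * f x).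

Lemma derive_scale (f : R -> R) x (v : R) : differentiable f x ->
  'D_v f x = v * 'D_1 f x.
Proof.
move=> df; rewrite !deriveE//.
by rewrite -[X in 'd f x X](mulr1 v) -[v * 1]/(v *: (1 : R)) linearZ.
Qed.

Lemma smooth_expinv n : smooth (expinv n).
Proof.
apply: (@smooth_class _ _ expinv_span); last exact: ESbase.
move=> f; elim => {f} [m|f g hf [df If] hg [dg Ig]|c f hf [df If]].
- have dm x : differentiable (expinv m) x.
    by apply/derivable1_diffP; have [] := is_derive_expinv m x.
  split => // v.
  rewrite (_ : 'D_v _ = fun x => v * (expinv m.+2 x + (- m%:R) * expinv m.+1 x)).
    by apply: ESscale; apply: ESadd; [exact: ESbase|apply: ESscale; exact: ESbase].
  apply/funext => x; rewrite derive_scale//.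
  by have [_ ->] := is_derive_expinv m x; rewrite mulNr.
- split=> [x|v]; first exact: differentiableD.
  rewrite (_ : 'D_v _ = fun x => 'D_v f x + 'D_v g x); first exact: ESadd.
  by apply/funext => x; rewrite deriveD//; exact: diff_derivable.
- split=> [x|v]; first exact: (@differentiableZ _ _ _ f c).
  rewrite (_ : 'D_v _ = fun x => c * 'D_v f x); first exact: ESscale.
  by apply/funext => x; rewrite [LHS]deriveZ//; exact: diff_derivable.
Qed.

End bump.

(** * Test functions, smooth bumps on rectangles and rational boxes *)

Section test_functions.
Variables (R : realType) (Omega : set (R * R)).
Implicit Types f g : R * R -> R.

Lemma test_funI f (K : set (R * R)) : smooth f -> compact K -> K `<=` Omega ->
  (forall x, ~ K x -> f x = 0) -> test_fun Omega f.
Proof.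
move=> sf cK KO fK.
have clK : closed K by apply: compact_closed => //; exact: norm_hausdorff.
have sub : closure [set x | f x != 0] `<=` K.
  rewrite closureE => x; apply; split => // y /= fy.
  by apply: contrapT => /fK fy0; rewrite fy0 eqxx in fy.
split => //; last exact: subset_trans KO.
by apply: subclosed_compact sub => //; exact: closed_closure.
Qed.

Lemma test_fun_off f x : ~ closure [set x | f x != 0] x -> f x = 0.
Proof.
move=> h; apply/eqP; apply: contra_notT h => fx; exact: subset_closure.
Qed.

Lemma test_smooth f : test_fun Omega f -> smooth f.
Proof. by case. Qed.

Lemma test_outside f x : test_fun Omega f -> ~ Omega x -> f x = 0.
Proof. by move=> [_ _ h] Ox; apply: test_fun_off => /h. Qed.

Lemma test_sub f g : test_fun Omega f -> smooth g ->
  (forall x, ~ closure [set x | f x != 0] x -> g x = 0) -> test_fun Omega g.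
Proof. by move=> [_ cf fO] sg h; exact: (test_funI sg cf fO h). Qed.

Lemma testD f g : test_fun Omega f -> test_fun Omega g ->
  test_fun Omega (fun x => f x + g x).
Proof.
move=> [sf cf fO] [sg cg gO].
apply: (@test_funI _ (closure [set x | f x != 0] `|` closure [set x | g x != 0])).
- exact: smoothD.
- exact: compactU.
- by rewrite subUset.
- move=> x /not_orP[hf hg]; by rewrite (test_fun_off hf) (test_fun_off hg) addr0.
Qed.

Lemma testMl f g : test_fun Omega f -> smooth g ->
  test_fun Omega (fun x => g x * f x).
Proof.
move=> tf sg; apply: (test_sub tf); first by apply: smoothM => //; case: tf.
by move=> x h; rewrite (test_fun_off h) mulr0.
Qed.

Lemma testZ c f : test_fun Omega f -> test_fun Omega (fun x => c * f x).
Proof. by move=> tf; apply: testMl => //; exact: smooth_cst. Qed.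

Lemma testN f : test_fun Omega f -> test_fun Omega (fun x => - f x).
Proof. by move=> /(testZ (-1)); under eq_fun do rewrite mulN1r. Qed.

Lemma test_comp (F : R -> R) f : smooth F -> F 0 = 0 -> test_fun Omega f ->
  test_fun Omega (fun x => F (f x)).
Proof.
move=> sF F0 tf; apply: (test_sub tf).
  by apply: smooth_comp => //; case: tf.
by move=> x h; rewrite (test_fun_off h).
Qed.

Lemma derive_near0 f x v : (\near x, f x = 0) -> 'D_v f x = 0.
Proof. by move=> h; rewrite (near_eq_derive _ h) derive_cst. Qed.

Lemma test_derive f v : test_fun Omega f -> test_fun Omega ('D_v f : R * R -> R).
Proof.
move=> tf; apply: (test_sub tf); first by apply: smooth_derive; case: tf.
move=> x h; apply: derive_near0.
have oc : open (~` closure [set x | f x != 0]) by apply: closed_openC; exact: closed_closure.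
have : nbhs x (~` closure [set x | f x != 0]) by apply: open_nbhs_nbhs.
by apply: filterS => y; exact: test_fun_off.
Qed.

Lemma test0 : test_fun Omega (fun=> 0).
Proof.
apply: (@test_funI _ set0) => //; first exact: smooth_cst.
exact: compact0.
Qed.

End test_functions.

Section boxes.
Variable R : realType.
Implicit Types (a b c d : R).

Definition box_bump (n : R) a b c d (x : R * R) : R :=
  (expinv 0 (n * (x.1 - a)) * expinv 0 (n * (b - x.1))) *
  (expinv 0 (n * (x.2 - c)) * expinv 0 (n * (d - x.2))).

Lemma smooth_box_bump n a b c d : smooth (box_bump n a b c d).
Proof.
have e (g : R * R -> R) : smooth g -> smooth (fun x => expinv 0 (n * g x)).
  by move=> sg; apply: (@smooth_comp _ _ (expinv 0)); [exact: smooth_expinv|exact: smoothZ].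
have s1 := @smooth_fst R; have s2 := @smooth_snd R.
apply: smoothM; apply: smoothM; apply: e; apply: smoothB => //; exact: smooth_cst.
Qed.

Lemma box_bump_ge0 n a b c d x : 0 <= box_bump n a b c d x.
Proof. by rewrite /box_bump !mulr_ge0// expinv_ge0. Qed.

Lemma box_bump_le1 n a b c d x : box_bump n a b c d x <= 1.
Proof.
have e1 t : expinv 0 t <= 1 :> R by have := expinv_le 0 t; rewrite fact0.
have e0 t : 0 <= expinv 0 t :> R by exact: expinv_ge0.
by rewrite /box_bump !mulr_ile1// ?mulr_ge0// mulr_ile1.
Qed.

Lemma box_bump_gt0 n a b c d x : 0 < n -> a < x.1 < b -> c < x.2 < d ->
  0 < box_bump n a b c d x.
Proof.
move=> n0 /andP[? ?] /andP[? ?].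
by rewrite /box_bump !mulr_gt0// expinv_gt0// mulr_gt0// subr_gt0.
Qed.

Lemma box_bump_off n a b c d x : 0 < n ->
  ~ (a < x.1 < b /\ c < x.2 < d) -> box_bump n a b c d x = 0.
Proof.
move=> n0 h; apply/eqP; apply: contra_notT h; rewrite /box_bump !mulf_eq0 !negb_or.
have e t : expinv 0 (n * t) != 0 -> 0 < t.
  apply: contraNT; rewrite -leNgt => t0.
  by rewrite expinv_le0// pmulr_rle0.
move=> /andP[/andP[/e h1 /e h2] /andP[/e h3 /e h4]].
by rewrite -(subr_gt0 a) -(subr_gt0 x.1 b) h1 h2 -(subr_gt0 c) -(subr_gt0 x.2 d) h3 h4.
Qed.

Lemma test_box_bump (Omega : set (R * R)) n a b c d : 0 < n ->
  `[a, b] `*` `[c, d] `<=` Omega -> test_fun Omega (box_bump n a b c d).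
Proof.
move=> n0 sub; apply: (test_funI _ _ sub).
- exact: smooth_box_bump.
- by apply: compact_setX; exact: segment_compact.
- move=> x h; apply: box_bump_off => // -[/andP[? ?] /andP[? ?]]; apply: h.
  by split => /=; rewrite in_itv/= !ltW.
Qed.

(** Balls of the product norm are squares. Rational centres and radii give a countable base, through
    which local statements about null sets become global. *)
Definition qbox (p : rat * rat * rat) : set (R * R) :=
  ball ((ratr p.1.1, ratr p.1.2) : R * R) (ratr p.2 : R).

(** The factor one half leaves room for a bump that is positive at [x] and has its support inside
    the box. *)
Lemma qbox_nbhs_half (x : R * R) (U : set (R * R)) : nbhs x U ->
  exists p, [/\ 0 < ratr p.2 :> R,
    ball ((ratr p.1.1, ratr p.1.2) : R * R) (ratr p.2 / 2 : R) x &
    qbox p `<=` U].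
Proof.
move=> /nbhs_ballP[r /= r0 rU].
have r8 : 0 < r / 8 by lra.
have [q1] := @dense_rat R (ball x.1 (r / 8)) (ex_intro _ x.1 (ballxx x.1 r8)) (ball_open x.1 (r / 8)).
move=> [/= b1 [p1 _ e1]].
have [q2] := @dense_rat R (ball x.2 (r / 8)) (ex_intro _ x.2 (ballxx x.2 r8)) (ball_open x.2 (r / 8)).
move=> [/= b2 [p2 _ e2]].
have h1 : r / 4 < r / 2 by lra.
have [p3] := rat_in_itvoo h1; rewrite in_itv/= => /andP[p3a p3b].
move: b1 b2; rewrite -e1 -e2 /ball/= => b1 b2.
exists (p1, p2, p3); split => /=; first by lra.
  by split; rewrite /ball/= distrC; lra.
move=> y [/= y1 y2]; apply: rU; split; rewrite /ball/=; move: y1 y2; rewrite /ball/=.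
  move=> y1 _; rewrite (le_lt_trans (ler_distD (ratr p1) _ _))//; lra.
move=> _ y1; rewrite (le_lt_trans (ler_distD (ratr p2) _ _))//; lra.
Qed.

Lemma qbox_nbhs (x : R * R) (U : set (R * R)) : nbhs x U ->
  exists p, qbox p x /\ qbox p `<=` U.
Proof.
move=> /qbox_nbhs_half[p [p0 px pU]]; exists p; split => //.
by apply: le_ball px; lra.
Qed.

End boxes.

(** * Measurability in the plane and null sets *)

Section plane_measurability.
Variable R : realType.
Local Notation P := (measurableTypeR R * measurableTypeR R)%type.

Global Instance ae_mu2_filter : Filter (nbhs (almost_everywhere (@mu2 R))).
Proof. exact: (@ae_filter_ringOfSetsType _ P R (@mu2 R)). Qed.

Lemma measurable_qbox p : measurable (@qbox R p : set P).
Proof. by apply: measurableX; exact: measurable_ball. Qed.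

Lemma open_measurable2 (U : set (R * R)) : open U -> measurable (U : set P).
Proof.
move=> oU.
have -> : U = \bigcup_(p in [set p | qbox p `<=` U]) qbox p.
  apply/seteqP; split => [x Ux|x [p]]; last by move=> h /h.
  have [p [h1 h2]] := qbox_nbhs (open_nbhs_nbhs (conj oU Ux)).
  by exists p.
rewrite bigcup_mkcond.
apply: (@countable_bigcupT_measurable _ P _ _) => [|p]; first exact: countableP.
by case: ifPn => _; [exact: measurable_qbox|exact: measurable0].
Qed.

Lemma continuous_measurable2 (f : R * R -> R) : continuous f ->
  measurable_fun [set: P] (f : P -> R).
Proof.
move=> /continuousP cf; apply: (measurability _ (RGenOpens.measurableE R)) => //.
move=> _ [_ [a [b ->] <-]]; rewrite setTI.
by apply: open_measurable2; apply: cf; exact: interval_open.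
Qed.

(** There are only countably many rational boxes, so the null sets attached to those boxes on which
    [Q] holds almost everywhere have a null union. *)
Lemma ae_locally (Omega : set (R * R)) (Q : R * R -> Prop) :
  (forall x, Omega x -> exists2 U : set (R * R), nbhs x U &
      {ae @mu2 R, forall y, U y -> Q y}) ->
  {ae @mu2 R, forall y, Omega y -> Q y}.
Proof.
move=> h.
pose S := [set p : rat * rat * rat | {ae @mu2 R, forall y, qbox p y -> Q y}].
(* Boxes on which the property is not known are replaced by the empty set, so that one countable
   intersection runs over all indices. *)
pose F p := if p \in S then qbox p else set0 : set (R * R).
have aeF p : {ae @mu2 R, forall y, F p y -> Q y}.
  rewrite /F; case: ifPn => [/set_mem //|_].
  by apply: aeW => y.
have : {ae @mu2 R, forall y, forall p, F p y -> Q y}.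
  pose g n := if unpickle n is Some p then F p else set0.
  have : {ae @mu2 R, forall y, forall n, g n y -> Q y}.
    apply/ae_foralln => n; rewrite /g; case: unpickle => [p|]; first exact: aeF.
    by apply: aeW => y.
  apply: filterS => y hy p; have := hy (pickle p); by rewrite /g pickleK.
apply: filterS => y hy Oy.
have [U nU aeU] := h y Oy; have [p [py pU]] := qbox_nbhs nU.
apply: (hy p); rewrite /F mem_set//.
by apply: filterS aeU => z hz /pU; exact: hz.
Qed.

End plane_measurability.

(** * Calculus on lines, slices of the plane and integration by parts for test functions *)

Section compactly_supported_calculus.
Variable R : realType.
Local Notation mu := (@lebesgue_measure R).
Variables (g dg : R -> R).
Hypothesis dgE : forall x : R, is_derive x (1 : R) g (dg x).
Hypothesis cdg : continuous dg.

Lemma integral_derive a b : a < b ->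
  (\int[mu]_(x in `[a, b]) (dg x)%:E = (g b)%:E - (g a)%:E)%E.
Proof.
move=> ab.
have cg : continuous g.
  by move=> x; apply/differentiable_continuous/derivable1_diffP; have [] := dgE x.
apply: (@continuous_FTC2 _ dg g) => //.
- exact: continuous_subspaceT.
- split; first by move=> x _; have [] := dgE x.
  + exact/cvg_at_right_filter/cg.
  + exact/cvg_at_left_filter/cg.
- by move=> x _; rewrite derive1E; have [_] := dgE x.
Qed.

Variable L : R.
Hypothesis L0 : 0 < L.
Hypothesis gL : forall x, L <= `|x| -> g x = 0.

Let dgL x : L < `|x| -> dg x = 0.
Proof.
move=> Lx; have [_ <-] := dgE x; rewrite (@near_eq_derive _ _ _ _ (cst 0)) ?derive_cst//.
near=> y; rewrite gL//; apply: ltW; near: y.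
have : `|y| @[y --> x] --> `|x| by exact: norm_continuous.
by move=> /cvgr_gt; exact.
Unshelve. all: by end_near. Qed.

Lemma integral_derive0 : (\int[mu]_x (dg x)%:E = 0)%E.
Proof.
have h : - (2 * L) < 2 * L by move: L0; lra.
have := integral_derive h; rewrite !gL; last 2 first.
- by rewrite ?normrN ger0_norm; move: L0; lra.
- by rewrite ?normrN ger0_norm; move: L0; lra.
rewrite sube0 => e; apply: etrans e.
rewrite [RHS]integral_mkcond; apply: eq_integral => x _.
rewrite patchE; case: ifPn => // /negP xL; rewrite dgL//.
rewrite ltNge; apply/negP => xle; apply: xL; apply/mem_set => /=.
by rewrite in_itv/= -ler_norml; move: L0 xle; lra.
Qed.

Lemma norm_le_integral_derive x : (`|g x|%:E <= \int[mu]_y `|dg y|%:E)%E.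
Proof.
have mdg : measurable_fun setT dg by exact: continuous_measurable_fun.
have mn : measurable_fun setT (fun y => `|dg y|%:E).
  by apply/measurable_EFinP; apply: measurableT_comp.
have [xL|xL] := leP L `|x|.
  by rewrite gL// normr0; apply: integral_ge0.
have h : - (2 * L) < x by move: L0 xL; rewrite ltr_norml => ? /andP[]; lra.
have := integral_derive h; rewrite [g (- _)]gL ?sube0; last first.
  by rewrite normrN ger0_norm; move: L0; lra.
move=> e; rewrite -[X in (X <= _)%E]abse_EFin -e.
apply: (le_trans (le_abse_integral _ _ _)) => //.
  by apply/measurable_EFinP; exact: measurable_funTS.
by apply: ge0_subset_integral.
Qed.

End compactly_supported_calculus.

Section slices.
Variable R : realType.
Implicit Types f : R * R -> R.

(** [s] runs along [dir R i] and [t] is the transverse coordinate; both axes are then covered by one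
    argument. *)
Definition dir_slice (i : bool) (t s : R) : R * R := if i then (t, s) else (s, t).

Lemma is_derive_slice f i t s : smooth f ->
  is_derive (s : R) (1 : R) (fun s => f (dir_slice i t s) : R) ('D_(dir R i) f (dir_slice i t s)).
Proof.
move=> sf.
have e (h : R) : dir_slice i t (h *: (1 : R) + s) = h *: dir R i + dir_slice i t s.
  rewrite /dir_slice /dir; case: i.
    by transitivity (h * 0 + t, h * 1 + s) => //; rewrite mulr0 add0r.
  by transitivity (h * 1 + s, h * 0 + t) => //; rewrite mulr0 add0r.
have e' : (fun h : R => h^-1 *: (f (dir_slice i t (h *: (1 : R) + s)) - f (dir_slice i t s)))
   = (fun h => h^-1 *: (f (h *: dir R i + dir_slice i t s) - f (dir_slice i t s))).
  by apply/funext => h; rewrite e.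
have d := @diff_derivable _ _ _ f _ (dir R i) (smooth_differentiable sf (dir_slice i t s)).
apply: DeriveDef; first by move: d; rewrite /derivable -e'.
by rewrite /derive e'.
Qed.

Lemma smooth_continuous f : smooth f -> continuous f.
Proof. by move=> sf x; have /differentiable_continuous := smooth_differentiable sf x. Qed.

Lemma continuous_slice i t : continuous (dir_slice i t : R -> R * R).
Proof.
move=> s; rewrite /continuous_at /dir_slice; case: i.
  by apply: (@cvg_pair _ _ _ _ (nbhs t) (nbhs s) _ _ _ (fun=> t) id) => //; exact: cvg_cst.
by apply: (@cvg_pair _ _ _ _ (nbhs s) (nbhs t) _ _ _ id (fun=> t)) => //; exact: cvg_cst.
Qed.

Lemma continuous_slice_comp f i t : continuous f ->
  continuous (fun s => f (dir_slice i t s)).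
Proof.
by move=> cf s; apply: (@continuous_comp _ _ _ (dir_slice i t) f);
  [exact: continuous_slice|exact: cf].
Qed.

Lemma bounded_box (Omega : set (R * R)) : bounded_set Omega ->
  exists2 L, 0 < L & forall x, Omega x -> `|x.1| < L /\ `|x.2| < L.
Proof.
move=> [M [_ hM]]; exists (`|M| + 2); first by rewrite ltr_wpDl.
move=> x Ox; have := hM (`|M| + 1) _ x Ox.
rewrite ltr_pwDr ?ler_norm// => /(_ isT) h.
have : `|x.1| <= `|x| /\ `|x.2| <= `|x|.
  by rewrite /Num.norm /= !le_max !lexx orbT.
by move=> [h1 h2]; split; [apply: le_lt_trans (le_trans h1 h) _|apply: le_lt_trans (le_trans h2 h) _]; lra.
Qed.

Lemma test_slice (Omega : set (R * R)) f L i t s :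
  (forall x, Omega x -> `|x.1| < L /\ `|x.2| < L) -> test_fun Omega f ->
  L <= `|s| -> f (dir_slice i t s) = 0.
Proof.
move=> OL tf Ls; apply: (test_outside tf) => /OL; rewrite /dir_slice.
by case: i => /= -[h1 h2]; move: Ls; rewrite leNgt ?h1 ?h2.
Qed.

End slices.

Section plane_integrals.
Variable R : realType.
Local Notation P := (measurableTypeR R * measurableTypeR R)%type.
Local Notation leb := (@lebesgue_measure R).
Local Notation mu2 := (@mu2 R).

Lemma tonelli_slice i (F : P -> \bar R) : measurable_fun setT F ->
  (forall x, (0 <= F x)%E) ->
  (\int[mu2]_x F x = \int[leb]_t \int[leb]_s F (dir_slice i t s))%E.
Proof.
move=> mF F0; rewrite /dir_slice; case: i.
  exact: (@fubini_tonelli1 _ _ _ _ R leb leb F).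
exact: (@fubini_tonelli2 _ _ _ _ R leb leb F).
Qed.

Lemma measurable_tonelli_slice i (F : P -> \bar R) : measurable_fun setT F ->
  (forall x, (0 <= F x)%E) ->
  measurable_fun setT (fun t => \int[leb]_s F (dir_slice i t s))%E.
Proof.
move=> mF F0; rewrite /dir_slice; case: i.
  exact: (@measurable_fun_fubini_tonelli_F _ _ _ _ R leb F).
exact: (@measurable_fun_fubini_tonelli_G _ _ _ _ R leb F).
Qed.

Lemma fubini_slice i (F : P -> \bar R) : mu2.-integrable setT F ->
  (\int[mu2]_x F x = \int[leb]_t \int[leb]_s F (dir_slice i t s))%E.
Proof.
move=> iF; rewrite /dir_slice; case: i.
  by rewrite -(@integral12_prod_meas1 _ _ _ _ R leb leb F).
by rewrite -(@integral21_prod_meas1 _ _ _ _ R leb leb F).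
Qed.

Lemma mu2_box a b c d : a <= b -> c <= d ->
  mu2 (`[a, b] `*` `[c, d]) = ((b - a) * (d - c))%:E.
Proof.
move=> ab cd.
transitivity (lebesgue_measure (`[a, b]%classic : set R) *
    lebesgue_measure (`[c, d]%classic : set R))%E.
  by apply: (@product_measure1E _ _ _ _ R leb leb).
rewrite !lebesgue_measure_itv/=.
rewrite !lte_fin; move: ab cd; rewrite !le_eqVlt.
move=> /predU1P[->|ab] /predU1P[->|cd]; rewrite ?ltxx ?ab ?cd ?subrr ?mul0r ?mulr0 ?mul0e ?mule0//.
Qed.

Lemma integral_vanish (D : set P) (F : P -> \bar R) :
  (forall x, ~ D x -> F x = 0%E) -> (\int[mu2]_(x in D) F x = \int[mu2]_x F x)%E.
Proof.
move=> F0; rewrite integral_mkcond; apply: eq_integral => x _.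
by rewrite patchE; case: ifPn => // /negP xD; rewrite F0// => /mem_set.
Qed.

End plane_integrals.

Lemma smooth_derivable (R : realType) (V : normedModType R) (f : V -> R) x v :
  smooth f -> derivable f x v.
Proof. by move=> sf; apply: diff_derivable; exact: (smooth_differentiable sf x). Qed.

Section test_integrals.
Variables (R : realType) (Omega : set (R * R)).
Hypothesis oO : open Omega.
Hypothesis bO : bounded_set Omega.
Local Notation P := (measurableTypeR R * measurableTypeR R)%type.
Local Notation leb := (@lebesgue_measure R).
Local Notation mu2 := (@mu2 R).
Implicit Types f g : R * R -> R.

Let mO : measurable (Omega : set P). Proof. exact: open_measurable2. Qed.

Lemma L2E f : L2 Omega f = sqint mu2 (Omega : set P) (f : P -> R).
Proof. by []. Qed.

Lemma mu2_domain_fin : (mu2 Omega < +oo)%E.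
Proof.
have [L L0 OL] := bounded_box bO.
apply: (@le_lt_trans _ _ (mu2 (`[- L, L] `*` `[- L, L]))).
  apply: le_measure.
  - by rewrite inE.
  - by rewrite inE; apply: measurableX.
  - by move=> x /OL[h1 h2]; split => /=; rewrite in_itv/= -ler_norml ltW.
by rewrite mu2_box ?ltry// ge0_cp// ltW.
Qed.

Lemma measurable_smooth f (D : set P) : smooth f -> measurable_fun D (f : P -> R).
Proof.
move=> sf; apply: measurable_funTS; apply: continuous_measurable2.
exact: smooth_continuous.
Qed.

Lemma test_bounded f : test_fun Omega f -> exists2 M, 0 < M & forall x, `|f x| <= M.
Proof.
move=> tf; have [sf cf _] := tf.
have /continuous_compact : {within closure [set x | f x != 0], continuous f}.
  by apply: continuous_subspaceT; exact: smooth_continuous.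
move=> /(_ cf) /compact_bounded [M [_ hM]].
exists (`|M| + 1); first by rewrite ltr_wpDl.
move=> x; have [xK|/test_fun_off ->] := pselect (closure [set x | f x != 0] x).
  apply: hM; first by rewrite ltr_pwDr ?ler_norm.
  by exists x.
by rewrite normr0 addr_ge0.
Qed.

Lemma bounded_integrable (f : P -> R) M : measurable_fun Omega f ->
  (forall x, Omega x -> `|f x| <= M) -> mu2.-integrable Omega (EFin \o f).
Proof.
move=> mf fM; apply: measurable_bounded_integrable => //; first exact: mu2_domain_fin.
exists M; split; first exact: num_real.
by move=> N MN x /= Ox; rewrite (le_trans (fM x Ox))// ltW.
Qed.

Lemma test_integrable f : test_fun Omega f -> mu2.-integrable Omega (EFin \o f).
Proof.
move=> tf; have [M M0 fM] := test_bounded tf.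
by apply: (bounded_integrable (M := M)) => //; apply: measurable_smooth; case: tf.
Qed.

Lemma test_L2 f : test_fun Omega f -> L2 Omega f.
Proof.
move=> tf; have [M M0 fM] := test_bounded tf.
have mf : measurable_fun Omega (f : P -> R) by apply: measurable_smooth; case: tf.
rewrite L2E; apply/sqintP; split => //.
apply: (bounded_integrable (M := M ^+ 2)); first exact: measurable_funX.
by move=> x _; rewrite normrX lerXn2r ?nnegrE// ltW.
Qed.

Lemma test_integral_derive0 i f : test_fun Omega f ->
  \int[mu2]_(x in Omega) 'D_(dir R i) f x = 0.
Proof.
move=> tf; have td := test_derive (dir R i) tf.
have [L L0 OL] := bounded_box bO.
rewrite /Rintegral integral_vanish; last by move=> x /(test_outside td) ->.
rewrite (@fubini_slice _ i); last first.
  have := test_integrable td; move/(integrable_mkcond _ mO).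
  apply: eq_integrable => // x _; rewrite patchE; case: ifPn => // /negP xD.
  by rewrite /= (test_outside td)// => /mem_set.
rewrite (eq_integral (fun=> 0%E)) ?integral0// => t _.
apply: (@integral_derive0 _ (fun s => f (dir_slice i t s))
  (fun s => 'D_(dir R i) f (dir_slice i t s)) _ _ L) => //.
- by move=> s; exact: is_derive_slice (test_smooth tf).
- by apply: (@continuous_slice_comp _ ('D_(dir R i) f)); exact: smooth_continuous (test_smooth td).
- by move=> s Ls; exact: (@test_slice _ Omega f L i t _ OL tf Ls).
Qed.

Lemma test_by_parts i f g : test_fun Omega f -> smooth g ->
  \int[mu2]_(x in Omega) (f x * 'D_(dir R i) g x) =
  - \int[mu2]_(x in Omega) ('D_(dir R i) f x * g x).
Proof.
move=> tf sg; have td := test_derive (dir R i) tf.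
have h1 : test_fun Omega (fun x => f x * 'D_(dir R i) g x).
  have := testMl tf (smooth_derive (dir R i) sg).
  by under eq_fun do rewrite mulrC.
have h2 : test_fun Omega (fun x => 'D_(dir R i) f x * g x).
  by have := testMl td sg; under eq_fun do rewrite mulrC.
have h := testMl tf sg.
apply/eqP; rewrite -subr_eq0 opprK -RintegralD//; [|exact: test_integrable..].
apply/eqP; rewrite -[RHS](test_integral_derive0 i h); apply: eq_Rintegral => x _.
have sf := test_smooth tf.
have d1 := @smooth_derivable _ _ f x (dir R i) sf.
have d2 := @smooth_derivable _ _ g x (dir R i) sg.
rewrite (_ : (fun x => g x * f x) = g * f)// deriveM//.
by rewrite /GRing.scale /= addrC (mulrC ('D_(dir R i) f x)).
Qed.

(** Gagliardo-Nirenberg in the plane: |f| is bounded by the line integral of either partial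
    derivative. Each of these two bounds depends on a single coordinate, so the integral of their
    product factors. *)
Lemma sobolev_W11 f : test_fun Omega f ->
  (\int[mu2]_(x in Omega) (f x ^+ 2)%:E <=
   (\int[mu2]_(x in Omega) `|'D_(dir R false) f x|%:E) *
   (\int[mu2]_(x in Omega) `|'D_(dir R true) f x|%:E))%E.
Proof.
move=> tf; have [L L0 OL] := bounded_box bO.
have td i := test_derive (dir R i) tf.
pose F i x := `|'D_(dir R i) f x|%:E.
have mF i : measurable_fun setT (F i : P -> \bar R).
  apply/measurable_EFinP; apply: measurableT_comp => //.
  by apply: measurable_smooth; case: (td i).
have F0 i x : (0 <= F i x)%E by rewrite lee_fin.
have dv i x : ~ Omega x -> `|'D_(dir R i) f x|%:E = 0%E.
  by move=> /(test_outside (td i)) ->; rewrite normr0.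
rewrite [X in (X <= _)%E]integral_vanish; last first.
  by move=> x /(test_outside tf) ->; rewrite expr0n.
rewrite [X in (_ <= X * _)%E](integral_vanish (dv false)).
rewrite [X in (_ <= _ * X)%E](integral_vanish (dv true)).
pose A i t := (\int[leb]_s F i (dir_slice i t s))%E.
have A0 i t : (0 <= A i t)%E by apply: integral_ge0.
have mA i : measurable_fun setT (A i) by apply: measurable_tonelli_slice.
have fA i t s : (`|f (dir_slice i t s)|%:E <= A i t)%E.
  apply: (@norm_le_integral_derive _ (fun s => f (dir_slice i t s))
    (fun s => 'D_(dir R i) f (dir_slice i t s)) _ _ L) => //.
  - by move=> u; exact: is_derive_slice (test_smooth tf).
  - by apply: (@continuous_slice_comp _ ('D_(dir R i) f)); exact: smooth_continuous (test_smooth (td i)).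
  - by move=> u Ls; exact: (@test_slice _ Omega f L i t _ OL tf Ls).
have mf : measurable_fun setT (f : P -> R) by apply: measurable_smooth; case: tf.
rewrite (@tonelli_slice _ true (fun x => (f x ^+ 2)%:E)); last 2 first.
- by apply/measurable_EFinP; apply: measurable_funX.
- by move=> x; rewrite lee_fin sqr_ge0.
have eA i : (\int[mu2]_x F i x = \int[leb]_t A i t)%E by exact: tonelli_slice.
rewrite [X in (_ <= X * _)%E](eA false) [X in (_ <= _ * X)%E](eA true).
have c0 : (0 <= \int[leb]_t A false t)%E by apply: integral_ge0.
rewrite -(@ge0_integralZl _ _ R leb setT measurableT _ (mA true) _ (fun x _ => A0 true x) c0).
apply: ge0_le_integral => //.
- by move=> t _; apply: integral_ge0 => s _; rewrite lee_fin sqr_ge0.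
- apply: (@measurable_tonelli_slice _ true (fun x => (f x ^+ 2)%:E)).
    by apply/measurable_EFinP; apply: measurable_funX.
  by move=> x; rewrite lee_fin sqr_ge0.
- exact: (measurable_funeM _ (mA true)).
move=> t _.
rewrite -(@ge0_integralZr _ _ R leb setT measurableT _ (mA false) _ (fun x _ => A0 false x) (A0 true t)).
apply: ge0_le_integral => //.
- by move=> s _; rewrite lee_fin sqr_ge0.
- apply/measurable_EFinP; apply: measurable_funX.
  apply: continuous_measurable_fun.
  by apply: (@continuous_slice_comp _ f true); exact: smooth_continuous (test_smooth tf).
- under eq_fun do rewrite muleC.
  exact: (measurable_funeM _ (mA false)).
move=> s _; rewrite -(@real_normK _ (f _)) ?num_real// expr2 EFinM.
by apply: lee_pmul => //; first [exact: (fA false s t)|exact: (fA true t s)].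
Qed.

End test_integrals.

(** * The fundamental lemma of the calculus of variations *)

Section fundamental_lemma.
Variables (R : realType) (Omega : set (R * R)).
Hypothesis oO : open Omega.
Local Notation P := (measurableTypeR R * measurableTypeR R)%type.
Local Notation mu2 := (@mu2 R).
Implicit Types f g : R * R -> R.

(** Formulated for every [p], with the zero function for unsuitable boxes, so that a single choice
    function covers the countable family. *)
Lemma qbox_bump (V : set (R * R)) (p : rat * rat * rat) :
  exists b : R * R -> R, [/\ test_fun V b, forall x, 0 <= b x <= 1 &
   0 < ratr p.2 :> R -> qbox p `<=` V -> forall x,
     ball ((ratr p.1.1, ratr p.1.2) : R * R) (ratr p.2 / 2 : R) x -> 0 < b x].
Proof.
have [[p0 pV]|h] := pselect (0 < ratr p.2 :> R /\ qbox p `<=` V); last first.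
  exists (fun=> 0); split; first exact: test0.
    by move=> x; rewrite lexx ler01.
  by move=> p0 pV; exfalso; apply: h.
set r : R := ratr p.2 in p0 *; set c1 : R := ratr p.1.1; set c2 : R := ratr p.1.2.
exists (box_bump 1 (c1 - r / 2) (c1 + r / 2) (c2 - r / 2) (c2 + r / 2)); split.
- apply: test_box_bump => // x [/=]; rewrite !in_itv /= => /andP[? ?] /andP[? ?].
  by apply: pV; split; rewrite /ball /= -/c1 -/c2 -/r ltr_norml; apply/andP; split; lra.
- by move=> x; rewrite box_bump_ge0 box_bump_le1.
- move=> _ _ x [/=]; rewrite /ball /= !ltr_norml => /andP[? ?] /andP[? ?].
  by apply: box_bump_gt0 => //; apply/andP; split; lra.
Qed.

(** With an enumeration c_k of the bumps, take 1 - prod over k < n of (1 - c_k)^n. At a point of [V]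
    some c_k is positive, so one factor tends to 0 while the others stay below 1. *)
Lemma test_exhaustion (V : set (R * R)) : open V ->
  exists phi : nat -> R * R -> R, [/\ forall n, test_fun V (phi n),
    forall n x, 0 <= phi n x <= 1 &
    forall x, V x -> phi n x @[n --> \oo] --> (1 : R)].
Proof.
move=> oV.
have [b hb] := choice (qbox_bump V).
pose c k := if unpickle k is Some p then b p else (fun=> 0).
have tc k : test_fun V (c k).
  by rewrite /c; case: unpickle => [p|]; [case: (hb p)|exact: test0].
have c01 k x : 0 <= c k x <= 1.
  rewrite /c; case: unpickle => [p|]; last by rewrite lexx ler01.
  by have [_ + _] := hb p; exact.
pose d n k x := (1 - c k x) ^+ n.
have d01 n k x : 0 <= d n k x <= 1.
  have /andP[? ?] := c01 k x.
  by rewrite exprn_ge0 ?exprn_ile1//; lra.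
have td n k : test_fun V (fun x => 1 - d n k x).
  apply: (@test_comp _ _ (fun t => 1 - (1 - t) ^+ n)) => //.
    apply: smoothB; first exact: smooth_cst.
    apply: smoothX; apply: smoothB; [exact: smooth_cst|exact: smooth_id].
  by rewrite subr0 expr1n subrr.
pose q n m x := \prod_(k < m) d n k x.
have q01 n m x : 0 <= q n m x <= 1.
  apply/andP; split; first by apply: prodr_ge0 => k _; case/andP: (d01 n k x).
  by apply: prodr_ile1 => k _; exact: d01.
have tq n m : test_fun V (fun x => 1 - q n m x).
  elim: m => [|m IH].
    rewrite (_ : (fun _ => _) = fun=> 0); first exact: test0.
    by apply/funext => x; rewrite /q big_ord0 subrr.
  rewrite (_ : (fun _ => _) = (fun x => (1 - q n m x) + q n m x * (1 - d n m x))).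
    apply: testD => //; apply: testMl => //.
    rewrite (_ : q n m = (fun x => 1 - (1 - q n m x))); last first.
      by apply/funext => x; rewrite subKr.
    by apply: smoothB; [exact: smooth_cst|case: IH].
  by apply/funext => x; rewrite /q big_ord_recr /=; ring.
exists (fun n x => 1 - q n n x); split=> [n|n x|x Vx].
- exact: tq.
- by have /andP[? ?] := q01 n n x; apply/andP; split; lra.
have [p [p0 px pV]] := qbox_nbhs_half (open_nbhs_nbhs (conj oV Vx)).
have bx : 0 < c (pickle p) x.
  by rewrite /c pickleK; have [_ _ h] := hb p; exact: h.
rewrite -[X in _ --> X]subr0; apply: cvgB; first exact: cvg_cst.
apply: (@squeeze_cvgr _ _ _ _ (fun=> 0) (fun n => (1 - c (pickle p) x) ^+ n)).
- near=> n; have /andP[-> _] /= := q01 n n x.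
  have pn : (pickle p < n)%N by near: n; exact: nbhs_infty_gt.
  rewrite /q (bigD1 (Ordinal pn))//= ler_piMr//.
    by case/andP: (d01 n (pickle p) x).
  by apply: prodr_ile1 => k _; exact: d01.
- exact: cvg_cst.
- apply: cvg_expr; have /andP[? ?] := c01 (pickle p) x.
  by rewrite ger0_norm; lra.
Unshelve. all: by end_near. Qed.

(** Open sets are stable under intersection, so this is the form of the sigma-algebra that Dynkin
    induction needs. *)
Lemma measurable_opens : @measurable _ P = <<s [set U | open (U : set (R * R))] >>.
Proof.
rewrite eqEsubset; split; last first.
  apply: smallest_sub; first exact: sigma_algebra_measurable.
  exact: open_measurable2.
rewrite measurable_prod_measurableType.
apply: smallest_sub; first exact: smallest_sigma_algebra.
move=> _ [A mA [B mB <-]].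
pose S := g_sigma_algebraType [set U : set (R * R) | open U].
have mfst : measurable_fun setT (fst : S -> measurableTypeR R).
  apply: (measurability _ (RGenOpens.measurableE R)) => _ [_ [a [b ->] <-]].
  rewrite setTI; apply: sub_sigma_algebra => /=.
  by apply: (@open_comp _ _ fst) => [x _|]; [exact: cvg_fst|exact: interval_open].
have msnd : measurable_fun setT (snd : S -> measurableTypeR R).
  apply: (measurability _ (RGenOpens.measurableE R)) => _ [_ [a [b ->] <-]].
  rewrite setTI; apply: sub_sigma_algebra => /=.
  by apply: (@open_comp _ _ snd) => [x _|]; [exact: cvg_snd|exact: interval_open].
have -> : A `*` B = ([set: S] `&` fst @^-1` A) `&` ([set: S] `&` snd @^-1` B).
  by apply/seteqP; split => [x [hA hB]|x [[_ hA] [_ hB]]]; do ?split.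
apply: (@measurableI _ S); [exact: mfst|exact: msnd].
Qed.

(** Cut-offs tending to 1 on an open set give, by dominated convergence, that [g] has integral 0
    over every open set; Dynkin induction extends this to all measurable sets, which forces [g] to
    vanish almost everywhere. *)
Lemma fundamental_lemma g : mu2.-integrable Omega (EFin \o g) ->
  (forall f, test_fun Omega f -> \int[mu2]_(x in Omega) (g x * f x) = 0) ->
  {ae mu2, forall x, Omega x -> g x = 0}.
Proof.
move=> ig h.
have mO : measurable (Omega : set P) by exact: open_measurable2.
have mg : measurable_fun Omega (g : P -> R) by apply/measurable_EFinP; exact: measurable_int ig.
pose Q (S : set P) := (\int[mu2]_(x in S `&` Omega) (g x)%:E = 0)%E.
have iS (S : set P) : measurable S -> mu2.-integrable (S `&` Omega) (EFin \o g).
  by move=> mS; apply: integrableS ig => //; exact: measurableI.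
have Qopen (U : set (R * R)) : open U -> Q U.
  move=> oU; have oV : open (U `&` Omega) by exact: openI.
  have [phi [tphi p01 pcv]] := test_exhaustion oV.
  have tO n : test_fun Omega (phi n).
    have [s c sub] := tphi n; split => //.
    by apply: subset_trans sub _; exact: subIsetr.
  have mV : measurable (U `&` Omega : set P) by exact: open_measurable2.
  have := @dominated_convergence _ P R mu2 _ mV
    (fun n x => (g x * phi n x)%:E) (EFin \o g) (fun x => `|g x|%:E).
  case.
  - move=> n; apply/measurable_EFinP; apply: measurable_funM.
      by apply: measurable_funS mg => //; exact: subIsetr.
    exact: measurable_smooth (test_smooth (tO n)).
  - by apply/measurable_EFinP; apply: measurable_funS mg => //; exact: subIsetr.
  - apply: aeW => x Vx; apply: cvg_EFin; first exact: nearW.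
    rewrite /= -[X in _ --> X](mulr1 (g x)); apply: cvgMr; exact: pcv.
  - by have := integrable_norm (iS _ (open_measurable2 oU)).
  - apply: aeW => x n Vx; rewrite /= lee_fin normrM ler_piMr//.
    by have /andP[? ?] := p01 n x; rewrite ger0_norm.
  move=> _ _ cv.
  have e n : (\int[mu2]_(x in U `&` Omega) (g x * phi n x)%:E = 0)%E.
    have i2 : mu2.-integrable Omega (EFin \o (fun x => g x * phi n x)).
      apply: (dom_integrable mO (g := fun x => `|g x|)).
      - apply: measurable_funM => //.
        exact: measurable_smooth (test_smooth (tO n)).
      - move=> x _; rewrite normrM ler_piMr//.
        by have /andP[? ?] := p01 n x; rewrite ger0_norm.
      - by have := integrable_norm ig.
    rewrite integral_vanish; last by move=> x /(test_outside (tphi n)) ->; rewrite mulr0.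
    rewrite -(@integral_vanish _ Omega); last first.
      by move=> x /(test_outside (tO n)) ->; rewrite mulr0.
    have := h _ (tO n); rewrite /Rintegral => e.
    by rewrite -[LHS]fineK ?e//; exact: integrable_fin_num i2.
  move: cv; rewrite (_ : (fun n : nat => _) = (fun=> 0%E)); last first.
    by apply/funext => n; exact: e.
  move=> cv; have := cvg_unique (@ereal_hausdorff R) cv (cvg_cst 0%E).
  by rewrite /Q => <-.
have Qall : forall S : set P, measurable S -> Q S.
  move=> S; rewrite measurable_opens; apply: dynkin_induction => //.
  - exact: measurable_opens.
  - by move=> U V; exact: openI.
  - by apply: Qopen; exact: openT.
  - move=> {}S mS QS; rewrite /Q.
    have : Q setT by apply: Qopen; exact: openT.
    rewrite /Q setTI => QT.
    have e : (S `&` Omega) `|` (~` S `&` Omega) = Omega by rewrite -setIUl setUv setTI.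
    have := @integral_setU _ P R mu2 (S `&` Omega) (~` S `&` Omega) (EFin \o g).
    rewrite e QT QS add0e => <- //.
    + exact: measurableI.
    + by apply: measurableI => //; exact: measurableC.
    + by apply/measurable_EFinP.
    + by apply/disj_setPS => x [[h1 _] [h2 _]]; exact: h2.
  - move=> F mF tF QF; rewrite /Q setI_bigcupl integral_bigcup//.
    + by rewrite eseries0// => n _ _; exact: QF.
    + exact: trivIset_setIr.
    + by move=> k; apply: (@measurableI _ P) => //; exact: mF.
    + by rewrite -setI_bigcupl; apply: iS; apply: bigcupT_measurable.
have h0 : ae_eq mu2 Omega (EFin \o g) (fun=> 0%E).
  apply: (@integral_ae_eq _ P R mu2 Omega mO (fun=> 0%E) (EFin \o g) ig) => //.
  by move=> E EO mE; rewrite integral0 -[E in LHS](setIidl EO); exact: Qall.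
have : {ae mu2, forall x, Omega x -> (EFin \o g) x = 0%E} by exact: h0.
by apply: filterS => x hx Ox; have [] := hx Ox.
Qed.

End fundamental_lemma.

Lemma geometric_le0 (R : realType) (x C : R) :
  (forall n, x <= C * 4^-1 ^+ n) -> x <= 0.
Proof.
move=> h; have c : C * 4^-1 ^+ n @[n --> \oo] --> C * 0.
  by apply: cvgMr; apply: cvg_expr; rewrite ger0_norm; lra.
rewrite mulr0 in c; rewrite -(cvg_lim _ c)//; apply: limr_ge; first by apply/cvg_ex; exists 0.
by apply: nearW.
Qed.

HB.lock Definition wpart (R : realType) (Omega : set (R * R)) (i : bool)
  (u : R * R -> R) : R * R -> R := weak_partial Omega i u.

(** The polar form of [dirichlet], with real values; [dirichletE] and [grad_dotE] connect it with
    the definitions of the statement. *)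
HB.lock Definition dform (R : realType) (Omega : set (R * R))
    (u v : R * R -> R) : R :=
  @ip _ (measurableTypeR R * measurableTypeR R)%type R (@mu2 R) Omega
    (wpart Omega false u) (wpart Omega false v) +
  @ip _ (measurableTypeR R * measurableTypeR R)%type R (@mu2 R) Omega
    (wpart Omega true u) (wpart Omega true v).

(** * Weak derivatives and the Dirichlet form *)

Section sobolev_space.
Variables (R : realType) (Omega : set (R * R)).
Hypothesis oO : open Omega.
Hypothesis bO : bounded_set Omega.
Local Notation P := (measurableTypeR R * measurableTypeR R)%type.
Local Notation mu2 := (@mu2 R).
Local Notation ipO := (@ip _ P R mu2 Omega).
Local Notation wp := (wpart Omega).
Implicit Types f g u v w : R * R -> R.

Let mO : measurable (Omega : set P). Proof. exact: open_measurable2. Qed.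

Lemma L2_integrable u : L2 Omega u -> mu2.-integrable Omega (EFin \o u).
Proof.
move=> hu.
have h1 : sqint mu2 (Omega : set P) (fun=> 1).
  apply/sqintP; split => //; apply: (bounded_integrable oO bO (M := 1)) => //.
  by move=> x _; rewrite expr1n normr1.
have := sqint_mul mO hu h1; apply: eq_integrable => // x _ /=; by rewrite mulr1.
Qed.

Lemma ip2E u v : \int[mu2]_(x in Omega) (u x * v x) = ipO u v.
Proof. by rewrite ip.unlock. Qed.

Lemma weak_partial_unique i u g h : is_weak_partial Omega i u g ->
  is_weak_partial Omega i u h -> {ae mu2, forall x, Omega x -> g x = h x}.
Proof.
move=> [hg ig] [hh ih].
have hgh : L2 Omega (fun x => g x - h x) by exact: (sqintB mO).
have : {ae mu2, forall x, Omega x -> g x - h x = 0}.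
  apply: fundamental_lemma => //; first exact: L2_integrable.
  move=> f tf; have tL := test_L2 oO bO tf.
  rewrite ip2E (ipBl mO hg hh tL).
  have := ig f tf; rewrite (ih f tf) !ip2E => /eqP.
  by rewrite eqr_opp => /eqP ->; rewrite subrr.
by apply: filterS => x hx Ox; apply/eqP; rewrite -subr_eq0 hx.
Qed.

Lemma weak_partialP i u : W12 Omega u -> is_weak_partial Omega i u (wp i u).
Proof. by rewrite wpart.unlock => -[_ /(_ i)]; exact: xgetPex. Qed.

Lemma weak_partial_L2 i u : W12 Omega u -> L2 Omega (wp i u).
Proof. by move=> /(weak_partialP i) []. Qed.

Lemma weak_partialE i u g : is_weak_partial Omega i u g ->
  {ae mu2, forall x, Omega x -> wp i u x = g x}.
Proof.
move=> h; have h' : is_weak_partial Omega i u (wp i u).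
  rewrite wpart.unlock; exact: (@xgetI _ _ [set g | is_weak_partial Omega i u g] g h).
exact: weak_partial_unique h' h.
Qed.

Lemma test_weak_partial i f : test_fun Omega f ->
  is_weak_partial Omega i f ('D_(dir R i) f).
Proof.
move=> tf; split; first exact: (test_L2 oO bO (test_derive _ tf)).
by move=> g tg; apply: test_by_parts => //; case: tg.
Qed.

Lemma is_weak_partialD i u v g h : L2 Omega u -> L2 Omega v ->
  is_weak_partial Omega i u g -> is_weak_partial Omega i v h ->
  is_weak_partial Omega i (fun x => u x + v x) (fun x => g x + h x).
Proof.
move=> hu hv [hg ig] [hh ih]; split; first exact: (sqintD mO).
move=> f tf; have tL := test_L2 oO bO tf.
have tD := test_L2 oO bO (test_derive (dir R i) tf).
have := ig f tf; have := ih f tf; rewrite !ip2E => e1 e2.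
by rewrite (ipDl mO hu hv tD) (ipDl mO hg hh tL) e1 e2 opprD.
Qed.

Lemma is_weak_partialZ i c u g : L2 Omega u ->
  is_weak_partial Omega i u g ->
  is_weak_partial Omega i (fun x => c * u x) (fun x => c * g x).
Proof.
move=> hu [hg ig]; split; first exact: (sqintZ mO).
move=> f tf; have tL := test_L2 oO bO tf.
have tD := test_L2 oO bO (test_derive (dir R i) tf).
have := ig f tf; rewrite !ip2E => e.
by rewrite (ipZl mO c hu tD) (ipZl mO c hg tL) e mulrN.
Qed.

Lemma W12D u v : W12 Omega u -> W12 Omega v -> W12 Omega (fun x => u x + v x).
Proof.
move=> hu hv; have [Lu _] := hu; have [Lv _] := hv.
split=> [|i]; first exact: (sqintD mO).
by exists (fun x => wp i u x + wp i v x); apply: is_weak_partialD => //; exact: weak_partialP.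
Qed.

Lemma W12Z c u : W12 Omega u -> W12 Omega (fun x => c * u x).
Proof.
move=> hu; have [Lu _] := hu; split=> [|i]; first exact: (sqintZ mO).
by exists (fun x => c * wp i u x); apply: is_weak_partialZ => //; exact: weak_partialP.
Qed.

Lemma test_W12 f : test_fun Omega f -> W12 Omega f.
Proof.
move=> tf; split=> [|i]; first exact: (test_L2 oO bO tf).
by eexists; exact: test_weak_partial.
Qed.

Lemma ip_ae u v w : L2 Omega u -> L2 Omega v -> L2 Omega w ->
  {ae mu2, forall x, Omega x -> u x = v x} -> ipO u w = ipO v w.
Proof.
move=> hu hv hw uv; rewrite ip.unlock; apply: ae_eq_Rintegral => //.
- by apply: measurable_funM; [exact: hu.1|exact: hw.1].
- by apply: measurable_funM; [exact: hv.1|exact: hw.1].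
- by apply: filterS uv => x h Ox; rewrite h.
Qed.

Lemma ip2C u v : ipO u v = ipO v u.
Proof. exact: ipC. Qed.

Lemma ip2Dl u v w : L2 Omega u -> L2 Omega v -> L2 Omega w ->
  ipO (fun x => u x + v x) w = ipO u w + ipO v w.
Proof. by move=> hu hv hw; exact: (ipDl mO hu hv hw). Qed.

Lemma ip2Zl c u w : L2 Omega u -> L2 Omega w ->
  ipO (fun x => c * u x) w = c * ipO u w.
Proof. by move=> hu hw; exact: (ipZl mO c hu hw). Qed.

Local Notation dform := (dform Omega).

Lemma dformC u v : dform u v = dform v u.
Proof. by rewrite dform.unlock ip2C (ip2C (wp true u)). Qed.

Lemma dform_ge0 u : 0 <= dform u u.
Proof. by rewrite dform.unlock addr_ge0// ip_ge0. Qed.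

(** The chosen representatives of weak derivatives are additive only almost everywhere; pairing with
    an L^2 function makes this an equality of numbers. *)
Lemma wpD i u v w : W12 Omega u -> W12 Omega v -> L2 Omega w ->
  ipO (wp i (fun x => u x + v x)) w = ipO (wp i u) w + ipO (wp i v) w.
Proof.
move=> hu hv hw; have Lu := weak_partial_L2 i hu; have Lv := weak_partial_L2 i hv.
refine (etrans _ (ip2Dl Lu Lv hw)); apply: (ip_ae _ _ hw).
- exact: weak_partial_L2 (W12D hu hv).
- exact: (sqintD mO Lu Lv).
- apply: weak_partialE.
  exact: (is_weak_partialD hu.1 hv.1 (weak_partialP i hu) (weak_partialP i hv)).
Qed.

Lemma wpZ i c u w : W12 Omega u -> L2 Omega w ->
  ipO (wp i (fun x => c * u x)) w = c * ipO (wp i u) w.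
Proof.
move=> hu hw; have Lu := weak_partial_L2 i hu.
refine (etrans _ (ip2Zl c Lu hw)); apply: (ip_ae _ _ hw).
- exact: weak_partial_L2 (W12Z c hu).
- exact: (sqintZ mO _ Lu).
- apply: weak_partialE; exact: (is_weak_partialZ c hu.1 (weak_partialP i hu)).
Qed.

Lemma dformDl u v w : W12 Omega u -> W12 Omega v -> W12 Omega w ->
  dform (fun x => u x + v x) w = dform u w + dform v w.
Proof.
move=> hu hv hw; have Lw i := weak_partial_L2 i hw.
rewrite dform.unlock (wpD _ hu hv (Lw false)) (wpD _ hu hv (Lw true)).
by rewrite addrACA.
Qed.

Lemma dformZl c u w : W12 Omega u -> W12 Omega w ->
  dform (fun x => c * u x) w = c * dform u w.
Proof.
move=> hu hw; have Lw i := weak_partial_L2 i hw.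
by rewrite dform.unlock (wpZ _ _ hu (Lw false)) (wpZ _ _ hu (Lw true)) mulrDr.
Qed.

Lemma dform_test f v : test_fun Omega f -> W12 Omega v ->
  dform f v = ipO ('D_(dir R false) f) (wp false v) + ipO ('D_(dir R true) f) (wp true v).
Proof.
move=> tf hv; have td i := test_L2 oO bO (test_derive (dir R i) tf).
have tW := test_W12 tf.
rewrite dform.unlock; apply: congr2; apply: ip_ae.
- exact: weak_partial_L2 tW.
- exact: td.
- exact: weak_partial_L2 hv.
- exact: weak_partialE (test_weak_partial _ tf).
- exact: weak_partial_L2 tW.
- exact: td.
- exact: weak_partial_L2 hv.
- exact: weak_partialE (test_weak_partial _ tf).
Qed.

Lemma dform_test2 f g : test_fun Omega f -> test_fun Omega g ->
  dform f g = ipO ('D_(dir R false) f) ('D_(dir R false) g) +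
              ipO ('D_(dir R true) f) ('D_(dir R true) g).
Proof.
move=> tf tg; have td i := test_L2 oO bO (test_derive (dir R i) tf).
have tdg i := test_L2 oO bO (test_derive (dir R i) tg).
have tW := test_W12 tg; rewrite (dform_test tf tW).
apply: congr2; refine (etrans (ip2C _ _) (etrans _ (ip2C _ _))); apply: ip_ae.
- exact: weak_partial_L2 tW.
- exact: tdg.
- exact: td.
- exact: weak_partialE (test_weak_partial _ tg).
- exact: weak_partial_L2 tW.
- exact: tdg.
- exact: td.
- exact: weak_partialE (test_weak_partial _ tg).
Qed.

Lemma dirichletE u : W12 Omega u -> dirichlet Omega u = (dform u u)%:E.
Proof.
move=> hu; have L i := weak_partial_L2 i hu.
rewrite /dirichlet dform.unlock EFinD (ip_EFin mO (L false)) (ip_EFin mO (L true)).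
rewrite -ge0_integralD//.
- by apply: eq_integral => x _; rewrite -EFinD /grad_dot !expr2 wpart.unlock.
- by move=> x _; rewrite lee_fin sqr_ge0.
- by apply/measurable_EFinP; apply: measurable_funX; exact: (L false).1.
- by move=> x _; rewrite lee_fin sqr_ge0.
- by apply/measurable_EFinP; apply: measurable_funX; exact: (L true).1.
Qed.

Lemma grad_dotE u v : W12 Omega u -> W12 Omega v ->
  \int[mu2]_(x in Omega) grad_dot Omega u v x = dform u v.
Proof.
move=> hu hv; rewrite /grad_dot dform.unlock -!ip2E wpart.unlock RintegralD//.
- have := sqint_mul mO (weak_partial_L2 false hu) (weak_partial_L2 false hv).
  by rewrite wpart.unlock.
- have := sqint_mul mO (weak_partial_L2 true hu) (weak_partial_L2 true hv).
  by rewrite wpart.unlock.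
Qed.

End sobolev_space.

Section quadratic_estimates.
Variable R : realFieldType.
Implicit Types a b m x y z e : R.

(** From 2ab <= a^2 + b^2. It converts the product of two L^1 norms of partial derivatives into a
    measure times an energy. *)
Lemma mul_le_of_sqr a b m x y : a ^+ 2 <= x * m -> b ^+ 2 <= y * m ->
  a * b <= m * (x + y).
Proof.
move=> h1 h2; have := sqr_ge0 (a - b); have := sqr_ge0 (a + b).
by rewrite sqrrB sqrrD; move: h1 h2; lra.
Qed.

Lemma sqrD_le_of_sqrB a b z x y m : (- z - a) ^+ 2 <= 8 * m * x ->
  (z - b) ^+ 2 <= 8 * m * y -> (a + b) ^+ 2 <= 16 * (x + y) * m.
Proof.
move=> h1 h2; have h := sqr_ge0 ((- z - a) - (z - b)).
have -> : (a + b) ^+ 2 =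
  2 * (- z - a) ^+ 2 + 2 * (z - b) ^+ 2 - ((- z - a) - (z - b)) ^+ 2 by ring.
by move: h1 h2 h; lra.
Qed.

Lemma absorb_error a x y z b m e : 0 <= m -> a <= 2 * x + 2 * y -> x <= z ->
  y <= m * b -> b <= 2 * z + 2 * e -> a <= 4 * m * e + z * (2 + 4 * m).
Proof.
move=> m0 h1 h2 h3 h4; have := ler_wpM2l m0 h4; move: h1 h2 h3; lra.
Qed.

Lemma sum3_le a b x m : a <= 8 * m -> b <= 8 * m -> x <= 8 * m ->
  x + (a + b) <= 24 * m.
Proof. by lra. Qed.

End quadratic_estimates.

(** * The space W^{1,2}_0: Poincare inequality and completeness *)

Section W012_space.
Variables (R : realType) (Omega : set (R * R)).
Hypothesis oO : open Omega.
Hypothesis bO : bounded_set Omega.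
Local Notation P := (measurableTypeR R * measurableTypeR R)%type.
Local Notation mu2 := (@mu2 R).
Local Notation ipO := (@ip _ P R mu2 Omega).
Local Notation wp := (wpart Omega).
Local Notation dO := (dform Omega).
Implicit Types f g u v w : R * R -> R.

Let mO : measurable (Omega : set P). Proof. exact: open_measurable2. Qed.

Lemma L2B u v : L2 Omega u -> L2 Omega v -> L2 Omega (fun x => u x - v x).
Proof. by move=> hu hv; exact: (sqintB mO hu hv). Qed.

Lemma W12B u v : W12 Omega u -> W12 Omega v -> W12 Omega (fun x => u x - v x).
Proof.
move=> hu hv; have := W12D oO bO hu (W12Z oO bO (-1) hv).
by under eq_fun do rewrite mulN1r.
Qed.

Lemma dformBl u v w : W12 Omega u -> W12 Omega v -> W12 Omega w ->
  dO (fun x => u x - v x) w = dO u w - dO v w.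
Proof.
move=> hu hv hw; have hv' := W12Z oO bO (-1) hv.
rewrite -(mulN1r (dO v w)) -(dformZl oO bO (-1) hv hw) -(dformDl oO bO hu hv' hw).
by congr (dform Omega _ w); apply/funext => x; rewrite mulN1r.
Qed.

Lemma dformZZ c u : W12 Omega u ->
  dO (fun x => c * u x) (fun x => c * u x) = c ^+ 2 * dO u u.
Proof.
move=> hu; have hcu := W12Z oO bO c hu.
by rewrite (dformZl oO bO c hu hcu) (dformC Omega u) (dformZl oO bO c hu hu) mulrA.
Qed.

Lemma dformDD u v : W12 Omega u -> W12 Omega v ->
  dO (fun x => u x + v x) (fun x => u x + v x) =
  dO u u + 2 * dO u v + dO v v.
Proof.
move=> hu hv; have huv := W12D oO bO hu hv.
rewrite (dformDl oO bO hu hv huv) (dformC Omega u (fun x => u x + v x)).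
rewrite (dformC Omega v (fun x => u x + v x)) (dformDl oO bO hu hv hu).
by rewrite (dformDl oO bO hu hv hv) (dformC Omega v u); ring.
Qed.

Lemma dformBB u v : W12 Omega u -> W12 Omega v ->
  dO (fun x => u x - v x) (fun x => u x - v x) =
  dO u u - 2 * dO u v + dO v v.
Proof.
move=> hu hv; have huv := W12B hu hv.
rewrite (dformBl hu hv huv) (dformC Omega u (fun x => u x - v x)).
rewrite (dformC Omega v (fun x => u x - v x)) (dformBl hu hv hu).
by rewrite (dformBl hu hv hv) (dformC Omega v u); ring.
Qed.

Lemma dform_leD u v : W12 Omega u -> W12 Omega v ->
  dO (fun x => u x + v x) (fun x => u x + v x) <= 2 * dO u u + 2 * dO v v.
Proof.
move=> hu hv; have := dform_ge0 Omega (fun x => u x - v x).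
by rewrite dformBB// dformDD//; lra.
Qed.

Lemma ipBB u v : L2 Omega u -> L2 Omega v ->
  ipO (fun x => u x - v x) (fun x => u x - v x) =
  ipO u u - 2 * ipO u v + ipO v v.
Proof.
move=> hu hv; have huv := L2B hu hv.
rewrite (ipBl mO hu hv huv) (ip2C Omega u (fun x => u x - v x)).
rewrite (ip2C Omega v (fun x => u x - v x)) (ipBl mO hu hv hu).
by rewrite (ipBl mO hu hv hv) (ip2C Omega v u); ring.
Qed.

Lemma ip_leD u v : L2 Omega u -> L2 Omega v ->
  ipO (fun x => u x + v x) (fun x => u x + v x) <= 2 * ipO u u + 2 * ipO v v.
Proof.
move=> hu hv; have := ip_ge0 mu2 Omega (fun x => u x - v x).
by rewrite (ipBB hu hv) (ipDD mO hu hv); lra.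
Qed.

(** The square of the Sobolev norm, which spares the roots in all approximation arguments. *)
Definition sob u : R := ipO u u + dO u u.

Lemma sob_ge0 u : 0 <= sob u.
Proof. by rewrite addr_ge0 ?ip_ge0 ?dform_ge0. Qed.

Lemma sob_leD u v : W12 Omega u -> W12 Omega v ->
  sob (fun x => u x + v x) <= 2 * sob u + 2 * sob v.
Proof.
move=> hu hv; rewrite /sob; have := dform_leD hu hv; have := ip_leD hu.1 hv.1.
by lra.
Qed.

Lemma sobZ c u : W12 Omega u -> sob (fun x => c * u x) = c ^+ 2 * sob u.
Proof. by move=> hu; rewrite /sob dformZZ// (ipZZ mO c hu.1) mulrDr. Qed.

Lemma sobC u v : W12 Omega u -> W12 Omega v ->
  sob (fun x => u x - v x) = sob (fun x => v x - u x).
Proof.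
move=> hu hv; have h := W12B hu hv.
have := sobZ (-1) h; rewrite sqrrN expr1n mul1r => <-; congr sob.
by apply/funext => x; rewrite mulN1r opprB.
Qed.

Lemma poweR_half (r : R) : 0 <= r -> (r%:E `^ 2^-1 = (Num.sqrt r)%:E)%E.
Proof. by move=> r0; rewrite poweR_EFin powR12_sqrt. Qed.

Lemma sobolev_normE u : W12 Omega u -> sobolev_norm Omega u = (Num.sqrt (sob u))%:E.
Proof.
move=> hu; rewrite /sobolev_norm (dirichletE oO hu) -(ip_EFin mO hu.1) -EFinD.
by rewrite poweR_half// sob_ge0.
Qed.

Lemma grad_normE u : W12 Omega u -> grad_norm Omega u = (Num.sqrt (dO u u))%:E.
Proof. by move=> hu; rewrite /grad_norm (dirichletE oO hu) poweR_half// dform_ge0. Qed.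

Lemma W012P u : W012 Omega u <-> W12 Omega u /\
  forall e, 0 < e -> exists2 f, test_fun Omega f & sob (fun x => u x - f x) < e.
Proof.
split=> -[hu h]; (split; first exact: hu) => e e0.
- have [|f tf] := h (Num.sqrt e); first by rewrite sqrtr_gt0.
  have tW := test_W12 oO bO tf.
  rewrite (sobolev_normE (W12B hu tW)) lte_fin ltr_sqrt// => hf.
  by exists f.
- have [|f tf hf] := h (e ^+ 2); first by rewrite exprn_gt0.
  have tW := test_W12 oO bO tf; exists f; first exact: tf.
  rewrite (sobolev_normE (W12B hu tW)) lte_fin.
  by rewrite -[ltRHS](gtr0_norm e0) -sqrtr_sqr ltr_sqrt// exprn_gt0.
Qed.

Lemma W012_W12 u : W012 Omega u -> W12 Omega u.
Proof. by case. Qed.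

Lemma W012_L2 u : W012 Omega u -> L2 Omega u.
Proof. by move=> /W012_W12 []. Qed.

Lemma test_W012 f : test_fun Omega f -> W012 Omega f.
Proof.
move=> tf; have tW := test_W12 oO bO tf; apply/W012P; split; first exact: tW.
move=> e e0; exists f; first exact: tf.
rewrite (_ : (fun x => f x - f x) = (fun x => 0 * f x)); last first.
  by apply/funext => x; rewrite mul0r subrr.
by rewrite sobZ// expr0n mul0r.
Qed.

Lemma W012D u v : W012 Omega u -> W012 Omega v -> W012 Omega (fun x => u x + v x).
Proof.
move=> /W012P[hu au] /W012P[hv av]; apply/W012P; split; first exact: W12D.
move=> e e0; have e4 : 0 < e / 4 by lra.
have [f tf hf] := au _ e4; have [g tg hg] := av _ e4.
exists (fun x => f x + g x); first exact: testD.
have h1 := W12B hu (test_W12 oO bO tf); have h2 := W12B hv (test_W12 oO bO tg).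
have := sob_leD h1 h2.
rewrite (_ : (fun x => _) = (fun x => u x + v x - (f x + g x))); first by lra.
by apply/funext => x; rewrite opprD addrACA.
Qed.

Lemma W012Z c u : W012 Omega u -> W012 Omega (fun x => c * u x).
Proof.
move=> /W012P[hu au]; apply/W012P; split; first exact: W12Z.
move=> e e0; have c0 : 0 < c ^+ 2 + 1 by rewrite ltr_wpDl ?sqr_ge0.
have [|f tf hf] := au (e / (c ^+ 2 + 1)); first by rewrite divr_gt0.
exists (fun x => c * f x); first exact: testZ.
have h1 := W12B hu (test_W12 oO bO tf).
rewrite (_ : (fun x => _) = (fun x => c * (u x - f x))); last first.
  by apply/funext => x; rewrite mulrBr.
rewrite sobZ//; move: hf; rewrite ltr_pdivlMr// => hf; apply: le_lt_trans hf.
by rewrite mulrC ler_wpM2l ?sob_ge0// lerDl.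
Qed.

Lemma W012B u v : W012 Omega u -> W012 Omega v -> W012 Omega (fun x => u x - v x).
Proof.
move=> hu hv; have := W012D hu (W012Z (-1) hv).
by under eq_fun do rewrite mulN1r.
Qed.

Lemma W012_closed u : W12 Omega u ->
  (forall e, 0 < e -> exists2 v, W012 Omega v & sob (fun x => u x - v x) < e) ->
  W012 Omega u.
Proof.
move=> hu h; apply/W012P; split; first exact: hu.
move=> e e0; have e4 : 0 < e / 4 by lra.
have [v /W012P[hv av] uv] := h _ e4; have [f tf vf] := av _ e4.
exists f; first exact: tf.
have h1 := W12B hu hv; have h2 := W12B hv (test_W12 oO bO tf).
have := sob_leD h1 h2.
rewrite (_ : (fun x => _) = (fun x => u x - f x)); first by lra.
by apply/funext => x; rewrite addrA subrK.
Qed.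

Lemma ip_wpB i u v : W12 Omega u -> W12 Omega v ->
  ipO (fun x => wp i u x - wp i v x) (fun x => wp i u x - wp i v x) =
  ipO (wp i (fun x => u x - v x)) (wp i (fun x => u x - v x)).
Proof.
move=> hu hv; have huv := W12B hu hv.
have Lu := weak_partial_L2 i hu; have Lv := weak_partial_L2 i hv.
have Luv := weak_partial_L2 i huv; have LB := L2B Lu Lv.
have hae : {ae mu2, forall x, Omega x ->
    wp i u x - wp i v x = wp i (fun x => u x - v x) x}.
  have := weak_partialE oO bO (is_weak_partialD oO bO hu.1 (W12Z oO bO (-1) hv).1
    (weak_partialP i hu) (is_weak_partialZ oO bO (-1) hv.1 (weak_partialP i hv))).
  rewrite (_ : (fun x => u x + -1 * v x) = (fun x => u x - v x)); last first.
    by apply/funext => x; rewrite mulN1r.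
  by apply: filterS => x h Ox; rewrite h// mulN1r.
rewrite (ip_ae oO LB Luv LB hae) ip2C.
exact: (ip_ae oO LB Luv Luv hae).
Qed.

(** In [sobolev_W11], Cauchy-Schwarz against the constant 1 replaces each L^1 norm by an L^2 norm;
    this is where the measure of Omega comes from. *)
Lemma poincare_test f : test_fun Omega f ->
  ipO f f <= fine (mu2 Omega) * dO f f.
Proof.
move=> tf; have Lf := test_L2 oO bO tf.
have td i := test_derive (dir R i) tf.
have L1 : sqint mu2 (Omega : set P) (fun=> 1 : R).
  apply/sqintP; split => //; apply: (bounded_integrable oO bO (M := 1)) => //.
  by move=> x _; rewrite expr1n normr1.
pose n i x := `|'D_(dir R i) f x|.
have Ld i : L2 Omega ('D_(dir R i) f) by exact: (test_L2 oO bO (td i)).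
have Ln i : L2 Omega (n i).
  have [m s] := Ld i; split; first by apply: measurableT_comp.
  by under eq_integral do rewrite real_normK ?num_real//.
have nn i : ipO (n i) (n i) = ipO ('D_(dir R i) f) ('D_(dir R i) f).
  rewrite ip.unlock; apply: eq_Rintegral => x _.
  by rewrite -!expr2 real_normK ?num_real.
have e11 : ipO (fun=> 1) (fun=> 1) = fine (mu2 Omega).
  rewrite ip.unlock (@eq_Rintegral _ _ _ mu2 Omega (cst 1)); last by move=> x _; rewrite mulr1.
  by rewrite Rintegral_cst// mul1r.
have n0 i : 0 <= ipO (n i) (fun=> 1).
  by rewrite ip.unlock; apply: Rintegral_ge0 => x _; rewrite mulr1; exact: normr_ge0.
have EF i : (\int[mu2]_(x in Omega) `|'D_(dir R i) f x|%:E)%E = (ipO (n i) (fun=> 1))%:E.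
  rewrite ip.unlock /Rintegral fineK; first by apply: eq_integral => x _; rewrite mulr1.
  exact: (integrable_fin_num mO (sqint_mul mO (Ln i) L1)).
have := sobolev_W11 bO tf; rewrite -(ip_EFin mO Lf) !EF -EFinM lee_fin => h.
apply: (le_trans h).
have h1 i := cauchy_schwarz mO (Ln i) L1; have := h1 false; have := h1 true.
rewrite !nn e11 (dform_test2 oO bO tf tf).
move=> hb ha; exact: (mul_le_of_sqr ha hb).
Qed.

(** Passing from test functions to their closure splits two squares, u = (u - f) + f and f = (f - u)
    + u, and each splitting costs a factor 2. *)
Lemma poincare u : W012 Omega u -> ipO u u <= 4 * fine (mu2 Omega) * dO u u.
Proof.
move=> /W012P[hu au]; set C := fine _.
have C0 : 0 <= C by rewrite fine_ge0.
apply/ler_addgt0Pr => e e0.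
have [|f tf hf] := au (e / (2 + 4 * C)); first by rewrite divr_gt0//; lra.
have tW := test_W12 oO bO tf; have hB := W12B hu tW.
have hB' := W12B tW hu.
have h1 : ipO u u <= 2 * ipO (fun x => u x - f x) (fun x => u x - f x) + 2 * ipO f f.
  have := ip_leD hB.1 tW.1.
  by rewrite (_ : (fun x => u x - f x + f x) = u)//; apply/funext => x; rewrite subrK.
have h2 : dO f f <= 2 * sob (fun x => u x - f x) + 2 * dO u u.
  have := dform_leD hB' hu.
  rewrite (_ : (fun x => f x - u x + u x) = f); last by apply/funext => x; rewrite subrK.
  rewrite (sobC hu tW) /sob.
  by have := ip_ge0 mu2 Omega (fun x => f x - u x); lra.
have := poincare_test tf; rewrite -/C => h3.
have h4 : ipO (fun x => u x - f x) (fun x => u x - f x) <= sob (fun x => u x - f x).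
  by rewrite lerDl dform_ge0.
move: hf; rewrite ltr_pdivlMr; last by lra.
move=> hf; apply: (le_trans (absorb_error C0 h1 h4 h3 h2)).
by rewrite lerD2l ltW.
Qed.

(** [c] is an inverse Poincare constant, at most 1, so that the functions as well as their weak
    derivatives have L^2 increments at most 8^-n. Limits are taken separately and matched by
    integration by parts; 24 is 8 for the function plus 8 for each derivative. *)
Lemma W012_complete : exists2 c, 0 < c & forall u_ : nat -> R * R -> R,
  (forall n, W012 Omega (u_ n)) ->
  (forall n, dO (fun x => u_ n.+1 x - u_ n x) (fun x => u_ n.+1 x - u_ n x)
     <= c * 8^-1 ^+ n) ->
  exists2 u, W012 Omega u &
    forall N, sob (fun x => u_ N x - u x) <= 24 * 4^-1 ^+ N.
Proof.
set C := 4 * fine (mu2 Omega) + 1.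
have C0 : 0 < C by rewrite ltr_wpDl// mulr_ge0// fine_ge0.
have C1 : C^-1 <= 1 by rewrite invf_le1// lerDr mulr_ge0// fine_ge0.
exists C^-1; first by rewrite invr_gt0.
move=> u_ hu hd.
have Wu n := W012_W12 (hu n); have Lu n := W012_L2 (hu n).
have q0 n : 0 <= 8^-1 ^+ n :> R by rewrite exprn_ge0.
have d1 n : dO (fun x => u_ n.+1 x - u_ n x) (fun x => u_ n.+1 x - u_ n x) <= 8^-1 ^+ n.
  by rewrite (le_trans (hd n))// ler_piMl.
have [u Lu' cu] : exists2 u, L2 Omega u & forall N,
    ipO (fun x => u_ N x - u x) (fun x => u_ N x - u x) <= 8 * 4^-1 ^+ N.
  apply: (sqint_complete mO Lu) => n.
  rewrite (le_trans (poincare (W012B (hu n.+1) (hu n))))//.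
  apply: (@le_trans _ _ (C * (C^-1 * 8^-1 ^+ n))); last by rewrite mulVKf ?gt_eqF.
  apply: le_trans (ler_wpM2l (ltW C0) (hd n)).
  by rewrite ler_wpM2r ?dform_ge0// lerDl.
have Lw n i := weak_partial_L2 i (Wu n).
have ex i : exists g, L2 Omega g /\ forall N,
    ipO (fun x => wp i (u_ N) x - g x) (fun x => wp i (u_ N) x - g x) <= 8 * 4^-1 ^+ N.
  have [||g Lg hg] := sqint_complete mO (u_ := fun n => wp i (u_ n)) (mu := mu2).
  - by move=> n; exact: Lw.
  - move=> n; rewrite ip_wpB//; apply: le_trans (d1 n).
    by case: i; rewrite dform.unlock ?lerDr ?lerDl ip_ge0.
  by exists g.
have [g hg] := choice ex.
have wg i : is_weak_partial Omega i u (g i).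
  have [Lg cg] := hg i; split; first exact: Lg.
  move=> f tf; rewrite !ip2E; apply/eqP; rewrite -subr_eq0 opprK -sqrf_eq0 eq_le sqr_ge0 andbT.
  have tL := test_L2 oO bO tf; have tD := test_L2 oO bO (test_derive (dir R i) tf).
  (* The identity is exact for each [u_ n], so its defect in the limit is at most the two L^2
     errors, which tend to 0. *)
  apply: (@geometric_le0 _ _ (16 * (ipO ('D_(dir R i) f) ('D_(dir R i) f) + ipO f f))) => n.
  have [_ e] := weak_partialP i (Wu n); have := e f tf; rewrite !ip2E => {}e.
  have e1 := ipBl mO (Lu n) Lu' tD; have e2 := ipBl mO (Lw n i) Lg tL.
  have c1 := cauchy_schwarz mO (L2B (Lu n) Lu') tD.
  have c2 := cauchy_schwarz mO (L2B (Lw n i) Lg) tL.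
  move: c1 c2; rewrite e1 e2 e.
  move=> c1 c2; apply: (sqrD_le_of_sqrB (z := ipO (wp i (u_ n)) f)).
    by apply: le_trans c1 _; rewrite ler_wpM2r ?ip_ge0.
  by apply: le_trans c2 _; rewrite ler_wpM2r ?ip_ge0.
have Wu' : W12 Omega u by split => [|i]; [exact: Lu'|exists (g i); exact: wg].
have cw i N : ipO (wp i (fun x => u_ N x - u x)) (wp i (fun x => u_ N x - u x)) <= 8 * 4^-1 ^+ N.
  have [Lg cg] := hg i; apply: le_trans (cg N).
  rewrite -ip_wpB//.
  have Lw' := weak_partial_L2 i Wu'.
  have LA := L2B (Lw N i) Lw'; have LB := L2B (Lw N i) Lg.
  have hae : {ae mu2, forall x, Omega x ->
      wp i (u_ N) x - wp i u x = wp i (u_ N) x - g i x}.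
    by apply: filterS (weak_partialE oO bO (wg i)) => x h Ox; rewrite h.
  by rewrite (ip_ae oO LA LB LA hae) ip2C (ip_ae oO LA LB LB hae).
have cs N : sob (fun x => u_ N x - u x) <= 24 * 4^-1 ^+ N.
  by rewrite /sob dform.unlock; exact: (sum3_le (cw false N) (cw true N) (cu N)).
exists u; last exact: cs.
apply: W012_closed; first exact: Wu'.
move=> e e0.
have cv : (24 : R) * 4^-1 ^+ n @[n --> \oo] --> (24 : R) * 0.
  by apply: cvgMr; apply: cvg_expr; rewrite ger0_norm ?invf_lt1 ?invr_ge0 ?ltr1n.
rewrite mulr0 in cv; have [N _ hN] := cvgr_lt _ cv e e0.
exists (u_ N); first exact: hu.
by rewrite sobC// (le_lt_trans (cs N))//; exact: hN N (leqnn N).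
Qed.

End W012_space.

(** * Exponential integrability through the decay of level sets *)

Section smooth_step.
Variable R : realType.

Definition step (s : R) : R :=
  expinv 0 (3 * s - 1) / (expinv 0 (3 * s - 1) + expinv 0 (2 - 3 * s)).

Lemma step_den_gt0 (s : R) : 0 < expinv 0 (3 * s - 1) + expinv 0 (2 - 3 * s).
Proof.
have [h|h] := ltP 0 (3 * s - 1).
  by rewrite ltr_pwDl ?expinv_gt0// expinv_ge0.
by rewrite ltr_wpDl ?expinv_ge0// expinv_gt0//; lra.
Qed.

Lemma smooth_step_fun : smooth step.
Proof.
have e (g : R -> R) : smooth g -> smooth (fun x => expinv 0 (g x)).
  by move=> sg; apply: (@smooth_comp _ _ (expinv 0)) => //; exact: smooth_expinv.
have s3 : smooth (fun s : R => 3 * s) by apply: smoothZ; exact: smooth_id.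
have e1 : smooth (fun s : R => expinv 0 (3 * s - 1)).
  by apply: e; apply: smoothB => //; exact: smooth_cst.
have e2 : smooth (fun s : R => expinv 0 (2 - 3 * s)).
  by apply: e; apply: smoothB => //; exact: smooth_cst.
apply: smoothM => //; apply: smoothV; first exact: smoothD.
by move=> s; rewrite gt_eqF// step_den_gt0.
Qed.

Lemma step0 (s : R) : s <= 1 / 3 -> step s = 0.
Proof. by move=> h; rewrite /step expinv_le0 ?mul0r//; lra. Qed.

Lemma step1 (s : R) : 2 / 3 <= s -> step s = 1.
Proof.
move=> h; rewrite /step (@expinv_le0 _ _ (2 - 3 * s)); last by lra.
by rewrite addr0 divff// gt_eqF// expinv_gt0//; lra.
Qed.

Lemma derive_step_off (s : R) : s < 0 \/ 1 <= s -> 'D_1 step s = 0.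
Proof.
move=> h.
have hn : \forall y \near s, step y = step s.
  case: h => h.
    have : (s < 1 / 3) by lra.
    move=> h'; near=> y; rewrite !step0 ?ltW//; near: y; exact: lt_nbhsl.
  have h' : 2 / 3 < s by lra.
  near=> y; rewrite !step1 ?ltW//; near: y; exact: lt_nbhsr.
by rewrite (@near_eq_derive _ _ _ _ (cst (step s)))// derive_cst.
Unshelve. all: by end_near. Qed.

Lemma derive_step_bounded : exists2 K : R, 0 < K & forall s, `|'D_1 step s| <= K.
Proof.
have cd : {within `[0, 1], continuous ('D_1 step : R -> R)}.
  apply: continuous_subspaceT => x.
  exact/differentiable_continuous/smooth_differentiable/(@smooth_derive _ _ step)/smooth_step_fun.
have /compact_bounded [M [_ hM]] := continuous_compact cd (@segment_compact _ 0 1).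
exists (`|M| + 1); first by rewrite ltr_wpDl.
move=> s; have [s0|s0] := ltP s 0.
  by rewrite derive_step_off ?normr0 ?addr_ge0//; left.
have [s1|s1] := leP 1 s.
  by rewrite derive_step_off ?normr0 ?addr_ge0//; right.
apply: hM; first by rewrite ltr_pwDr// ler_norm.
by exists s => //=; rewrite in_itv/= s0 ltW.
Qed.

End smooth_step.

Section level_sets.
Variables (R : realType) (Omega : set (R * R)).
Hypothesis oO : open Omega.
Hypothesis bO : bounded_set Omega.
Local Notation P := (measurableTypeR R * measurableTypeR R)%type.
Local Notation mu2 := (@mu2 R).
Local Notation ipO := (@ip _ P R mu2 Omega).
Local Notation dO := (dform Omega).
Implicit Types f g u v w : R * R -> R.

Let mO : measurable (Omega : set P). Proof. exact: open_measurable2. Qed.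

(** Indicators are real valued, so that [ip (above f t) (above f t)] is the measure of a superlevel
    set. *)
Definition above f (t : R) (x : R * R) : R := (t <= f x)%R%:R.
Definition between f (s t : R) (x : R * R) : R := (s <= f x < t)%R%:R.

Lemma measurable_level (b : P -> bool) : measurable_fun Omega b ->
  measurable_fun Omega (fun x : P => (b x)%:R : R).
Proof.
move=> mb; rewrite (_ : (fun x => _) = (fun x => if b x then 1 else 0)).
  by apply: measurable_fun_if => //; exact: measurable_cst.
by apply/funext => x; case: (b x).
Qed.

Lemma measurable_above f t : measurable_fun Omega (f : P -> R) ->
  measurable_fun Omega (above f t : P -> R).
Proof.
by move=> mf; apply: measurable_level; apply: measurable_fun_ler.
Qed.

Lemma measurable_between f s t : measurable_fun Omega (f : P -> R) ->
  measurable_fun Omega (between f s t : P -> R).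
Proof.
move=> mf; apply: measurable_level; apply: measurable_and.
  by apply: measurable_fun_ler.
by apply: measurable_fun_ltr.
Qed.

Lemma bounded_L2 (f : P -> R) M : measurable_fun Omega f ->
  (forall x, `|f x| <= M) -> L2 Omega f.
Proof.
move=> mf fM; rewrite L2E; apply/sqintP; split; first exact: mf.
apply: (bounded_integrable oO bO (M := M ^+ 2)); first exact: measurable_funX.
move=> x _; have M0 : 0 <= M := le_trans (normr_ge0 _) (fM x).
by rewrite normrX lerXn2r ?nnegrE.
Qed.

Lemma above_L2 f t : measurable_fun Omega (f : P -> R) -> L2 Omega (above f t).
Proof.
move=> mf; apply: (bounded_L2 (M := 1)); first exact: measurable_above.
by move=> x; rewrite /above normr_nat lern1 leq_b1.
Qed.

Lemma between_mul_L2 f s t g M : measurable_fun Omega (f : P -> R) ->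
  measurable_fun Omega (g : P -> R) -> (forall x, `|g x| <= M) ->
  L2 Omega (fun x => between f s t x * g x).
Proof.
move=> mf mg gM; apply: (bounded_L2 (M := M)).
  by apply: measurable_funM; [exact: measurable_between|exact: mg].
move=> x; rewrite normrM; apply: le_trans (gM x); rewrite ler_piMl//.
by rewrite /between normr_nat lern1 leq_b1.
Qed.

Lemma ip_le (u v w z : R * R -> R) : L2 Omega u -> L2 Omega v ->
  L2 Omega w -> L2 Omega z ->
  (forall x, Omega x -> u x * v x <= w x * z x) -> ipO u v <= ipO w z.
Proof.
move=> hu hv hw hz h; rewrite ip.unlock; apply: le_Rintegral.
- exact: mO.
- exact: (sqint_mul mO hu hv).
- exact: (sqint_mul mO hw hz).
- exact: h.
Qed.

Definition strip_energy f (s t : R) : R :=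
  ipO (fun x => between f s t x * 'D_(dir R false) f x)
      (fun x => between f s t x * 'D_(dir R false) f x) +
  ipO (fun x => between f s t x * 'D_(dir R true) f x)
      (fun x => between f s t x * 'D_(dir R true) f x).

(** Apply [sobolev_W11] to the truncation [T] of [f] between the levels t and t + h. It equals 1 on
    the higher superlevel set, and its gradient lives on the strip between the levels with a factor
    at most K / h; Cauchy-Schwarz against the indicator of the lower set produces its measure. *)
Lemma level_step (K : R) (hK : forall s, `|'D_1 (@step R) s| <= K) f t h :
  test_fun Omega f -> 0 <= t -> 0 < h ->
  ipO (above f (t + h)) (above f (t + h)) <=
  (K / h) ^+ 2 * (ipO (above f t) (above f t) * strip_energy f t (t + h)).
Proof.
move=> tf t0 h0; have sf := test_smooth tf.
have hn0 : h != 0 by rewrite gt_eqF.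
have mf : measurable_fun Omega (f : P -> R) by exact: measurable_smooth.
pose T s := step ((s - t) / h).
have sT : smooth T.
  apply: (@smooth_comp _ _ (@step R) (fun s => (s - t) / h)); first exact: smooth_step_fun.
  apply: smoothM; last exact: smooth_cst.
  by apply: smoothB; [exact: smooth_id|exact: smooth_cst].
(* The sign of [t] is used here: [T] must vanish at 0 for T(f) to be a test function. *)
have T0 : T 0 = 0.
  by rewrite /T step0// sub0r mulNr (@le_trans _ _ 0)// ?oppr_le0 ?divr_ge0// ltW.
have tg : test_fun Omega (fun x => T (f x)) by exact: test_comp.
have Lg := test_L2 oO bO tg.
have dT i x : 'D_(dir R i) (fun y => T (f y)) x =
    'D_1 (@step R) ((f x - t) / h) / h * 'D_(dir R i) f x.
  rewrite derive_comp1; [|exact: smooth_differentiable..].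
  congr (_ * _); rewrite /T (@derive_comp1 _ _ (@step R) (fun s => (s - t) / h)).
  - congr (_ * _); rewrite -derive1E derive1Mr; last first.
      by apply: derivableB; [exact: derivable_id|exact: derivable_cst].
    by rewrite derive1E deriveB ?derive_id ?derive_cst ?subr0 ?mul1r.
  - apply: smooth_differentiable; apply: smoothM; last exact: smooth_cst.
    by apply: smoothB; [exact: smooth_id|exact: smooth_cst].
  - exact/smooth_differentiable/smooth_step_fun.
have La s : L2 Omega (above f s) by exact: above_L2.
pose q i x := between f t (t + h) x * 'D_(dir R i) f x.
have td i := test_derive (dir R i) tf.
have md i : measurable_fun Omega ('D_(dir R i) f : P -> R).
  exact: measurable_smooth (test_smooth (td i)).
have Lq i : L2 Omega (q i).
  by have [M _ dM] := test_bounded (td i); exact: (between_mul_L2 _ _ mf (md i) dM).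
have Lnq i : L2 Omega (fun x => `|q i x|).
  have [m s] := Lq i; split; first by apply: measurableT_comp.
  by under eq_integral do rewrite real_normK ?num_real//.
have nq i : ipO (fun x => `|q i x|) (fun x => `|q i x|) = ipO (q i) (q i).
  rewrite ip.unlock; apply: eq_Rintegral => x _.
  by rewrite -!expr2 real_normK ?num_real.
have K0 : 0 <= K := le_trans (normr_ge0 _) (hK 0).
have Kh : 0 <= K / h by rewrite divr_ge0// ltW.
have bd i x : `|'D_(dir R i) (fun y => T (f y)) x| <=
    K / h * (above f t x * `|q i x|).
  rewrite dT normrM normrM normfV (gtr0_norm h0) /q /above /between.
  have [xt|xt] := leP t (f x); last first.
    by rewrite derive_step_off ?normr0 ?mul0r ?mulr0//; left; rewrite pmulr_llt0 ?invr_gt0// subr_lt0.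
  have [xh|xh] := ltP (f x) (t + h); last first.
    rewrite derive_step_off; first by rewrite normr0 !mul0r normr0 !mulr0.
    by right; rewrite ler_pdivlMr// mul1r lerBrDl.
  by rewrite !mul1r ler_wpM2r// ler_wpM2r// invr_ge0 ltW.
have S i : (\int[mu2]_(x in Omega) `|'D_(dir R i) (fun y => T (f y)) x|%:E <=
    (K / h * ipO (above f t) (fun x => `|q i x|))%:E)%E.
  have ia := sqint_mul mO (La t) (Lnq i).
  have -> : (K / h * ipO (above f t) (fun x => `|q i x|))%:E =
      (\int[mu2]_(x in Omega) (K / h * (above f t x * `|q i x|))%:E)%E.
    rewrite ip.unlock EFinM /Rintegral fineK; last exact: integrable_fin_num ia.
    by rewrite -integralZl//; apply: eq_integral => x _; rewrite EFinM.
  have ma : measurable_fun Omega (fun x : P => (K / h * (above f t x * `|q i x|))%:E).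
    apply/measurable_EFinP; apply: measurable_funM; first exact: measurable_cst.
    by apply: measurable_funM; [exact: (La t).1|exact: (Lnq i).1].
  apply: ge0_le_integral.
  - exact: mO.
  - by move=> x _; rewrite lee_fin.
  - apply/measurable_EFinP; apply: measurableT_comp; first exact: normr_measurable.
    exact: measurable_smooth (test_smooth (test_derive _ tg)).
  - exact: ma.
  - by move=> x _; rewrite lee_fin; exact: bd.
have low : ipO (above f (t + h)) (above f (t + h)) <=
    ipO (fun x => T (f x)) (fun x => T (f x)).
  apply: (ip_le (La _) (La _) Lg Lg) => x _; rewrite /above.
  have [xt|xt] := leP (t + h) (f x); last by rewrite mul0r -expr2 sqr_ge0.
  have -> : T (f x) = 1; last by [].
  apply: step1; rewrite (@le_trans _ _ 1)//; first by lra.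
  by rewrite ler_pdivlMr// mul1r lerBrDl.
apply: (le_trans low).
pose a i := ipO (above f t) (fun x => `|q i x|).
have a0 i : 0 <= a i.
  rewrite /a ip.unlock; apply: Rintegral_ge0 => x _.
  by apply: mulr_ge0; [exact: ler0n|exact: normr_ge0].
have : ipO (fun x => T (f x)) (fun x => T (f x)) <= (K / h) ^+ 2 * (a false * a true).
  have := sobolev_W11 bO tg; rewrite -(ip_EFin mO Lg) => hs.
  rewrite -lee_fin (le_trans hs)// (_ : _ * (_ * _) = (K / h * a false) * (K / h * a true)); last by ring.
  by rewrite EFinM; apply: lee_pmul;
    [exact: integral_ge0|exact: integral_ge0|exact: S|exact: S].
move=> /le_trans; apply; rewrite ler_wpM2l ?sqr_ge0//.
have h1 i : a i ^+ 2 <= ipO (q i) (q i) * ipO (above f t) (above f t).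
  by rewrite -nq mulrC; exact: (cauchy_schwarz mO (La t) (Lnq i)).
exact: (mul_le_of_sqr (h1 false) (h1 true)).
Qed.

End level_sets.

Section trudinger.
Variables (R : realType) (Omega : set (R * R)).
Hypothesis oO : open Omega.
Hypothesis bO : bounded_set Omega.
Local Notation P := (measurableTypeR R * measurableTypeR R)%type.
Local Notation mu2 := (@mu2 R).
Local Notation ipO := (@ip _ P R mu2 Omega).
Local Notation dO := (dform Omega).
Local Notation strip := (strip_energy Omega).
Implicit Types f g u v w : R * R -> R.

Let mO : measurable (Omega : set P). Proof. exact: open_measurable2. Qed.
Let A : R := fine (mu2 Omega).
Let A0 : 0 <= A. Proof. exact: fine_ge0. Qed.

(* Splitting a test function at the levels k, k+1, ... makes the energies of the
   slices add up to the total energy, whence geometric decay of the level sets. *)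
Lemma strip_energy_split f s t r : test_fun Omega f -> s <= t -> t <= r ->
  strip f s r = strip f s t + strip f t r.
Proof.
move=> tf st tr.
have mf : measurable_fun Omega (f : P -> R) by exact: measurable_smooth (test_smooth tf).
have L i a b : L2 Omega (fun x => between f a b x * 'D_(dir R i) f x).
  have td := test_derive (dir R i) tf; have [M _ dM] := test_bounded td.
  exact: (between_mul_L2 oO bO _ _ mf (measurable_smooth (test_smooth td)) dM).
have e i : ipO (fun x => between f s r x * 'D_(dir R i) f x)
               (fun x => between f s r x * 'D_(dir R i) f x) =
  ipO (fun x => between f s t x * 'D_(dir R i) f x)
      (fun x => between f s t x * 'D_(dir R i) f x) +
  ipO (fun x => between f t r x * 'D_(dir R i) f x)
      (fun x => between f t r x * 'D_(dir R i) f x).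
  rewrite ip.unlock -RintegralD; last 3 first.
  - exact: mO.
  - exact: (sqint_mul mO (L i s t) (L i s t)).
  - exact: (sqint_mul mO (L i t r) (L i t r)).
  apply: eq_Rintegral => x _; rewrite /between.
  have [sx|sx] := leP s (f x); have [xt|xt] := ltP (f x) t;
    have [xr|xr] := ltP (f x) r => /=; rewrite ?mul0r ?mul1r ?add0r ?addr0//.
  - by have := lt_le_trans xt (le_trans tr xr); rewrite ltxx.
  - by have := lt_le_trans sx (le_trans st xt); rewrite ltxx.
by rewrite /strip_energy (e false) (e true); exact: addrACA.
Qed.

Lemma strip_energy_le f s t : test_fun Omega f -> strip f s t <= dO f f.
Proof.
move=> tf; rewrite (dform_test2 oO bO tf tf) /strip_energy.
have mf : measurable_fun Omega (f : P -> R) by exact: measurable_smooth (test_smooth tf).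
suff h i : ipO (fun x => between f s t x * 'D_(dir R i) f x)
      (fun x => between f s t x * 'D_(dir R i) f x) <=
    ipO ('D_(dir R i) f) ('D_(dir R i) f) by rewrite lerD.
have td := test_derive (dir R i) tf; have [M _ dM] := test_bounded td.
have L1 := between_mul_L2 oO bO s t mf (measurable_smooth (test_smooth td)) dM.
have L2 := test_L2 oO bO td.
apply: (ip_le oO L1 L1 L2 L2) => x _; rewrite mulrACA -!expr2 ler_piMl ?sqr_ge0//.
by rewrite exprn_ile1 ?ler0n// lern1 leq_b1.
Qed.

Lemma strip_energy_ge0 f s t : 0 <= strip f s t.
Proof. by rewrite addr_ge0// ip_ge0. Qed.

Lemma ip_one_le f : L2 Omega f -> (forall x, 0 <= f x <= 1) -> ipO f f <= A.
Proof.
move=> Lf f01; rewrite ip.unlock.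
have -> : A = \int[mu2]_(x in Omega) (1 * 1).
  rewrite (@eq_Rintegral _ _ _ mu2 Omega (cst 1)); last by move=> x _; rewrite mulr1.
  by rewrite Rintegral_cst// mul1r.
apply: le_Rintegral.
- exact: mO.
- exact: (sqint_mul mO Lf Lf).
- apply: (bounded_integrable oO bO (M := 1)) => //.
  by move=> x _; rewrite mulr1 normr1.
- by move=> x _; have /andP[? ?] := f01 x; rewrite mulr1 mulr_ile1.
Qed.

Lemma above01 f t x : 0 <= above f t x <= 1.
Proof. by rewrite /above ler0n lern1 leq_b1. Qed.

Lemma level_prod (K : R) (hK : forall s, `|'D_1 (@step R) s| <= K) f h n :
  test_fun Omega f -> 0 < h ->
  ipO (above f (n%:R * h)) (above f (n%:R * h)) <=
  A * \prod_(k < n) ((K / h) ^+ 2 * strip f (k%:R * h) (k.+1%:R * h)).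
Proof.
move=> tf h0.
have mf : measurable_fun Omega (f : P -> R) by exact: measurable_smooth (test_smooth tf).
elim: n => [|n IH].
  rewrite big_ord0 mulr1; apply: ip_one_le; first exact: above_L2.
  exact: above01.
rewrite big_ord_recr /= mulrA.
have e : n.+1%:R * h = n%:R * h + h by rewrite -natr1 mulrDl mul1r.
rewrite e; have := level_step oO bO hK tf (_ : 0 <= n%:R * h) h0.
move=> /(_ _)/le_trans; apply; first by rewrite mulr_ge0// ltW.
rewrite mulrCA; apply: ler_wpM2r => //.
by rewrite mulr_ge0 ?sqr_ge0// strip_energy_ge0.
Qed.

(** Cut the height t into N equal steps h = t / N. The N factors of [level_prod] have sum at most 3
    (K / h)^2, so by the inequality of arithmetic and geometric means their product is at most (3
    K^2 N / t^2)^N. The choice t^2 = 6 K^2 N makes this 2^-N, a Gaussian decay in t. *)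
Lemma level_test : exists2 k : R, 0 < k & forall f, test_fun Omega f ->
  dO f f <= 3 -> forall n,
  ipO (above f (Num.sqrt (k * n%:R))) (above f (Num.sqrt (k * n%:R))) <=
  A * 2^-1 ^+ n.
Proof.
have [K K0 hK] := @derive_step_bounded R.
exists (6 * K ^+ 2); first by rewrite mulr_gt0 ?exprn_gt0.
move=> f tf f3 n.
have mf : measurable_fun Omega (f : P -> R) by exact: measurable_smooth (test_smooth tf).
case: n => [|n].
  by rewrite expr0 mulr1; apply: ip_one_le; [exact: above_L2|exact: above01].
set N := n.+1; set t := Num.sqrt _.
have N0 : 0 < N%:R :> R by rewrite ltr0n.
have t2 : t ^+ 2 = 6 * K ^+ 2 * N%:R by rewrite sqr_sqrtr// mulr_ge0// mulr_ge0// sqr_ge0.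
have t0 : 0 < t by rewrite sqrtr_gt0 !mulr_gt0// exprn_gt0.
set h := t / N%:R; have h0 : 0 < h by rewrite divr_gt0.
have -> : t = N%:R * h by rewrite mulrC divfK// gt_eqF.
apply: (le_trans (level_prod hK N tf h0)); apply: ler_wpM2l => //.
pose E (k : 'I_N) := (K / h) ^+ 2 * strip f (k%:R * h) (k.+1%:R * h).
have E0 k : 0 <= E k by rewrite mulr_ge0 ?sqr_ge0// strip_energy_ge0.
have sumE m : \sum_(k < m) ((K / h) ^+ 2 * strip f (k%:R * h) (k.+1%:R * h)) <=
    (K / h) ^+ 2 * 3.
  rewrite -mulr_sumr ler_wpM2l ?sqr_ge0//; apply: le_trans f3.
  apply: le_trans (strip_energy_le 0 (m%:R * h) tf).
  elim: m => [|m IH]; first by rewrite big_ord0 strip_energy_ge0.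
  rewrite big_ord_recr /= (@strip_energy_split f 0 (m%:R * h))//.
  - by rewrite lerD2r.
  - by rewrite mulr_ge0// ltW.
  - by rewrite ler_pM2r// ler_nat.
have AG := (@leif_AGM _ _ 'I_N E (fun k _ => E0 k)).1.
apply: (le_trans AG); rewrite card_ord.
apply: lerXn2r; rewrite ?nnegrE//.
  by rewrite mulr_ge0 ?invr_ge0// sumr_ge0.
rewrite ler_pdivrMr//; apply: (le_trans (sumE N)).
rewrite le_eqVlt; apply/orP; left; apply/eqP.
rewrite expr_div_n /h expr_div_n t2; field.
by rewrite !gt_eqF.
Qed.

End trudinger.

Lemma nneseries_geometric (R : realType) (c q : R) : 0 <= q < 1 ->
  (\sum_(n <oo) (c * q ^+ n)%:E = (c / (1 - q))%:E)%E.
Proof.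
move=> /andP[q0 q1]; apply: cvg_lim => //.
have h : series (geometric c q) @ \oo --> c * (1 - q)^-1.
  by apply: cvg_geometric_series; rewrite ger0_norm.
apply/fine_cvgP; split; first by apply: nearW => n; rewrite sumEFin.
by under eq_fun do rewrite /= sumEFin /=.
Qed.

Lemma two_levels_le (R : realFieldType) (x y z m q e : R) :
  x <= m * q -> y <= m * q -> z <= e -> x + y + z <= 2 * m * q + e.
Proof. by lra. Qed.

(** * From level sets of test functions to exponential integrals on the unit ball *)

Section exponential_integrability.
Variables (R : realType) (Omega : set (R * R)).
Hypothesis oO : open Omega.
Hypothesis bO : bounded_set Omega.
Local Notation P := (measurableTypeR R * measurableTypeR R)%type.
Local Notation mu2 := (@mu2 R).
Local Notation ipO := (@ip _ P R mu2 Omega).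
Local Notation dO := (dform Omega).
Implicit Types f g u v w : R * R -> R.

Let mO : measurable (Omega : set P). Proof. exact: open_measurable2. Qed.

(** If |a| >= 2s then |b| >= s or |a - b| >= s, and the latter case is paid for as in Chebyshev's
    inequality. *)
Lemma level_pointwise (a b s : R) : 0 < s ->
  (4 * s ^+ 2 <= a ^+ 2)%R%:R <=
  (s <= b)%R%:R + (s <= - b)%R%:R + s^-2 * (a - b) ^+ 2 :> R.
Proof.
move=> s0; have h0 : 0 <= s^-2 * (a - b) ^+ 2.
  by rewrite mulr_ge0 ?sqr_ge0// invr_ge0 sqr_ge0.
have b0 (c : bool) : 0 <= c%:R :> R by exact: ler0n.
have bT : true%:R = 1 :> R by [].
have bF : false%:R = 0 :> R by [].
have [h|h] := leP (4 * s ^+ 2) (a ^+ 2); last by rewrite bF !addr_ge0.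
rewrite bT.
have [h1|h1] := leP s b; first by rewrite bT; have := b0 (s <= - b); lra.
have [h2|h2] := leP s (- b); first by rewrite bT bF; lra.
rewrite !bF !add0r -(@ler_pM2l _ (s ^+ 2)) ?exprn_gt0// mulrA mulfV ?gt_eqF ?exprn_gt0//.
rewrite mulr1 mul1r.
have ha : 2 * s <= `|a|.
  have e : (2 * s) ^+ 2 = 4 * s ^+ 2 by rewrite exprMn; congr (_ * _); ring.
  have s2 : 0 <= 2 * s by lra.
  by rewrite -(@ler_pXn2r _ 2%N) ?nnegrE// real_normK ?num_real// e.
have hb' : `|b| < s by rewrite ltr_norml ltrNl h1 h2.
have : s <= `|a - b| by have := lerB_dist a b; lra.
move=> hs; rewrite -[leRHS](@real_normK _ (a - b)) ?num_real//.
by rewrite ler_pXn2r// ?nnegrE// ltW.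
Qed.

(** Comparison with a test function doubles the level, whence 4k in place of k; the superlevel sets
    of f and of -f give the factor 2, and the Chebyshev term is made smaller than any [e]. *)
Lemma level_W012 : exists2 k : R, 0 < k & forall u, W012 Omega u ->
  dO u u <= 1 -> forall n,
  ipO (above (fun x => u x ^+ 2) (k * n%:R)) (above (fun x => u x ^+ 2) (k * n%:R))
   <= 2 * fine (mu2 Omega) * 2^-1 ^+ n.
Proof.
set A := fine _; have A0 : 0 <= A by exact: fine_ge0.
have [k k0 hk] := level_test oO bO; exists (4 * k); first by rewrite mulr_gt0.
move=> u hu u1 n.
have Lu := W012_L2 hu; have mu := Lu.1.
have La : L2 Omega (above (fun x => u x ^+ 2) (4 * k * n%:R)).
  by apply: above_L2 => //; exact: measurable_funX.
case: n La => [|n] La.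
  rewrite expr0 mulr1 (@le_trans _ _ A)//; last by lra.
  by apply: ip_one_le => // x; exact: above01.
set s := Num.sqrt (k * n.+1%:R).
have s0 : 0 < s by rewrite sqrtr_gt0 mulr_gt0.
have s2 : s ^+ 2 = k * n.+1%:R by rewrite sqr_sqrtr// mulr_ge0// ltW.
apply/ler_addgt0Pr => e e0.
have [hW hap] := (W012P oO bO u).1 hu.
(* The distance 1/2 keeps the energy of [f] below 2 * (1/2) + 2 * 1 = 3, the bound allowed in
   [level_test]. *)
have m0 : 0 < Num.min (2^-1) (e * s ^+ 2) by rewrite lt_min mulr_gt0 ?exprn_gt0//; lra.
have [f tf] := hap _ m0; rewrite lt_min => /andP[hf1 hf2].
have tW := test_W12 oO bO tf; have hB := W12B oO bO hW tW.
have hB' := W12B oO bO tW hW.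
have f3 : dO f f <= 3.
  have := dform_leD oO bO hB' hW.
  rewrite (_ : (fun x => f x - u x + u x) = f); last by apply/funext => x; rewrite subrK.
  have : dO (fun x => f x - u x) (fun x => f x - u x) <= sob Omega (fun x => u x - f x).
    by rewrite (sobC oO bO hW tW) /sob lerDr ip_ge0.
  by move: hf1 u1; lra.
have tnf := testN tf.
have nf3 : dO (fun x => - f x) (fun x => - f x) <= 3.
  rewrite (_ : (fun x => - f x) = (fun x => -1 * f x)); last by apply/funext => x; rewrite mulN1r.
  by rewrite (dformZZ oO bO _ tW) sqrrN expr1n mul1r.
have h1 := hk f tf f3 n.+1; have h2 := hk _ tnf nf3 n.+1.
rewrite -/s in h1 h2.
have mf : measurable_fun Omega (f : P -> R) by exact: measurable_smooth (test_smooth tf).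
have mnf : measurable_fun Omega (fun x : P => - f x) by exact: measurable_smooth (test_smooth tnf).
have L1 := above_L2 oO bO s mf; have L2 := above_L2 oO bO s mnf.
have L3 := hB.1.
have i1 := sqint_mul mO L1 L1; have i2 := sqint_mul mO L2 L2.
have i3 := sqint_mul mO L3 L3.
have i3' : mu2.-integrable Omega (EFin \o (fun x => s^-2 * ((u x - f x) * (u x - f x)))).
  have := integrableZl mO (s^-2) i3; exact: eq_integrable.
have i12 : mu2.-integrable Omega (EFin \o (fun x => above f s x * above f s x +
    above (fun x => - f x) s x * above (fun x => - f x) s x)).
  by have := integrableD mO i1 i2; apply: eq_integrable.
have i123 : mu2.-integrable Omega (EFin \o (fun x => above f s x * above f s x +
    above (fun x => - f x) s x * above (fun x => - f x) s x +
    s^-2 * ((u x - f x) * (u x - f x)))).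
  by have := integrableD mO i12 i3'; apply: eq_integrable.
have sq (b : bool) : b%:R * b%:R = b%:R :> R by case: b; rewrite /= ?mulr1n ?mulr0n ?mulr0 ?mulr1.
have main : ipO (above (fun x => u x ^+ 2) (4 * k * n.+1%:R))
    (above (fun x => u x ^+ 2) (4 * k * n.+1%:R)) <=
  ipO (above f s) (above f s) + ipO (above (fun x => - f x) s) (above (fun x => - f x) s)
    + s^-2 * ipO (fun x => u x - f x) (fun x => u x - f x).
  rewrite ip.unlock -(RintegralZl (s^-2) mO i3) -(RintegralD mO i1 i2) -(RintegralD mO i12 i3').
  apply: le_Rintegral.
  - exact: mO.
  - exact: (sqint_mul mO La La).
  - exact: i123.
  - move=> x _; rewrite /above !sq -mulrA -s2 -expr2; exact: level_pointwise.
apply: (le_trans main).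
have h3 : s^-2 * ipO (fun x => u x - f x) (fun x => u x - f x) <= e.
  rewrite mulrC ler_pdivrMr ?exprn_gt0//; apply: le_trans (ltW hf2).
  by rewrite /sob lerDl dform_ge0.
exact: (two_levels_le h1 h2 h3).
Qed.

(* A weak form of the Moser-Trudinger inequality: some positive exponent b is
   enough, since only small a matters. *)
Lemma exp_W012 : exists b K : R, [/\ 0 < b, 0 <= K & forall u, W012 Omega u ->
  dO u u <= 1 -> (\int[mu2]_(x in Omega) (expR (b * u x ^+ 2))%:E <= K%:E)%E].
Proof.
set A := fine (mu2 Omega); have A0 : 0 <= A by exact: fine_ge0.
have [k k0 hk] := level_W012.
(* Then exp(bk) = 3/2, so level n contributes at most (3/2)^(n+1) * 2A * 2^-n = 3A (3/4)^n, and the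
   sum is 12A. *)
pose b := ln (3 / 2) / k.
have l0 : 0 < ln (3 / 2 : R) by rewrite ln_gt0//; lra.
exists b, (12 * A); split; [by rewrite divr_gt0|by rewrite mulr_ge0|].
move=> u hu u1; have Lu := W012_L2 hu; have mu := Lu.1.
pose chi n := above (fun x => u x ^+ 2) (k * n%:R).
pose t n x : R := (3 / 2) ^+ n.+1 * (chi n x * chi n x).
have mchi n : measurable_fun Omega (chi n : P -> R).
  by apply: (measurable_above oO); exact: measurable_funX.
have t0 n x : 0 <= t n x.
  by rewrite mulr_ge0 ?exprn_ge0// -?expr2 ?sqr_ge0//; lra.
have mt n : measurable_fun Omega (fun x : P => (t n x)%:E).
  apply/measurable_EFinP; apply: measurable_funM; first exact: measurable_cst.
  by apply: measurable_funM.
have Lchi n : L2 Omega (chi n) by apply: above_L2 => //; exact: measurable_funX.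
apply: (@le_trans _ _ (\int[mu2]_(x in Omega) (\sum_(n <oo) (t n x)%:E))%E).
  apply: ge0_le_integral.
  - exact: mO.
  - by move=> x _; rewrite lee_fin expR_ge0.
  - apply/measurable_EFinP; apply: measurableT_comp => //.
    by apply: measurable_funM; [exact: measurable_cst|exact: measurable_funX].
  - by apply: ge0_emeasurable_sum => [n x _ _|n _]; [rewrite lee_fin|exact: mt].
  (* With k n <= u^2 < k (n + 1), the single term of index n already dominates the exponential. *)
  move=> x _; set n := Num.truncn (u x ^+ 2 / k).
  have uk0 : 0 <= u x ^+ 2 / k by rewrite divr_ge0 ?sqr_ge0// ltW.
  have /andP[n1 n2] := truncn_itv uk0.
  rewrite -/n in n1 n2.
  apply: le_trans (nneseries_lim_ge n.+1 _); last by move=> j _ _; rewrite lee_fin.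
  rewrite big_nat_recr//=; apply: (@le_trans _ _ (t n x)%:E); last first.
    by rewrite leeDr//; apply: sume_ge0 => j _; exact: t0.
  rewrite lee_fin /t /chi /above.
  have -> : k * n%:R <= u x ^+ 2 by move: n1; rewrite ler_pdivlMr// mulrC.
  have e32 : expR (ln (3 / 2)) = 3 / 2 :> R by rewrite lnK// posrE; lra.
  rewrite (_ : true%:R = 1 :> R)// !mulr1 -e32.
  rewrite -expRM_natl ler_expR /b mulrAC ler_pdivrMr// [leRHS]mulrAC.
  rewrite [leLHS]mulrC ler_pM2r//.
  by move: n2; rewrite ltr_pdivrMr// => /ltW.
have ichi n : (\int[mu2]_(x in Omega) (t n x)%:E = ((3 / 2) ^+ n.+1 * ipO (chi n) (chi n))%:E)%E.
  rewrite ip.unlock -RintegralZl//; last exact: (sqint_mul mO (Lchi n) (Lchi n)).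
  rewrite /Rintegral fineK//.
  have := integrableZl mO ((3 / 2) ^+ n.+1) (sqint_mul mO (Lchi n) (Lchi n)).
  by move=> /(integrable_fin_num mO); under eq_integral do rewrite -EFinM.
rewrite integral_nneseries//; last by move=> n x _; rewrite lee_fin.
apply: (@le_trans _ _ (\sum_(n <oo) (3 * A * (3 / 4) ^+ n)%:E)%E).
  apply: lee_nneseries => [n _ _|n _]; first by apply: integral_ge0 => x _; rewrite lee_fin.
  rewrite ichi lee_fin.
  apply: (le_trans (ler_wpM2l _ (hk u hu u1 n))); first by rewrite exprn_ge0//; lra.
  rewrite -/A exprS (_ : 3 / 4 = 3 / 2 * 2^-1 :> R); last by field.
  rewrite [(3 / 2 * 2^-1) ^+ n]exprMn le_eqVlt; apply/orP; left; apply/eqP.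
  by move: (2^-1 ^+ n) ((3 / 2) ^+ n) => q p; field.
rewrite nneseries_geometric; last by apply/andP; split; lra.
by rewrite lee_fin le_eqVlt; apply/orP; left; apply/eqP; field.
Qed.

End exponential_integrability.

(** * Poincare inequality on squares *)

Section one_dimensional_oscillation.
Variable R : realType.
Local Notation leb := (@lebesgue_measure R).
Variables (g dg : R -> R).
Hypothesis dgE : forall x : R, is_derive x (1 : R) g (dg x).
Hypothesis cdg : continuous dg.

(** Cauchy-Schwarz for the integral of [dg] between the two points. The interval is half open to
    match the cells. *)
Lemma oscillation_le (a h x y : R) : a <= x < a + h -> a <= y < a + h ->
  (((g x - g y) ^+ 2)%:E <=
     h%:E * \int[leb]_(s in `[a, (a + h)%R[) ((dg s) ^+ 2)%:E)%E.
Proof.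
wlog xy : x y / x <= y.
  move=> W hx hy; have [xy|/ltW yx] := leP x y; first exact: W.
  by rewrite -[(_ - _) ^+ 2]sqrrN opprB; exact: W.
move=> /andP[ax xh] /andP[ay yh].
have mdg : measurable_fun setT dg by exact: continuous_measurable_fun.
have m2 (D : set R) : measurable_fun D (fun s => ((dg s) ^+ 2)%:E).
  by apply/measurable_EFinP; apply: measurable_funX; exact: measurable_funTS.
have i0 (D : set R) : (0 <= \int[leb]_(s in D) ((dg s) ^+ 2)%:E)%E.
  by apply: integral_ge0 => s _; rewrite lee_fin sqr_ge0.
have h0 : 0 < h by move: ax xh; lra.
have [->|xny] := eqVneq x y.
  by rewrite subrr expr0n mule_ge0// lee_fin ltW.
have ltxy : x < y by rewrite lt_neqAle xny.
have cW (k : R -> R) : continuous k -> leb.-integrable `[x, y] (EFin \o k).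
  move=> ck; apply: continuous_compact_integrable; first exact: segment_compact.
  exact: continuous_subspaceT.
have sq : sqint leb `[x, y]%classic dg.
  apply/sqintP; split; first exact: measurable_funTS.
  apply: cW => z; rewrite /continuous_at expr2; under eq_fun do rewrite expr2.
  by apply: cvgM; exact: cdg.
have s1 : sqint leb `[x, y]%classic (fun=> 1).
  by apply/sqintP; split => //; apply: cW => z; exact: cvg_cst.
have mxy : measurable (`[x, y]%classic : set (measurableTypeR R)) by exact: measurable_itv.
have e := integral_derive dgE cdg ltxy.
have e1 : ip leb `[x, y]%classic dg (fun=> 1) = g y - g x.
  rewrite ip.unlock /Rintegral; under eq_integral do rewrite mulr1.
  by rewrite e -EFinB.
have e2 : ip leb `[x, y]%classic (fun=> 1) (fun=> 1) = y - x.
  rewrite ip.unlock (@eq_Rintegral _ _ _ _ _ (cst 1)); last by move=> z _; rewrite mulr1.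
  have lxy : lebesgue_measure (`[x, y]%classic : set R) = (y - x)%:E.
    by rewrite lebesgue_measure_itv/= lte_fin ltxy -EFinB.
  rewrite Rintegral_cst// mul1r; exact: (congr1 fine lxy).
have := cauchy_schwarz mxy sq s1; rewrite e1 e2 => cs.
rewrite -[(_ - _) ^+ 2]sqrrN opprB.
apply: (@le_trans _ _ (h%:E * (ip leb `[x, y]%classic dg dg)%:E)%E).
  rewrite -EFinM lee_fin (le_trans cs)// mulrC ler_wpM2r ?ip_ge0//.
  by move: ax yh; lra.
apply: lee_wpmul2l; first by rewrite lee_fin ltW.
rewrite (ip_EFin mxy sq).
have mah : measurable (`[a, (a + h)[%classic : set (measurableTypeR R)) by exact: measurable_itv.
apply: (@ge0_subset_integral _ _ R leb _ _ mxy mah).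
- exact: m2.
- by move=> s _; rewrite lee_fin sqr_ge0.
- by move=> s /=; rewrite !in_itv/= => /andP[? ?]; apply/andP; split; move: ax yh; lra.
Qed.

End one_dimensional_oscillation.

Section cells.
Variable R : realType.
Local Notation P := (measurableTypeR R * measurableTypeR R)%type.
Local Notation leb := (@lebesgue_measure R).
Local Notation mu2 := (@mu2 R).

(** Half open, so that a cell of side 2h is the disjoint union of four cells of side h. *)
Definition cell (a c h : R) : set P := `[a, (a + h)[ `*` `[c, (c + h)[.

Lemma measurable_cell a c h : measurable (cell a c h).
Proof. by apply: measurableX; exact: measurable_itv. Qed.

Lemma mu2_cell a c h : 0 < h -> mu2 (cell a c h) = (h ^+ 2)%:E.
Proof.
move=> h0.
transitivity (lebesgue_measure (`[a, (a + h)%R[%classic : set R) *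
    lebesgue_measure (`[c, (c + h)%R[%classic : set R))%E.
  by apply: (@product_measure1E _ _ _ _ R leb leb).
have l (b : R) : lebesgue_measure (`[b, (b + h)[%classic : set R) = h%:E.
  rewrite lebesgue_measure_itv/= lte_fin ltrDl h0 -EFinB.
  by rewrite addrAC subrr add0r.
by rewrite !l -EFinM expr2.
Qed.

Definition start (i : bool) (a c : R) : R := if i then c else a.

Lemma cell_slice i a c h t s : cell a c h (dir_slice i t s) <->
  `[start (~~ i) a c, start (~~ i) a c + h[%classic t /\
  `[start i a c, start i a c + h[%classic s.
Proof. by case: i => /=; split => -[]. Qed.

Lemma fin_cell_integrable a c h (f : P -> R) M : 0 < h -> measurable_fun setT f ->
  (forall x, `|f x| <= M) -> mu2.-integrable (cell a c h) (EFin \o f).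
Proof.
move=> h0 mf fM; apply: measurable_bounded_integrable.
- exact: measurable_cell.
- by rewrite mu2_cell// ltry.
- exact: measurable_funTS.
- exists M; split; first exact: num_real.
  by move=> N MN x /= Ox; rewrite (le_trans (fM x))// ltW.
Qed.

Lemma tonelli_cell i a c h (F : P -> \bar R) : measurable_fun setT F ->
  (forall x, 0 <= F x)%E ->
  (\int[mu2]_(x in cell a c h) F x =
   \int[leb]_(t in `[start (~~ i) a c, (start (~~ i) a c + h)%R[)
     \int[leb]_(s in `[start i a c, (start i a c + h)%R[) F (dir_slice i t s))%E.
Proof.
move=> mF F0; rewrite integral_mkcond (@tonelli_slice _ i); last 2 first.
- by apply/(measurable_restrictT F (measurable_cell a c h)); exact: measurable_funTS.
- by move=> x; rewrite patchE; case: ifP.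
rewrite [RHS]integral_mkcond; apply: eq_integral => t _.
rewrite [RHS]patchE; case: ifPn => ht.
  rewrite [RHS]integral_mkcond; apply: eq_integral => s _; rewrite !patchE.
  congr (if _ then _ else _); apply/idP/idP => /set_mem hs; apply/mem_set.
    by have /cell_slice[] := hs.
  by apply/cell_slice; split => //; exact: set_mem ht.
rewrite (eq_integral (fun=> 0%E)) ?integral0// => s _; rewrite patchE ifN//.
by apply: contra ht => /set_mem/cell_slice[? _]; exact: mem_set.
Qed.

(** The double integral of (f x - f y)^2 equals twice m F2 - F1^2. The assumed bound is a function
    of x plus a function of y, so it is integrated in one variable after the other, with no measure
    on pairs of points. *)
Lemma variance_le (Q : set P) (f p q : P -> R) : measurable Q ->
  (mu2 Q < +oo)%E ->
  mu2.-integrable Q (EFin \o f) ->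
  mu2.-integrable Q (EFin \o (fun x => f x ^+ 2)) ->
  mu2.-integrable Q (EFin \o p) -> mu2.-integrable Q (EFin \o q) ->
  (forall x y, Q x -> Q y -> (f x - f y) ^+ 2 <= 2 * (p x + q y)) ->
  fine (mu2 Q) * \int[mu2]_(x in Q) (f x ^+ 2) <=
  (\int[mu2]_(x in Q) f x) ^+ 2 +
  fine (mu2 Q) * (\int[mu2]_(x in Q) p x + \int[mu2]_(x in Q) q x).
Proof.
move=> mQ fQ if1 if2 ip iq h.
set m := fine (mu2 Q); set F1 := \int[mu2]_(x in Q) f x.
set F2 := \int[mu2]_(x in Q) f x ^+ 2.
have ic k : mu2.-integrable Q (EFin \o (fun=> k : R)).
  apply: measurable_bounded_integrable => //; exists `|k|.
  by split => [|N kN x _]; [exact: num_real|exact: ltW].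
have icst k : \int[mu2]_(x in Q) k = k * m by rewrite Rintegral_cst.
have iZ k (u : P -> R) : mu2.-integrable Q (EFin \o u) ->
    mu2.-integrable Q (EFin \o (fun x => k * u x)).
  by move=> iu; have := integrableZl mQ k iu; exact: eq_integrable.
have iD (u v : P -> R) : mu2.-integrable Q (EFin \o u) -> mu2.-integrable Q (EFin \o v) ->
    mu2.-integrable Q (EFin \o (fun x => u x + v x)).
  by move=> iu iv; have := integrableD mQ iu iv; exact: eq_integrable.
have step1 x : Q x -> f x ^+ 2 * m - 2 * f x * F1 + F2 <= 2 * (p x * m + \int[mu2]_(y in Q) q y).
  move=> Qx.
  have -> : f x ^+ 2 * m - 2 * f x * F1 + F2 =
      \int[mu2]_(y in Q) (f x ^+ 2 + (- 2 * f x) * f y + f y ^+ 2).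
    rewrite RintegralD//; last by apply: (iD); [exact: ic|exact: iZ].
    by rewrite RintegralD ?icst ?RintegralZl//; [rewrite mulNr mulNr|exact: iZ].
  have -> : 2 * (p x * m + \int[mu2]_(y in Q) q y) =
      \int[mu2]_(y in Q) (2 * (p x + q y)).
    by rewrite RintegralZl ?RintegralD ?icst//; apply: (iD).
  apply: le_Rintegral => //.
  - by apply: (iD) => //; apply: (iD); [exact: ic|exact: iZ].
  - by apply: (iZ); exact: iD.
  - by move=> y Qy; apply: le_trans (h x y Qx Qy); rewrite le_eqVlt; apply/orP; left; apply/eqP; ring.
have : \int[mu2]_(x in Q) (m * f x ^+ 2 + (- 2 * F1) * f x + F2) <=
    \int[mu2]_(x in Q) (2 * (m * p x + \int[mu2]_(y in Q) q y)).
  apply: le_Rintegral => //.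
  - by apply: (iD); [apply: (iD); exact: iZ|exact: ic].
  - by apply: (iZ); apply: (iD); [exact: iZ|exact: ic].
  - move=> x Qx; have := step1 x Qx; rewrite (mulrC m (p x)).
    by apply: le_trans; rewrite le_eqVlt; apply/orP; left; apply/eqP; ring.
set p' := \int[mu2]_(x in Q) p x; set q' := \int[mu2]_(x in Q) q x.
have -> : \int[mu2]_(x in Q) (m * f x ^+ 2 + (- 2 * F1) * f x + F2) =
    m * F2 + (- 2 * F1) * F1 + F2 * m.
  have i1 := iZ m _ if2; have i2 := iZ (- 2 * F1) _ if1.
  by rewrite (RintegralD mQ (iD _ _ i1 i2) (ic F2)) (RintegralD mQ i1 i2)
    (RintegralZl m mQ if2) (RintegralZl _ mQ if1) icst.
have -> : \int[mu2]_(x in Q) (2 * (m * p x + q')) = 2 * (m * p' + q' * m).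
  have i1 := iZ m _ ip.
  by rewrite (RintegralZl 2 mQ (iD _ _ i1 (ic q'))) (RintegralD mQ i1 (ic q'))
    (RintegralZl m mQ ip) icst.
move: F1 F2 p' q' m {ic icst step1} => F1 F2 p' q' m H.
rewrite -(@ler_pM2l _ 2)//.
have -> : 2 * (F1 ^+ 2 + m * (p' + q')) = 2 * (m * p' + q' * m) + 2 * F1 * F1 by ring.
have -> : 2 * (m * F2) = m * F2 + - 2 * F1 * F1 + F2 * m + 2 * F1 * F1 by ring.
by rewrite lerD2r.
Qed.

End cells.

Lemma two_steps_le (R : realFieldType) (A B C D : R) :
  A ^+ 2 <= C -> B ^+ 2 <= D -> (A + B) ^+ 2 <= 2 * (C + D).
Proof. by move=> hA hB; have := sqr_ge0 (A - B); rewrite sqrrB sqrrD; lra. Qed.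

Lemma divide_area (R : realFieldType) (h F1 F2 D0 D1 : R) : 0 < h ->
  h ^+ 2 * F2 <= F1 ^+ 2 + h ^+ 2 * (h ^+ 2 * D0 + h ^+ 2 * D1) ->
  F2 <= (h^-1 * F1) ^+ 2 + h ^+ 2 * (D0 + D1).
Proof.
move=> h0 H; have h2 : 0 < h ^+ 2 by rewrite exprn_gt0.
rewrite -(@ler_pM2l _ (h ^+ 2))//; apply: (le_trans H).
rewrite le_eqVlt; apply/orP; left; apply/eqP; field.
by rewrite gt_eqF.
Qed.

Section cell_poincare.
Variables (R : realType) (Omega : set (R * R)) (f : R * R -> R).
Hypothesis tf : test_fun Omega f.
Local Notation P := (measurableTypeR R * measurableTypeR R)%type.
Local Notation leb := (@lebesgue_measure R).
Local Notation mu2 := (@mu2 R).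
Variables (a c h : R).
Hypothesis h0 : 0 < h.
Local Notation Q := (cell a c h).
Local Notation I i := `[start i a c, (start i a c + h)%R[%classic.
Local Notation df i := ('D_(dir R i) f).

Definition transverse (i : bool) (x : R * R) : R := if i then x.1 else x.2.
Definition longitudinal (i : bool) (x : R * R) : R := if i then x.2 else x.1.

Lemma measurable_transverse i : measurable_fun setT (transverse i : P -> R).
Proof. by case: i; [exact: measurable_fst|exact: measurable_snd]. Qed.

Lemma measurable_longitudinal i : measurable_fun setT (longitudinal i : P -> R).
Proof. by case: i; [exact: measurable_snd|exact: measurable_fst]. Qed.

Definition line_energy (i : bool) (t : R) : \bar R :=
  (\int[leb]_(s in I i) ((df i (dir_slice i t s)) ^+ 2)%:E)%E.

Lemma line_energy_ge0 i t : (0 <= line_energy i t)%E.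
Proof. by apply: integral_ge0 => s _; rewrite lee_fin sqr_ge0. Qed.

Let lI i : leb (I i) = h%:E.
Proof.
have := lebesgue_measure_itv `[start i a c, (start i a c + h)%R[.
rewrite /= lte_fin ltrDl h0 -EFinB => e.
by rewrite addrAC subrr add0r in e; exact: e.
Qed.

Let mI i : measurable (I i : set (measurableTypeR R)). Proof. exact: measurable_itv. Qed.

Let bd i : exists2 M, 0 < M & forall x, `|df i x| <= M.
Proof. exact: test_bounded (test_derive _ tf). Qed.

Let md i : measurable_fun setT (df i : P -> R).
Proof. exact: measurable_smooth (test_smooth (test_derive _ tf)). Qed.

Let mslice i t : measurable_fun setT (fun s : R => df i (dir_slice i t s)).
Proof.
apply: continuous_measurable_fun; apply: (@continuous_slice_comp _ (df i)).
exact: smooth_continuous (test_smooth (test_derive _ tf)).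
Qed.

Lemma line_energy_le i : exists2 M, 0 <= M & forall t, (line_energy i t <= M%:E)%E.
Proof.
have [M M0 hM] := bd i; exists (M ^+ 2 * h); first by rewrite mulr_ge0 ?sqr_ge0// ltW.
move=> t; apply: (@le_trans _ _ (\int[leb]_(s in I i) (M ^+ 2)%:E)%E).
  apply: ge0_le_integral.
  - exact: mI.
  - by move=> s _; rewrite lee_fin sqr_ge0.
  - by apply/measurable_EFinP; apply: measurable_funX; apply: measurable_funTS; exact: mslice.
  - exact: measurable_cst.
  - move=> s _; rewrite lee_fin -(@real_normK _ (df i _)) ?num_real//.
    by rewrite lerXn2r ?nnegrE// ltW.
have -> : (\int[leb]_(s in I i) (M ^+ 2)%:E = (M ^+ 2 * h)%:E)%E.
  exact: (etrans (integral_cst leb (mI i) _) (congr1 (mule _) (lI i))).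
by [].
Qed.

Definition line_energyR i t : R := fine (line_energy i t).

Lemma line_energyE i t : (line_energyR i t)%:E = line_energy i t.
Proof.
have [M _ hM] := line_energy_le i; rewrite /line_energyR fineK//.
by rewrite ge0_fin_numE ?line_energy_ge0// (le_lt_trans (hM t))// ltry.
Qed.

Lemma measurable_line_energy i : measurable_fun setT (line_energyR i).
Proof.
apply: measurableT_comp; first exact: fine_measurable.
pose G (x : P) : \bar R := if longitudinal i x \in I i then (df i x ^+ 2)%:E else 0%E.
have -> : line_energy i = (fun t => \int[leb]_s G (dir_slice i t s))%E.
  apply/funext => t; rewrite /line_energy integral_mkcond; apply: eq_integral => s _.
  by rewrite patchE /G /longitudinal /dir_slice; case: (i).
apply: measurable_tonelli_slice; last first.
  by move=> x; rewrite /G; case: ifP => // _; rewrite lee_fin sqr_ge0.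
apply: measurable_fun_if => //.
- apply: (measurable_fun_bool true) => //.
  rewrite setTI (_ : _ @^-1` _ = longitudinal i @^-1` I i); last first.
    by apply/seteqP; split => x /=; [move=> /set_mem|move=> ?; apply/mem_set].
  by rewrite -[X in measurable X]setTI; apply: measurable_longitudinal.
- by apply/measurable_EFinP; apply: measurable_funX; exact: measurable_funTS.
Qed.

Let p i (x : P) : R := h * line_energyR i (transverse i x).

Let mp i : measurable_fun setT (p i).
Proof.
apply: measurable_funM; first exact: measurable_cst.
by apply: measurableT_comp; [exact: measurable_line_energy|exact: measurable_transverse].
Qed.

Let p0 i x : 0 <= p i x.
Proof. by rewrite mulr_ge0 ?(ltW h0)// fine_ge0// line_energy_ge0. Qed.

Let intp i : mu2.-integrable Q (EFin \o p i).
Proof.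
have [M M0 hM] := line_energy_le i.
apply: (fin_cell_integrable a c (M := h * M)) => // x.
by rewrite ger0_norm// ler_pM2l// -lee_fin line_energyE.
Qed.

Let intd i : mu2.-integrable Q (EFin \o (fun x => df i x ^+ 2)).
Proof.
have [M M0 hM] := bd i.
apply: (fin_cell_integrable a c (M := M ^+ 2)) => //; first exact: measurable_funX.
by move=> x; rewrite normrX lerXn2r ?nnegrE// ltW.
Qed.

(** [p i] is constant along direction i; integrating it over that side gives a second factor h. *)
Let int_p i : \int[mu2]_(x in Q) p i x = h ^+ 2 * \int[mu2]_(x in Q) (df i x ^+ 2).
Proof.
have mQ : measurable Q := measurable_cell a c h.
rewrite -(RintegralZl _ mQ (intd i)) /Rintegral; congr fine.
under [RHS]eq_integral do rewrite EFinM.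
rewrite [RHS](@ge0_integralZl_EFin _ _ _ mu2 Q mQ (fun x => (df i x ^+ 2)%:E)); last 3 first.
- by move=> x _; rewrite lee_fin sqr_ge0.
- by apply/measurable_EFinP; apply: measurable_funX; exact: measurable_funTS.
- by rewrite sqr_ge0.
rewrite (@tonelli_cell _ i _ _ _ (fun x => (p i x)%:E)); last 2 first.
- exact/measurable_EFinP.
- by move=> x; rewrite lee_fin.
rewrite (@tonelli_cell _ i _ _ _ (fun x => (df i x ^+ 2)%:E)); last 2 first.
- by apply/measurable_EFinP; exact: measurable_funX.
- by move=> x; rewrite lee_fin sqr_ge0.
rewrite -ge0_integralZl_EFin; last 4 first.
- exact: mI.
- by move=> t _; exact: line_energy_ge0.
- have e : line_energy i = EFin \o line_energyR i.
    by apply/funext => t; rewrite /= line_energyE.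
  rewrite -[X in measurable_fun _ X]/(line_energy i) e; apply/measurable_EFinP.
  by apply: measurable_funTS; exact: measurable_line_energy.
- by rewrite sqr_ge0.
apply: eq_integral => t _; rewrite -/(line_energy i t) -line_energyE -EFinM.
have -> : (fun s => (p i (dir_slice i t s))%:E) = (fun=> (h * line_energyR i t)%:E).
  by apply/funext => s; rewrite /p /transverse /dir_slice; case: i.
rewrite (etrans (integral_cst leb (mI i) _) (congr1 (mule _) (lI i))) -EFinM.
by congr EFin; ring.
Qed.

Let osc i t s s' : I i s -> I i s' ->
  (f (dir_slice i t s) - f (dir_slice i t s')) ^+ 2 <= h * line_energyR i t.
Proof.
rewrite /= !in_itv /= => hs hs'; rewrite -lee_fin (EFinM h) line_energyE.
apply: (@oscillation_le _ (fun s => f (dir_slice i t s)) (fun s => df i (dir_slice i t s))) => //.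
- by move=> u; exact: is_derive_slice (test_smooth tf).
- by apply: (@continuous_slice_comp _ (df i)); exact: smooth_continuous (test_smooth (test_derive _ tf)).
Qed.

(** Join x to y inside the square by a horizontal segment at the height of x and then a vertical one
    at the abscissa of y. The cost of the first depends on x alone and that of the second on y
    alone, as [variance_le] requires. *)
Lemma cell_poincare :
  \int[mu2]_(x in Q) (f x ^+ 2) <= (h^-1 * \int[mu2]_(x in Q) f x) ^+ 2 +
   h ^+ 2 * (\int[mu2]_(x in Q) (df false x ^+ 2) + \int[mu2]_(x in Q) (df true x ^+ 2)).
Proof.
have mQ : measurable Q := measurable_cell a c h.
have [M M0 hM] := test_bounded tf.
have mf : measurable_fun setT (f : P -> R) by exact: measurable_smooth (test_smooth tf).
have if1 : mu2.-integrable Q (EFin \o f) by exact: (fin_cell_integrable a c (M := M)).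
have if2 : mu2.-integrable Q (EFin \o (fun x => f x ^+ 2)).
  apply: (fin_cell_integrable a c (M := M ^+ 2)) => //; first exact: measurable_funX.
  by move=> x; rewrite normrX lerXn2r ?nnegrE// ltW.
have hxy x y : Q x -> Q y -> (f x - f y) ^+ 2 <= 2 * (p false x + p true y).
  case: x y => [x1 x2] [y1 y2] [/= qx1 qx2] [/= qy1 qy2].
  have o1 := @osc false x2 x1 y1 qx1 qy1; have o2 := @osc true y1 x2 y2 qx2 qy2.
  rewrite /dir_slice /= in o1 o2; rewrite /p /transverse /=.
  have -> : f (x1, x2) - f (y1, y2) =
    (f (x1, x2) - f (y1, x2)) + (f (y1, x2) - f (y1, y2)) by rewrite addrA subrK.
  by apply: two_steps_le; [exact: o1|exact: o2].
have := variance_le mQ _ if1 if2 (intp false) (intp true) hxy.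
rewrite mu2_cell// ltry => /(_ isT); rewrite !int_p /=.
exact: (divide_area h0).
Qed.

End cell_poincare.

Lemma dyadic_sum_le (R : realFieldType) (h s1 s2 s3 s4 : R) (f1 f2 f3 f4 d1 d2 d3 d4 : R) :
  f1 <= s1 + h * d1 -> f2 <= s2 + h * d2 -> f3 <= s3 + h * d3 -> f4 <= s4 + h * d4 ->
  f1 + f2 + (f3 + f4) <= s1 + (s2 + (s3 + s4)) + h * (d1 + d2 + (d3 + d4)).
Proof. by lra. Qed.

Lemma sqrB_cs (R : realFieldType) (x y c : R) : y ^+ 2 <= c ->
  (x - y) ^+ 2 <= 2 * x ^+ 2 + 2 * c.
Proof. by move=> h; have := sqr_ge0 (x + y); rewrite sqrrB sqrrD; lra. Qed.

Lemma density_le (R : realFieldType) (eps C d v f g Df Dv Dg Sf Sv : R) :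
  0 <= eps -> 0 <= C ->
  v <= 2 * f + 2 * g -> Df <= 2 * Dv + 2 * Dg -> Sf <= 2 * Sv + 2 * (C * g) ->
  (g + Dg) * (eps + 4 * C + 2) < d -> 0 <= Dg -> 0 <= g ->
  f <= eps / 4 * Df + Sf -> v <= eps * Dv + 4 * Sv + d.
Proof.
move=> e0 C0 h1 h2 h3 h4 D0 g0 h5.
have := ler_wpM2l e0 h2; have := mulr_ge0 e0 g0; have := mulr_ge0 C0 D0.
have := mulr_ge0 C0 g0; have := mulr_ge0 e0 D0.
move: h4; rewrite !mulrDl !mulrDr => h4 p1 p2 p3 p4 p5; move: h1 h3 h5 h4 p1 p2 p3 p4 p5.
lra.
Qed.

(** * Quantitative compactness of the L^2 norm relative to the energy *)

Section finite_rank_approximation.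
Variables (R : realType) (Omega : set (R * R)).
Hypotheses (oO : open Omega) (bO : bounded_set Omega).
Local Notation P := (measurableTypeR R * measurableTypeR R)%type.
Local Notation mu2 := (@mu2 R).
Local Notation ipO := (ip mu2 (Omega : set P)).
Local Notation dO := (dform Omega).
Let mO : measurable (Omega : set P). Proof. exact: open_measurable2. Qed.

Lemma cell_split a c h (g : P -> R) M : 0 < h -> measurable_fun setT g ->
  (forall x, `|g x| <= M) ->
  \int[mu2]_(x in cell a c (2 * h)) g x =
  \int[mu2]_(x in cell a c h) g x + \int[mu2]_(x in cell (a + h) c h) g x +
  (\int[mu2]_(x in cell a (c + h) h) g x + \int[mu2]_(x in cell (a + h) (c + h) h) g x).
Proof.
move=> h0 mg gM.
have h20 : 0 < 2 * h by rewrite mulr_gt0.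
have ig a' c' : mu2.-integrable (cell a' c' h) (EFin \o g).
  exact: (fin_cell_integrable a' c' (M := M)).
have iG := fin_cell_integrable a c h20 mg gM.
have mc a' c' := measurable_cell a' c' h.
have e : cell a c (2 * h) = (cell a c h `|` cell (a + h) c h) `|`
   (cell a (c + h) h `|` cell (a + h) (c + h) h).
  apply/seteqP; split => -[x y]; rewrite /cell /= !in_itv /=.
    move=> [/andP[x1 x2] /andP[y1 y2]].
    have [xa|xa] := ltP x (a + h); have [yc|yc] := ltP y (c + h).
    - by left; left; split; apply/andP; split.
    - by right; left; split; apply/andP; split => //; move: y2; lra.
    - by left; right; split; apply/andP; split => //; move: x2; lra.
    - by right; right; split; apply/andP; split => //; move: x2 y2; lra.
  by move=> [[]|[]] [/andP[x1 x2] /andP[y1 y2]]; split; apply/andP; split;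
    move: h0 x1 x2 y1 y2; lra.
rewrite e in iG *.
have mU c' : measurable (cell a c' h `|` cell (a + h) c' h) by apply: measurableU.
have iU c' : mu2.-integrable (cell a c' h `|` cell (a + h) c' h) (EFin \o g).
  have h20' := fin_cell_integrable a c' h20 mg gM.
  apply: (integrableS (measurable_cell a c' (2 * h)) (mU c') _ h20').
  by move=> -[x y]; rewrite /cell /= !in_itv /= => -[] [/andP[x1 x2] /andP[y1 y2]];
    split; apply/andP; split; move: h0 x1 x2 y1 y2; lra.
have dj c' : [disjoint cell a c' h & cell (a + h) c' h]%classic.
  apply/disj_setPRL => -[x y] /= ; rewrite /cell /= !in_itv /= => -[/andP[x1 x2] _].
  by move=> [/andP[x3 x4] _]; move: x2 x3; lra.
rewrite (Rintegral_setU (mU c) (mU (c + h)) iG); last first.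
  apply/disj_setPRL => -[x y] /= ; rewrite /cell /= !in_itv /= => q1 q2.
  have : c + h <= y by case: q1 => -[_ /andP[]].
  have : y < c + h by case: q2 => -[_ /andP[]].
  lra.
by congr (_ + _); apply: Rintegral_setU.
Qed.

(** Each step of the induction splits a square into four. Energies over disjoint squares add up, so
    the factor stays h^2 however large the square is. *)
Lemma dyadic_poincare k a c (h : R) : 0 < h -> exists s : seq (R * R),
  forall f, test_fun Omega f ->
  \int[mu2]_(x in cell a c (2 ^+ k * h)) (f x ^+ 2) <=
  \sum_(e <- s) (h^-1 * \int[mu2]_(x in cell e.1 e.2 h) f x) ^+ 2 +
  h ^+ 2 * (\int[mu2]_(x in cell a c (2 ^+ k * h)) (('D_(dir R false) f x) ^+ 2 + ('D_(dir R true) f x) ^+ 2)).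
Proof.
move=> h0; elim: k a c => [|k IH] a c.
  exists [:: (a, c)] => f tf; rewrite big_seq1/= expr0 mul1r.
  have td i := test_derive (dir R i) tf.
  have i2 i : mu2.-integrable (cell a c h) (EFin \o (fun x => ('D_(dir R i) f x) ^+ 2)).
    have [M M0 hM] := test_bounded (td i).
    apply: (fin_cell_integrable a c (M := M ^+ 2)) => //.
      by apply: measurable_funX; exact: measurable_smooth (test_smooth (td i)).
    by move=> x; rewrite normrX lerXn2r ?nnegrE// ltW.
  rewrite (RintegralD (measurable_cell a c h) (i2 false) (i2 true)).
  exact: (cell_poincare tf a c h0).
have [s1 H1] := IH a c; have [s2 H2] := IH (a + 2 ^+ k * h) c.
have [s3 H3] := IH a (c + 2 ^+ k * h); have [s4 H4] := IH (a + 2 ^+ k * h) (c + 2 ^+ k * h).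
exists (s1 ++ (s2 ++ (s3 ++ s4))) => f tf.
have td i := test_derive (dir R i) tf.
have k0 : 0 < 2 ^+ k * h by rewrite mulr_gt0// exprn_gt0.
rewrite exprS -mulrA.
have [M M0 hM] := test_bounded tf.
have mf : measurable_fun setT (f : P -> R) by exact: measurable_smooth (test_smooth tf).
rewrite (@cell_split a c _ (fun x => f x ^+ 2) (M ^+ 2))//; last 2 first.
- exact: measurable_funX.
- by move=> x; rewrite normrX lerXn2r ?nnegrE// ltW.
have [M1 M10 hM1] := test_bounded (td false); have [M2 M20 hM2] := test_bounded (td true).
rewrite (@cell_split a c _ (fun x => ('D_(dir R false) f x) ^+ 2 + ('D_(dir R true) f x) ^+ 2) (M1 ^+ 2 + M2 ^+ 2))//; last 2 first.
- by apply: measurable_funD; apply: measurable_funX; exact: measurable_smooth (test_smooth (td _)).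
- move=> x; apply: (le_trans (ler_normD _ _)).
  by rewrite !normrX lerD// lerXn2r ?nnegrE// ltW.
rewrite !big_cat /=.
exact: dyadic_sum_le (H1 f tf) (H2 f tf) (H3 f tf) (H4 f tf).
Qed.

(* Quantitative Rellich compactness, by the Poincare inequality on small dyadic
   squares; the functionals are the means over these squares. *)
Lemma finite_rank_test (eps : R) : 0 < eps -> exists s : seq (R * R -> R),
  (forall i, L2 Omega (nth (fun=> 0) s i)) /\
  forall f, test_fun Omega f ->
    ipO f f <= eps * dO f f + \sum_(i < size s) (ipO (nth (fun=> 0) s i) f) ^+ 2.
Proof.
move=> e0; have [L L0 hL] := bounded_box bO.
(* The dyadic cells are refined until the square of their side is below [eps]. *)
have [k hk] : exists k, (2 * L / 2 ^+ k) ^+ 2 <= eps.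
  have c : (2 * L) ^+ 2 * 4^-1 ^+ k @[k --> \oo] --> ((2 * L) ^+ 2 * 0 : R).
    by apply: cvgMr; apply: cvg_expr; rewrite ger0_norm; lra.
  rewrite mulr0 in c.
  have /cvgr_lt/(_ eps e0)[k _ hk] := c.
  exists k; have := hk k (leqnn k); rewrite /= => /ltW; apply: le_trans.
  rewrite expr_div_n -exprM mulnC exprM -natrX exprVn.
  by rewrite (_ : (2 ^ 2)%N = 4)%N.
set h := 2 * L / 2 ^+ k in hk.
have h0 : 0 < h by rewrite divr_gt0 ?exprn_gt0// mulr_gt0.
have [s hs] := dyadic_poincare k (- L) (- L) h0.
have e2 : 2 ^+ k * h = 2 * L.
  by rewrite /h mulrC divfK// gt_eqF// exprn_gt0.
rewrite e2 in hs.
have OQ x : Omega x -> cell (- L) (- L) (2 * L) x.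
  move=> /hL[]; rewrite !ltr_norml /cell /= !in_itv /= => /andP[x1 x2] /andP[x3 x4].
  by split; apply/andP; split; move: x1 x2 x3 x4; lra.
(* Test functions vanish off Omega, so cells that cross the boundary do no harm. *)
have onQ (g : P -> R) : (forall x, ~ Omega x -> g x = 0) ->
    \int[mu2]_(x in cell (- L) (- L) (2 * L)) g x = \int[mu2]_(x in Omega) g x.
  move=> g0; rewrite /Rintegral; congr fine.
  rewrite (@integral_vanish _ Omega (fun x => (g x)%:E)); last by move=> x /g0 ->.
  by apply: integral_vanish => x nQ; rewrite g0// => /OQ.
pose E (e : R * R) (x : R * R) : R := h^-1 * \1_(cell e.1 e.2 h) x.
have LE e : L2 Omega (E e).
  apply: (bounded_L2 oO bO (M := h^-1)).
    apply: measurable_funM; first exact: measurable_cst.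
    by apply: measurable_funTS; apply: measurable_indic; exact: measurable_cell.
  move=> x; have hi : 0 <= h^-1 by rewrite invr_ge0 ltW.
  rewrite /E normrM (ger0_norm hi) indicE ger0_norm ?ler0n//.
  by rewrite ler_piMr// lern1 leq_b1.
have L0' : L2 Omega (fun=> 0 : R) := test_L2 oO bO (test0 Omega).
exists [seq E e | e <- s]; split.
  move=> i; have [si|si] := ltnP i (size s); first by rewrite (nth_map (0, 0))//.
  by rewrite nth_default ?size_map.
move=> f tf.
have td i := test_derive (dir R i) tf.
have := hs f tf; rewrite (onQ (fun x => f x ^+ 2)); last first.
  by move=> x nx; rewrite (test_outside tf nx) expr0n.
rewrite (onQ (fun x => ('D_(dir R false) f x) ^+ 2 + ('D_(dir R true) f x) ^+ 2)); last first.
  by move=> x nx; rewrite (test_outside (td false) nx) (test_outside (td true) nx) expr0n addr0.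
have -> : \int[mu2]_(x in Omega) (f x ^+ 2) = ipO f f.
  by rewrite -ip2E; apply: eq_Rintegral => x _; rewrite expr2.
have -> : \int[mu2]_(x in Omega) (('D_(dir R false) f x) ^+ 2 + ('D_(dir R true) f x) ^+ 2) = dO f f.
  have i2 i := sqint_mul mO (test_L2 oO bO (td i)) (test_L2 oO bO (td i)).
  rewrite (dform_test2 oO bO tf tf) -!ip2E -(RintegralD mO (i2 false) (i2 true)).
  by apply: eq_Rintegral => x _; rewrite !expr2.
have -> : \sum_(e <- s) (h^-1 * \int[mu2]_(x in cell e.1 e.2 h) f x) ^+ 2 =
    \sum_(i < size [seq E e | e <- s]) (ipO (nth (fun=> 0) [seq E e | e <- s] i) f) ^+ 2.
  rewrite size_map (big_nth (0, 0)) big_mkord; apply: eq_bigr => i _.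
  rewrite (nth_map (0, 0))//; move: (nth _ s i) => e; congr (_ ^+ 2).
  have [M M0 hM] := test_bounded tf.
  rewrite -RintegralZl; last 2 first.
  - exact: measurable_cell.
  - by apply: (fin_cell_integrable _ _ (M := M)) => //; exact: measurable_smooth (test_smooth tf).
  rewrite -ip2E /Rintegral; congr fine.
  rewrite integral_mkcond [RHS]integral_vanish; last first.
    by move=> x nx; rewrite (test_outside tf nx) mulr0.
  apply: eq_integral => x _; rewrite patchE /E indicE.
  by case: ifP => _; rewrite ?mulr1 ?mulr0 ?mul0r.
move=> H; rewrite addrC; apply: (le_trans H); rewrite lerD2l.
by rewrite ler_wpM2r ?dform_ge0.
Qed.

(** Two splittings of a square on the way to the closure cost a factor 4: hence [eps / 4] for test
    functions, and functionals multiplied by 2. *)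
Lemma finite_rank (eps : R) : 0 < eps -> exists s : seq (R * R -> R),
  (forall i, L2 Omega (nth (fun=> 0) s i)) /\
  forall v, W012 Omega v ->
    ipO v v <= eps * dO v v + \sum_(i < size s) (ipO (nth (fun=> 0) s i) v) ^+ 2.
Proof.
move=> e0; have e4 : 0 < eps / 4 by lra.
have [s [Ls hs]] := finite_rank_test e4.
set E := nth (fun=> 0) s in Ls hs.
exists [seq (fun x => 2 * e x) | e <- s].
have En i : nth (fun=> 0) [seq (fun x => 2 * e x) | e <- s] i = (fun x => 2 * E i x).
  have [si|si] := ltnP i (size s); first by rewrite (nth_map (fun=> 0))//.
  by rewrite nth_default ?size_map// /E nth_default//; apply/funext => x; rewrite mulr0.
split=> [i|v hv]; first by rewrite En; exact: (sqintZ mO 2 (Ls i)).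
have Lv := W012_L2 hv; have Wv := W012_W12 hv.
rewrite size_map.
have -> : \sum_(i < size s) ipO (nth (fun=> 0) [seq (fun x => 2 * e x) | e <- s] i) v ^+ 2 =
    4 * \sum_(i < size s) (ipO (E i) v) ^+ 2.
  rewrite mulr_sumr; apply: eq_bigr => i _.
  by rewrite En (ipZl mO 2 (Ls i) Lv) exprMn -natrX.
pose C := \sum_(i < size s) ipO (E i) (E i).
have C0 : 0 <= C by apply: sumr_ge0 => i _; exact: ip_ge0.
apply/ler_addgt0Pr => d d0.
have [_ /(_ (d / (eps + 4 * C + 2)))[|f tf hf]] := (W012P oO bO v).1 hv.
  by rewrite divr_gt0//; lra.
have Lf := test_L2 oO bO tf; have Wf := test_W12 oO bO tf.
set g := (fun x => v x - f x) in hf.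
have Wg : W12 Omega g := W12B oO bO Wv Wf.
have hfg : v = (fun x => f x + g x) by apply/funext => x; rewrite /g addrC subrK.
have h1 := ip_leD oO Lf Wg.1; rewrite -hfg in h1.
have h2 : dO f f <= 2 * dO v v + 2 * dO g g.
  have e : f = (fun x => v x + - 1 * g x) by apply/funext => x; rewrite /g mulN1r opprB addrC subrK.
  have := dform_leD oO bO Wv (W12Z oO bO (-1) Wg); rewrite -e.
  by rewrite (dformZZ oO bO (-1) Wg) sqrrN expr1n mul1r.
have h3 : \sum_(i < size s) (ipO (E i) f) ^+ 2 <=
   2 * \sum_(i < size s) (ipO (E i) v) ^+ 2 + 2 * (C * ipO g g).
  rewrite /C mulr_suml !mulr_sumr -big_split; apply: ler_sum => i _ /=.
  have e : ipO (E i) f = ipO (E i) v - ipO (E i) g.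
    have e := ipDl mO Lf Wg.1 (Ls i); rewrite -hfg in e.
    by rewrite !(ip2C Omega (E i)) e addrK.
  have := cauchy_schwarz mO (Ls i) Wg.1; rewrite e.
  exact: sqrB_cs.
have := hs f tf; rewrite ltr_pdivlMr in hf; last by lra.
move: h1 h2 h3 hf (dform_ge0 Omega g) (ip_ge0 mu2 (Omega : set P) g); rewrite /sob.
exact: density_le (ltW e0) C0.
Qed.

End finite_rank_approximation.

(** * Logarithmic energy of nonnegative supersolutions *)

Section logarithmic_estimates.
Variable R : realFieldType.
Implicit Types a b m x y z e s t p k : R.

(** Read t = f, y = psi, s = sqrt(1 + t^2), with [a] and [b] partial derivatives of f and psi: the
    left side is the partial derivative of f times that of psi^2 (s - t). One completes the square
    in y a - 2 b s. The only danger is that (s - t) s is large for negative t; there t^2 <= (t -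
    p)^2 because p >= 0. *)
Lemma log_energy_pointwise s t p y a b : 0 < s -> s ^+ 2 = 1 + t ^+ 2 -> 0 <= p ->
  a * (2 * y * b * (s - t) - y ^+ 2 * ((s - t) / s * a)) <=
  4 * b ^+ 2 + 4 * b ^+ 2 * (t - p) ^+ 2 + - 4^-1 * (y * (t / (1 + t ^+ 2) * a)) ^+ 2.
Proof.
move=> s0 s2 p0; rewrite -s2.
have H0 : 0 < s - t.
  rewrite subr_gt0; have [t0|t0] := ltP t 0; first exact: lt_trans s0.
  by rewrite -(@ltr_pXn2r _ 2)// ?nnegrE ?(ltW s0)// s2; lra.
have Hs : (s - t) * s <= 2 + 2 * (t - p) ^+ 2.
  have [t0|t0] := ltP t 0.
    have tp : t ^+ 2 <= (t - p) ^+ 2.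
      rewrite -(sqrrN t) -(sqrrN (t - p)) lerXn2r ?nnegrE//; lra.
    by have := sqr_ge0 (s + t); rewrite sqrrD mulrBl -expr2 s2; move: tp; lra.
  have := mulr_ge0 t0 (ltW H0); have := sqr_ge0 (t - p).
  by rewrite mulrBr mulrBl -!expr2 s2 (mulrC t s); lra.
have k2 : (t / s ^+ 2) ^+ 2 <= 2 * ((s - t) / s).
  rewrite -subr_ge0.
  have -> : 2 * ((s - t) / s) - (t / s ^+ 2) ^+ 2 =
    (2 * ((s - t) * s) * s ^+ 2 - t ^+ 2) / s ^+ 4.
    by field; rewrite gt_eqF.
  apply: divr_ge0; last by rewrite exprn_ge0// ltW.
  have -> : 2 * ((s - t) * s) = 1 + (s - t) ^+ 2.
    by rewrite sqrrB mulrBl -expr2 s2; ring.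
  have := mulr_ge0 (sqr_ge0 (s - t)) (sqr_ge0 s).
  rewrite mulrDl mul1r; move: (_ * s ^+ 2) => X; move: s2; lra.
have e : a * (2 * y * b * (s - t) - y ^+ 2 * ((s - t) / s * a)) =
   2 * b ^+ 2 * ((s - t) * s) - 2^-1 * (y * a) ^+ 2 * ((s - t) / s)
   - 2^-1 * ((s - t) / s) * (y * a - 2 * b * s) ^+ 2.
  by field; rewrite gt_eqF.
rewrite e; have b0 := sqr_ge0 b.
have m1 := ler_wpM2l b0 Hs.
have m2 := ler_wpM2l (sqr_ge0 (y * a)) k2.
have m3 : 0 <= ((s - t) / s) * (y * a - 2 * b * s) ^+ 2.
  by rewrite mulr_ge0 ?sqr_ge0// divr_ge0// ltW.
have -> : (y * (t / s ^+ 2 * a)) ^+ 2 = (y * a) ^+ 2 * (t / s ^+ 2) ^+ 2 by ring.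
move: m1 m2 m3; move: ((t / s ^+ 2) ^+ 2) ((s - t) / s) ((y * a) ^+ 2) ((s - t) * s) => X K Y Z.
lra.
Qed.

(** A crude bound on the gradient of the same test function by f and its gradient; it controls the
    error made in replacing p by f. *)
Lemma log_test_pointwise s t y a b A B : 0 < s -> s ^+ 2 = 1 + t ^+ 2 ->
  `|y| <= A -> `|b| <= B ->
  (2 * y * b * (s - t) - y ^+ 2 * ((s - t) / s * a)) ^+ 2 <=
  32 * (A * B) ^+ 2 + 32 * (A * B) ^+ 2 * t ^+ 2 + 8 * (A ^+ 2) ^+ 2 * a ^+ 2.
Proof.
move=> s0 s2 yA bB.
have A0 : 0 <= A := le_trans (normr_ge0 _) yA.
have B0 : 0 <= B := le_trans (normr_ge0 _) bB.
have y2 : y ^+ 2 <= A ^+ 2 by rewrite -(real_normK (num_real y)) lerXn2r ?nnegrE.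
have b2 : b ^+ 2 <= B ^+ 2 by rewrite -(real_normK (num_real b)) lerXn2r ?nnegrE.
have H2 : (s - t) ^+ 2 <= 4 * s ^+ 2.
  by have := sqr_ge0 (s + t); rewrite sqrrB sqrrD; move: s2; lra.
have K2 : ((s - t) / s) ^+ 2 <= 4.
  by rewrite expr_div_n ler_pdivrMr ?exprn_gt0.
have yb : (y * b) ^+ 2 <= (A * B) ^+ 2 by rewrite !exprMn ler_pM// sqr_ge0.
have y4 : (y ^+ 2) ^+ 2 <= (A ^+ 2) ^+ 2 by rewrite lerXn2r ?nnegrE ?sqr_ge0.
have m1 : (y * b) ^+ 2 * (s - t) ^+ 2 <= (A * B) ^+ 2 * (4 * s ^+ 2).
  by rewrite ler_pM ?sqr_ge0.
have m2 : (y ^+ 2) ^+ 2 * ((s - t) / s) ^+ 2 * a ^+ 2 <= (A ^+ 2) ^+ 2 * 4 * a ^+ 2.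
  by rewrite ler_wpM2r ?sqr_ge0// ler_pM ?sqr_ge0.
have := sqr_ge0 (2 * y * b * (s - t) + y ^+ 2 * ((s - t) / s * a)).
rewrite s2 in m1.
have -> : (2 * y * b * (s - t) + y ^+ 2 * ((s - t) / s * a)) ^+ 2 =
   2 * (4 * ((y * b) ^+ 2 * (s - t) ^+ 2) + (y ^+ 2) ^+ 2 * ((s - t) / s) ^+ 2 * a ^+ 2)
   - (2 * y * b * (s - t) - y ^+ 2 * ((s - t) / s * a)) ^+ 2.
  by move: ((s - t) / s) => k; ring.
move: m1 m2; move: ((_ - _) ^+ 2) => X.
move: ((y * b) ^+ 2 * _) ((y ^+ 2) ^+ 2 * _ * _) => Y Z; lra.
Qed.

End logarithmic_estimates.

Section logarithmic_functions.
Variable R : realType.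
Implicit Types t : R.

(** ln sqrt(1 + t^2), a logarithm without singularity; its companion [conj_root] is 1 / (sqrt(1 +
    t^2) + t), positive and decreasing on the whole line, so it may be composed with approximants
    that change sign. *)
Definition half_log t := ln (1 + t ^+ 2) / 2.
Definition conj_root t := Num.sqrt (1 + t ^+ 2) - t.

Let pos t : 0 < 1 + t ^+ 2. Proof. by rewrite ltr_pwDl ?sqr_ge0. Qed.

Let smooth_pos : smooth (fun t : R => 1 + t ^+ 2).
Proof. by apply: smoothD; [exact: smooth_cst|apply: smoothX; exact: smooth_id]. Qed.

Lemma smooth_ln (V : normedModType R) (f : V -> R) : smooth f -> (forall x, 0 < f x) ->
  smooth (fun x => ln (f x)).
Proof.
move=> sf f0; set G := fun x => _.
have dS x : is_derive (f x) 1 (@ln R) (f x)^-1 by exact: is_derive1_ln.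
have dG x : differentiable G x.
  apply: (@differentiable_comp _ _ _ _ f (@ln R)).
    exact: smooth_differentiable.
  by apply/derivable1_diffP; have := dS x => -[].
apply: (@smooth_genP _ _ G) => //; last exact: SGgen.
move=> v; rewrite (_ : 'D_v G = fun x => (f x)^-1 * 'D_v f x).
  apply: SGbase; apply: smoothM; last exact: smooth_derive.
  by apply: smoothV => // x; rewrite gt_eqF.
apply/funext => x; have df := smooth_differentiable sf x.
rewrite /G derive_comp1//; last by apply/derivable1_diffP; have := dS x => -[].
by have := dS x => -[_ ->].
Qed.

Lemma smooth_half_log : smooth half_log.
Proof.
rewrite /half_log; under eq_fun do rewrite mulrC.
by apply: smoothZ; apply: smooth_ln.
Qed.

Lemma smooth_conj_root : smooth conj_root.
Proof. by apply: smoothB; [exact: smooth_sqrt|exact: smooth_id]. Qed.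

Lemma conj_root_gt0 t : 0 < conj_root t.
Proof.
rewrite subr_gt0; have s0 : 0 < Num.sqrt (1 + t ^+ 2) by rewrite sqrtr_gt0.
have [t0|t0] := ltP t 0; first exact: lt_trans s0.
by rewrite -(@ltr_pXn2r _ 2)// ?nnegrE ?(ltW s0)// sqr_sqrtr ?ltW//; lra.
Qed.

Lemma derive_pos t : is_derive t (1 : R) (fun t : R => 1 + t ^+ 2) (2 * t).
Proof. by apply: is_derive_eq; rewrite add0r /GRing.scale /=; ring. Qed.

Lemma derive_half_log t : 'D_1 half_log t = t / (1 + t ^+ 2).
Proof.
have d1 := derive_pos t; have d2 := is_derive1_ln (pos t).
have d3 := @is_derive1_comp _ (@ln R) (fun t : R => 1 + t ^+ 2) _ _ _ d2 d1.
have d4 : is_derive t (1 : R) (fun t => 2^-1 * ln (1 + t ^+ 2)) (2^-1 * ((1 + t ^+ 2)^-1 * (2 * t))).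
  exact: (is_deriveZ 2^-1 d3).
rewrite /half_log; under eq_fun do rewrite mulrC.
by have [_ ->] := d4; field; rewrite gt_eqF.
Qed.

Lemma derive_conj_root t :
  'D_1 conj_root t = - (conj_root t / Num.sqrt (1 + t ^+ 2)).
Proof.
have d1 := derive_pos t; have d2 := is_derive1_sqrt (pos t).
have d3 := @is_derive1_comp _ (@Num.sqrt R) (fun t : R => 1 + t ^+ 2) _ _ _ d2 d1.
have d4 := is_deriveB d3 (is_derive_id t (1 : R)).
have s0 : Num.sqrt (1 + t ^+ 2) != 0 by rewrite gt_eqF// sqrtr_gt0.
have [_ e] := d4; rewrite /conj_root.
transitivity ((2 * Num.sqrt (1 + t ^+ 2))^-1 * (2 * t) - 1); first exact: e.
by field.
Qed.

Lemma half_log_ge0 t : 0 <= half_log t.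
Proof. by rewrite divr_ge0// ln_ge0// lerDl sqr_ge0. Qed.

Lemma half_log_le t : half_log t <= `|t|.
Proof.
rewrite ler_pdivrMr// -(expRK (`|t| * 2)) ler_ln ?posrE ?expR_gt0//.
have -> : expR (`|t| * 2) = expR `|t| ^+ 2 by rewrite -expRM_natl mulrC.
apply: (@le_trans _ _ ((1 + `|t|) ^+ 2)).
  by rewrite sqrrD expr1n mul1r real_normK ?num_real// lerD2r lerDl mulrn_wge0.
by rewrite lerXn2r ?nnegrE ?expR_ge0 ?expR_ge1Dx// addr_ge0.
Qed.

End logarithmic_functions.

(** * Independence of the representative *)

Section almost_everywhere_representatives.
Variables (R : realType) (Omega : set (R * R)).
Hypotheses (oO : open Omega) (bO : bounded_set Omega).
Local Notation P := (measurableTypeR R * measurableTypeR R)%type.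
Local Notation mu2 := (@mu2 R).
Local Notation ipO := (ip mu2 (Omega : set P)).
Local Notation wp := (wpart Omega).
Local Notation dO := (dform Omega).
Let mO : measurable (Omega : set P). Proof. exact: open_measurable2. Qed.

Lemma is_weak_partial_ae i u v g : L2 Omega u -> L2 Omega v ->
  {ae mu2, forall x, Omega x -> u x = v x} ->
  is_weak_partial Omega i u g -> is_weak_partial Omega i v g.
Proof.
move=> Lu Lv uv [Lg hg]; split; first exact: Lg.
move=> f tf; rewrite -hg//; rewrite !ip2E.
by rewrite (ip_ae oO Lu Lv (test_L2 oO bO (test_derive _ tf)) uv).
Qed.

Lemma dform_ae u v w : W12 Omega u -> L2 Omega v -> W12 Omega w ->
  {ae mu2, forall x, Omega x -> u x = v x} -> dO v w = dO u w.
Proof.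
move=> Wu Lv Ww uv.
have hv i := is_weak_partial_ae Wu.1 Lv uv (weak_partialP i Wu).
have Wv : W12 Omega v by split => // i; exists (wp i u).
have Lw i := weak_partial_L2 i Ww.
have e i : {ae mu2, forall x, Omega x -> wp i v x = wp i u x}.
  exact: (weak_partialE oO bO (hv i)).
rewrite dform.unlock.
by rewrite (ip_ae oO (weak_partial_L2 false Wv) (weak_partial_L2 false Wu) (Lw false) (e false))
  (ip_ae oO (weak_partial_L2 true Wv) (weak_partial_L2 true Wu) (Lw true) (e true)).
Qed.

Lemma W12_ae u v : W12 Omega u -> L2 Omega v ->
  {ae mu2, forall x, Omega x -> u x = v x} -> W12 Omega v.
Proof.
move=> Wu Lv uv; split => // i; exists (wp i u).
exact: is_weak_partial_ae Wu.1 Lv uv (weak_partialP i Wu).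
Qed.

Lemma W012_ae u v : W012 Omega u -> L2 Omega v ->
  {ae mu2, forall x, Omega x -> u x = v x} -> W012 Omega v.
Proof.
move=> hu Lv uv; have Wu := W012_W12 hu; have Wv := W12_ae Wu Lv uv.
apply: (W012_closed oO bO) => // e e0; exists u; first exact: hu.
have Wvu := W12B oO bO Wv Wu.
have z : {ae mu2, forall x, Omega x -> v x - u x = 0}.
  by apply: filterS uv => x + Ox => /(_ Ox) ->; rewrite subrr.
have z' : {ae mu2, forall x, Omega x -> (fun=> 0) x = v x - u x}.
  by apply: filterS z => x + Ox => /(_ Ox) ->.
rewrite /sob (ae0_ip mO Wvu.1 z) add0r.
have W0 := test_W12 oO bO (test0 Omega).
rewrite (dform_ae W0 Wvu.1 Wvu z').
by have := dformZl oO bO 0 W0 Wvu; rewrite !mul0r => ->.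
Qed.

End almost_everywhere_representatives.

(** [K] is the parameter in Young's inequality. It exceeds the energy e0 + e1 of the test function,
    while q + D < 1/K gives K^2 D <= K; together the error pairing D' is at most 1. *)
Lemma log_energy_arith (R : realFieldType) (A2 A4 B2 m q K sp ff f0 f1 x0 x1 e0 e1 g0 g1 D D' : R) :
  0 <= B2 -> 0 <= m -> 0 <= A2 -> 0 <= A4 -> 0 <= sp -> 0 <= f0 -> 0 <= f1 -> 0 <= ff ->
  K = (64 * A2 + 8 * A4) * (m + 2 * sp + 2) + 1 ->
  0 <= D -> 0 <= q ->
  x0 <= 4 * B2 * m + 4 * B2 * q + - 4^-1 * g0 ->
  x1 <= 4 * B2 * m + 4 * B2 * q + - 4^-1 * g1 ->
  e0 <= 32 * A2 * m + 32 * A2 * ff + 8 * A4 * f0 ->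
  e1 <= 32 * A2 * m + 32 * A2 * ff + 8 * A4 * f1 ->
  0 <= x0 + x1 + D' ->
  2 * K * D' <= K ^+ 2 * D + (e0 + e1) ->
  ff + (f0 + f1) <= 2 * sp + 2 * (q + D) ->
  q + D < K^-1 ->
  g0 + g1 <= 4 * (8 * B2 * (m + 1) + 1).
Proof.
move=> B20 m0 A20 A40 sp0 f00 f10 ff0 KE D0 q0 h1 h2 h3 h4 h5 h6 h7 h8.
have K1 : 1 <= K by rewrite KE lerDr mulr_ge0// !addr_ge0// mulr_ge0.
have K0 : 0 < K by exact: lt_le_trans K1.
have i1 : K^-1 <= 1 by rewrite invf_le1.
have d1 : q + D <= 1 by exact: le_trans (ltW h8) i1.
have KD : K * D <= 1.
  by rewrite -(divff (lt0r_neq0 K0)) ler_wpM2l ?(ltW K0)// (le_trans _ (ltW h8))// lerDr.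
have eK : e0 + e1 <= K.
  have t1 : ff <= 2 * sp + 2 by move: f00 f10 h7 d1; lra.
  have t2 : f0 + f1 <= 2 * sp + 2 by move: ff0 h7 d1; lra.
  have := ler_wpM2l A20 t1; have := ler_wpM2l A40 t2; have := mulr_ge0 A40 m0.
  have := mulr_ge0 A20 sp0; have := mulr_ge0 A40 sp0.
  by rewrite KE; move: h3 h4; lra.
have D1 : D' <= 1.
  have : 2 * K * D' <= 2 * K * 1.
    apply: (le_trans h6); have := ler_wpM2l (ltW K0) KD; rewrite mulrA -expr2.
    by move: eK; lra.
  by rewrite ler_pM2l// mulr_gt0.
have := ler_wpM2l B20 (le_trans _ d1 : q <= 1); rewrite lerDl => /(_ D0).
by move: h1 h2 h5 D1; lra.
Qed.

(** * Supersolutions and their logarithmic energy *)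

Section supersolutions.
Variables (R : realType) (Omega : set (R * R)).
Hypotheses (oO : open Omega) (bO : bounded_set Omega).
Local Notation P := (measurableTypeR R * measurableTypeR R)%type.
Local Notation mu2 := (@mu2 R).
Local Notation ipO := (ip mu2 (Omega : set P)).
Local Notation wp := (wpart Omega).
Local Notation dO := (dform Omega).
Let mO : measurable (Omega : set P). Proof. exact: open_measurable2. Qed.

Lemma ip_pointwise_le (u v g1 g2 : R * R -> R) C0 C1 C2 :
  L2 Omega u -> L2 Omega v -> L2 Omega g1 -> L2 Omega g2 ->
  (forall x, Omega x -> u x * v x <= C0 + C1 * (g1 x) ^+ 2 + C2 * (g2 x) ^+ 2) ->
  ipO u v <= C0 * fine (mu2 Omega) + C1 * ipO g1 g1 + C2 * ipO g2 g2.
Proof.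
move=> Lu Lv L1 L2' h.
have i0 := sqint_mul mO Lu Lv; have i1 := sqint_mul mO L1 L1; have i2 := sqint_mul mO L2' L2'.
have ic : mu2.-integrable (Omega : set P) (EFin \o (fun=> C0)).
  by apply: (bounded_integrable oO bO (M := `|C0|)) => //; exact: measurable_cst.
have iZ C g : mu2.-integrable (Omega : set P) (EFin \o g) ->
    mu2.-integrable (Omega : set P) (EFin \o (fun x => C * g x)).
  by move=> ig; have := integrableZl mO C ig; exact: eq_integrable.
have iD g g' : mu2.-integrable (Omega : set P) (EFin \o g) ->
    mu2.-integrable (Omega : set P) (EFin \o g') ->
    mu2.-integrable (Omega : set P) (EFin \o (fun x => g x + g' x)).
  by move=> ig ig'; have := integrableD mO ig ig'; exact: eq_integrable.
have j1 := iZ C1 _ i1; have j2 := iZ C2 _ i2; have j3 := iD _ _ ic j1.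
have -> : C0 * fine (mu2 Omega) + C1 * ipO g1 g1 + C2 * ipO g2 g2 =
    \int[mu2]_(x in Omega) (C0 + C1 * (g1 x * g1 x) + C2 * (g2 x * g2 x)).
  rewrite (RintegralD mO j3 j2) (RintegralD mO ic j1) (RintegralZl C1 mO i1)
    (RintegralZl C2 mO i2) !ip2E; congr (_ + _ + _).
  by rewrite Rintegral_cst// ; exact: mu2_domain_fin.
rewrite -ip2E; apply: le_Rintegral => //; first exact: iD _ _ j3 j2.
Qed.

Lemma deriveM_smooth (f g : R * R -> R) v x : smooth f -> smooth g ->
  'D_v (fun y => f y * g y) x = f x * 'D_v g x + g x * 'D_v f x.
Proof. by move=> sf sg; rewrite deriveM//; exact: smooth_derivable. Qed.

Lemma dform_young u v c : W12 Omega u -> W12 Omega v -> 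
  2 * c * dO u v <= c ^+ 2 * dO u u + dO v v.
Proof.
move=> Wu Wv; have := dform_ge0 Omega (fun x => c * u x - v x).
have Wcu := W12Z oO bO c Wu.
rewrite (dformBB oO bO Wcu Wv) (dformZZ oO bO c Wu) (dformZl oO bO c Wu Wv).
by rewrite mulrA; lra.
Qed.

(** Weak form of - Laplacian p >= 0, together with the sign of p. *)
Definition supersolution (p : R * R -> R) := [/\ W012 Omega p,
  forall x, Omega x -> 0 <= p x &
  forall eta, test_fun Omega eta -> (forall x, 0 <= eta x) -> 0 <= dO p eta].

(* The test function psi^2 H(f), with H(t) = sqrt(1+t^2) - t, bounds the energy of
   ln(1+f^2)/2 independently of p; applied to p/eps it is the usual bound on
   the gradient of ln(eps^2+p^2). *)
Lemma local_log_energy psi : test_fun Omega psi ->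
  exists2 C, 0 <= C & forall p, supersolution p -> exists2 d, 0 < d <= 1 &
  forall f, test_fun Omega f -> sob Omega (fun x => p x - f x) < d ->
  \int[mu2]_(x in Omega) ((psi x * 'D_(dir R false) (fun y => half_log (f y)) x) ^+ 2) +
  \int[mu2]_(x in Omega) ((psi x * 'D_(dir R true) (fun y => half_log (f y)) x) ^+ 2) <= C.
Proof.
move=> tpsi; have spsi := test_smooth tpsi.
have [A A0 hA] := test_bounded tpsi.
have tb i := test_derive (dir R i) tpsi.
have [B hB] : exists B, forall i x, `|'D_(dir R i) psi x| <= B.
  have [B0 _ hB0] := test_bounded (tb false); have [B1 _ hB1] := test_bounded (tb true).
  exists (Num.max B0 B1) => i x; rewrite le_max; apply/orP.
  by case: i; [right; exact: hB1|left; exact: hB0].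
set m := fine (mu2 Omega); have m0 : 0 <= m by exact: fine_ge0.
exists (4 * (8 * B ^+ 2 * (m + 1) + 1)).
  by repeat first [done | exact: sqr_ge0 | apply: addr_ge0 | apply: mulr_ge0].
move=> p [hp p0 sup]; have Wp := W012_W12 hp.
pose C1 := 64 * (A * B) ^+ 2 + 8 * (A ^+ 2) ^+ 2.
have C10 : 0 <= C1.
  by repeat first [done | exact: sqr_ge0 | apply: addr_ge0 | apply: mulr_ge0].
pose K := C1 * (m + 2 * sob Omega p + 2) + 1.
have K1 : 1 <= K.
  by rewrite lerDr; repeat first [done | exact: sob_ge0 | apply: addr_ge0 | apply: mulr_ge0].
have K0 : 0 < K by exact: lt_le_trans K1.
(* Only the required closeness of f depends on [p], through [K]; the bound fixed above depends on
   psi and Omega. *)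
exists K^-1; first by rewrite invr_gt0 K0 invf_le1.
move=> f tf hf; have sf := test_smooth tf.
set L := fun y => half_log (f y).
have Wf := test_W12 oO bO tf.
pose H y := conj_root (f y).
have sH : smooth H by exact: smooth_comp (@smooth_conj_root R) sf.
pose eta x := (psi x * H x) * psi x.
have spH : smooth (fun x => psi x * H x) := smoothM spsi sH.
have teta : test_fun Omega eta := testMl tpsi spH.
have eta0 x : 0 <= eta x.
  by rewrite /eta mulrAC -expr2 mulr_ge0 ?sqr_ge0// ltW// conj_root_gt0.
have Weta := test_W12 oO bO teta.
pose s x := Num.sqrt (1 + (f x) ^+ 2).
have s0 x : 0 < s x by rewrite sqrtr_gt0 ltr_pwDl ?sqr_ge0.
have s2 x : s x ^+ 2 = 1 + f x ^+ 2 by rewrite sqr_sqrtr// addr_ge0// sqr_ge0.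
have deta i x : 'D_(dir R i) eta x = 2 * psi x * 'D_(dir R i) psi x * (s x - f x) -
    psi x ^+ 2 * ((s x - f x) / s x * 'D_(dir R i) f x).
  rewrite /eta (deriveM_smooth _ _ spH spsi) (deriveM_smooth _ _ spsi sH).
  rewrite (derive_comp1 _ (smooth_differentiable sf x)
    (smooth_differentiable (@smooth_conj_root R) (f x))).
  rewrite derive_conj_root /conj_root -/(s x).
  by move: ((s x - _) / _) => k; rewrite /H /conj_root -/(s x); ring.
have dL i x : 'D_(dir R i) L x = f x / (1 + f x ^+ 2) * 'D_(dir R i) f x.
  by rewrite (derive_comp1 _ (smooth_differentiable sf x)
    (smooth_differentiable (@smooth_half_log R) (f x))) derive_half_log.
have tL : test_fun Omega L.
  apply: (test_comp (@smooth_half_log R) _ tf).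
  by rewrite /half_log expr0n addr0 ln1 mul0r.
pose g i x := psi x * 'D_(dir R i) L x.
have tg i : test_fun Omega (g i) 
  := testMl (test_derive _ tL) spsi.
have Lg i := test_L2 oO bO (tg i).
have gE i : \int[mu2]_(x in Omega) (g i x ^+ 2) = ipO (g i) (g i).
  by rewrite -ip2E; apply: eq_Rintegral => x _; rewrite expr2.
rewrite (gE false) (gE true).
have Wpf := W12B oO bO Wp Wf.
have Lf := test_L2 oO bO tf.
have Lt i := test_L2 oO bO (test_derive (dir R i) tf).
have Lte i := test_L2 oO bO (test_derive (dir R i) teta).
have n0 : 0 <= dO (fun x => p x - f x) (fun x => p x - f x) by exact: dform_ge0.
have n1 : 0 <= ipO (fun x => p x - f x) (fun x => p x - f x) by exact: ip_ge0.
have B2 i x : ('D_(dir R i) psi x) ^+ 2 <= B ^+ 2.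
  rewrite -(real_normK (num_real ('D_(dir R i) psi x))) lerXn2r ?nnegrE//.
  exact: le_trans (normr_ge0 _) (hB i x).
have E1 i : ipO ('D_(dir R i) f) ('D_(dir R i) eta) <=
    4 * B ^+ 2 * m + 4 * B ^+ 2 * ipO (fun x => p x - f x) (fun x => p x - f x) +
     - 4^-1 * ipO (g i) (g i).
  apply: (ip_pointwise_le (Lt i) (Lte i) Wpf.1 (Lg i)).
  move=> x Ox; rewrite deta /g dL.
  apply: (le_trans (log_energy_pointwise _ _ _ (s0 x) (s2 x) (p0 x Ox))).
  rewrite lerD2r -(sqrrN (p x - f x)) opprB.
  by rewrite lerD// ?ler_wpM2r ?sqr_ge0// ler_wpM2l.
have E2 i : ipO ('D_(dir R i) eta) ('D_(dir R i) eta) <=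
    32 * (A * B) ^+ 2 * m + 32 * (A * B) ^+ 2 * ipO f f +
    8 * (A ^+ 2) ^+ 2 * ipO ('D_(dir R i) f) ('D_(dir R i) f).
  apply: (ip_pointwise_le (Lte i) (Lte i) Lf (Lt i)).
  move=> x Ox; rewrite -expr2 deta.
  exact: log_test_pointwise (s0 x) (s2 x) (hA x) (hB i x).
(* The supersolution inequality is split: the pairing with f is classical and yields minus the
   logarithmic energy, the other pairing is an error term. *)
have e1 : 0 <= dO f eta + dO (fun x => p x - f x) eta.
  by rewrite (dformBl oO bO Wp Wf Weta) addrC subrK; exact: sup.
have y := dform_young K Wpf Weta.
have e2 : sob Omega f <= 2 * sob Omega p + 2 * sob Omega (fun x => p x - f x).
  have := sob_leD oO bO Wp (W12Z oO bO (-1) Wpf).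
  rewrite (sobZ oO bO (-1) Wpf) sqrrN expr1n mul1r (_ : (fun x => _) = f)//.
  by apply/funext => x; ring.
have := E1 false; have := E1 true; have := E2 false; have := E2 true.
rewrite (dform_test2 oO bO tf teta) in e1; rewrite (dform_test2 oO bO teta teta) in y.
rewrite {1}/sob (dform_test2 oO bO tf tf) in e2.
move=> f4 f3 f2 f1.
apply: (log_energy_arith _ m0 _ _ _ _ _ _ (erefl K) n0 n1 f1 f2 f3 f4 e1 y e2 hf);
  by [exact: sqr_ge0|exact: sob_ge0|exact: ip_ge0].
Qed.

End supersolutions.

(** X is the squared L^2 norm on the cell, A and B the integrals over the zero set and over its
    complement, and t = z / h^2 the proportion of the zero set. Weighting the square of A + B by 1 +
    1/t and 1 + t leaves (1 + t)(1 - t) X = X - t^2 X on the right, so X is absorbed and t^2 X is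
    bounded. *)
Lemma zero_set_arith (R : realFieldType) (X A B E h2 z h : R) : 0 < h -> h2 = h ^+ 2 ->
  0 < z -> z <= h2 -> 0 <= E ->
  X <= (h^-1 * (A + B)) ^+ 2 + h2 * E -> A ^+ 2 <= h2 -> B ^+ 2 <= (h2 - z) * X ->
  X <= (1 + h2 / z + h2 * E) * (h2 / z) ^+ 2.
Proof.
move=> h0 h2E z0 zh E0 hX hA hB.
have h20 : 0 < h2 by rewrite h2E exprn_gt0.
set t := z / h2; have t0 : 0 < t by rewrite divr_gt0.
have tV : h2 / z = t^-1 by rewrite invf_div.
have ti : 0 < t^-1 by rewrite invr_gt0.
have y : (A + B) ^+ 2 <= (1 + t^-1) * A ^+ 2 + (1 + t) * B ^+ 2.
  rewrite -subr_ge0 (_ : _ - _ = t^-1 * (A - t * B) ^+ 2); last by field; rewrite gt_eqF.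
  by rewrite mulr_ge0 ?sqr_ge0// ltW.
have hB' : h2^-1 * B ^+ 2 <= (1 - t) * X.
  rewrite ler_pdivrMl// mulrA (_ : h2 * (1 - t) = h2 - z)//.
  by rewrite /t; field; rewrite gt_eqF.
have hA' : h2^-1 * A ^+ 2 <= 1 by rewrite ler_pdivrMl// mulr1.
rewrite exprMn exprVn -h2E in hX.
have h2i : 0 <= h2^-1 by rewrite invr_ge0 ltW.
have s1 := ler_wpM2l h2i y.
have s2 := ler_wpM2l (addr_ge0 ler01 (ltW ti)) hA'.
have s3 := ler_wpM2l (addr_ge0 ler01 (ltW t0)) hB'.
have s4 : t ^+ 2 * X <= 1 + t^-1 + h2 * E.
  have e1 : h2^-1 * ((1 + t^-1) * A ^+ 2 + (1 + t) * B ^+ 2) =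
      (1 + t^-1) * (h2^-1 * A ^+ 2) + (1 + t) * (h2^-1 * B ^+ 2) by ring.
  have e2 : (1 + t) * ((1 - t) * X) = X - t ^+ 2 * X by ring.
  move: s1 s2 s3 hX; rewrite e1 e2 mulr1.
  move: ((1 + t^-1) * (h2^-1 * A ^+ 2)) ((1 + t) * (h2^-1 * B ^+ 2)) (h2^-1 * (A + B) ^+ 2) (t ^+ 2 * X) => u1 u2 u3 u4.
  lra.
by rewrite tV -[X](mulKf (x := t ^+ 2)) ?expf_neq0 ?gt_eqF// exprVn mulrC ler_wpM2r// invr_ge0 exprn_ge0// ltW.
Qed.

Lemma gap_le (R : realFieldType) (N f q : R) : f < N -> 2 * N <= q -> N <= q - f.
Proof. by lra. Qed.

(** * The size of a supersolution that vanishes on a set of positive measure *)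

Section dichotomy.
Variables (R : realType) (Omega : set (R * R)).
Hypotheses (oO : open Omega) (bO : bounded_set Omega).
Local Notation P := (measurableTypeR R * measurableTypeR R)%type.
Local Notation mu2 := (@mu2 R).
Local Notation ipO := (ip mu2 (Omega : set P)).
Local Notation dO := (dform Omega).
Let mO : measurable (Omega : set P). Proof. exact: open_measurable2. Qed.

Lemma supersolutionZ c p : 0 <= c -> supersolution Omega p ->
  supersolution Omega (fun x => c * p x).
Proof.
move=> c0 [hp p0 sup]; split=> [|x Ox|eta te e0].
- exact: W012Z.
- by rewrite mulr_ge0// p0.
- have Wp := W012_W12 hp; have We := test_W12 oO bO te.
  by rewrite (dformZl oO bO c Wp We) mulr_ge0// sup.
Qed.

Lemma half_log_mono (s t : R) : 0 <= s -> s <= t -> half_log s <= half_log t.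
Proof.
move=> s0 st; rewrite /half_log ler_pM2r ?invr_gt0// ler_ln ?posrE ?ltr_pwDl ?sqr_ge0//.
by rewrite lerD2l lerXn2r ?nnegrE// (le_trans s0).
Qed.

Section on_cell.
Variables (psi : R * R -> R) (kappa a c h : R).
Hypotheses (tpsi : test_fun Omega psi) (k0 : 0 < kappa) (h0 : 0 < h).
Local Notation Q := (cell a c h).
Hypotheses (QO : Q `<=` Omega) (kpsi : forall x, Q x -> kappa <= psi x).
Let mQ : measurable Q := measurable_cell a c h.

Lemma sqint_on_cell u : L2 Omega u -> sqint mu2 Q u.
Proof.
move=> [mu iu]; split; first exact: measurable_funS mO QO mu.
apply: le_lt_trans iu; apply: ge0_subset_integral => //.
by apply/measurable_EFinP; exact: measurable_funX.
by move=> x _; rewrite lee_fin sqr_ge0.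
Qed.

Lemma ip_cell_le u : L2 Omega u -> ip mu2 Q u u <= ipO u u.
Proof.
move=> Lu; rewrite -lee_fin (ip_EFin mQ (sqint_on_cell Lu)) (ip_EFin mO Lu).
apply: ge0_subset_integral => //; last by move=> x _; rewrite lee_fin sqr_ge0.
by apply/measurable_EFinP; apply: measurable_funX; exact: Lu.1.
Qed.

Lemma ip_cell_mono (u v : R * R -> R) : sqint mu2 Q u -> sqint mu2 Q v ->
  (forall x, Q x -> (u x) ^+ 2 <= (v x) ^+ 2) -> ip mu2 Q u u <= ip mu2 Q v v.
Proof.
move=> hu hv uv; rewrite ip.unlock; apply: le_Rintegral => //.
- exact: sqint_mul.
- exact: sqint_mul.
Qed.

Lemma sqint_mask (Z : set P) u : measurable Z -> sqint mu2 Q u ->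
  sqint mu2 Q (fun x => \1_Z x * u x).
Proof.
move=> mZ [mu iu].
have m1 : measurable_fun Q (\1_Z : P -> R) by exact: measurable_indic.
split; first exact: measurable_funM.
apply: le_lt_trans iu; apply: ge0_le_integral => //.
- by move=> x _; rewrite lee_fin sqr_ge0.
- by apply/measurable_EFinP; apply: measurable_funX; exact: measurable_funM.
- by apply/measurable_EFinP; exact: measurable_funX.
- move=> x _; rewrite lee_fin exprMn indicE.
  by case: (x \in Z); rewrite ?expr1n ?mul1r// expr0n mul0r sqr_ge0.
Qed.

Lemma sqint_cell1 : sqint mu2 Q (fun=> 1 : R).
Proof.
split; first exact: measurable_cst.
by under eq_integral do rewrite expr1n; rewrite integral_cst// mul1e mu2_cell// ltry.
Qed.

Lemma ip_indic (Z : set P) : measurable Z -> Z `<=` Q ->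
  (ip mu2 Q (\1_Z : P -> R) \1_Z)%:E = mu2 Z.
Proof.
move=> mZ ZQ; have := sqint_mask mZ sqint_cell1.
under eq_fun do rewrite mulr1.
move=> s1; rewrite (ip_EFin mQ s1).
rewrite (eq_integral (fun x => (\1_Z x)%:E)); last first.
  by move=> x _; rewrite indicE; case: (x \in Z); rewrite ?expr1n// expr0n.
by rewrite integral_indic// setIidl.
Qed.

(* On a square where p vanishes on a set of positive measure, Poincare turns the
   energy bound into a bound on the logarithm itself, uniform under scaling p. *)
Lemma zero_set_bound (Z : set P) : measurable Z -> Z `<=` Q -> (0 < mu2 Z)%E ->
  exists K, forall q, supersolution Omega q -> (forall x, Z x -> q x = 0) ->
  forall N, 0 <= N -> (((half_log N) ^+ 2)%:E * mu2 (Q `&` [set x | (2 * N <= q x)%R]) <= K%:E)%E.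
Proof.
move=> mZ ZQ Z0; have [C C0 hC] := local_log_energy oO bO tpsi.
set z := fine (mu2 Z).
have muQ : mu2 Q = (h ^+ 2)%:E by exact: mu2_cell.
have zQ : (mu2 Z <= (h ^+ 2)%:E)%E by rewrite -muQ; apply: le_measure; rewrite ?inE.
have zfin : mu2 Z \is a fin_num.
  by rewrite ge0_fin_numE ?measure_ge0// (le_lt_trans zQ)// ltry.
have zE : mu2 Z = z%:E by rewrite fineK.
have z0 : 0 < z by rewrite zE lte_fin in Z0.
have zh : z <= h ^+ 2 by rewrite zE lee_fin in zQ.
have mZc : measurable (Q `\` Z) by exact: measurableD.
have zcE : mu2 (Q `\` Z) = (h ^+ 2 - z)%:E.
  have fQ : (mu2 Q < +oo)%E by rewrite muQ ltry.
  have e : mu2 (Q `\` Z) = (mu2 Q - mu2 (Q `&` Z))%E := measureD mQ mZ fQ.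
  by rewrite e muQ (_ : Q `&` Z = Z) ?zE ?EFinB//; apply/seteqP; split => [x []|x Zx] //; split => //; exact: ZQ.
pose E := C / kappa ^+ 2.
have E0 : 0 <= E by rewrite divr_ge0// sqr_ge0.
(* The first summand comes from [zero_set_arith]; the final 1 pays for the L^2 distance between q
   and its approximant. *)
exists ((1 + h ^+ 2 / z + h ^+ 2 * E) * (h ^+ 2 / z) ^+ 2 + 1) => q sq qZ N N0.
have [hq _ _] := sq; have [d /andP[d0 d1] hd] := hC q sq.
have [_ /(_ d d0)[f tf hf]] := (W012P oO bO q).1 hq.
have Wpf := W12B oO bO (W012_W12 hq) (test_W12 oO bO tf).
have hE := hd f tf hf; move: hf; rewrite /sob => hf.
have n0 := dform_ge0 Omega (fun x => q x - f x).
have err : ipO (fun x => q x - f x) (fun x => q x - f x) <= 1.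
  by apply: le_trans (ltW (lt_le_trans hf d1)); rewrite lerDl.
clear hd n0 hf.
set F := fun y => half_log (f y) in hE.
have tF : test_fun Omega F.
  apply: (test_comp (@smooth_half_log R) _ tf).
  by rewrite /half_log expr0n addr0 ln1 mul0r.
have LF := test_L2 oO bO tF; have sF := sqint_on_cell LF.
have hP := cell_poincare tF a c h0.
have XE : \int[mu2]_(x in Q) (F x ^+ 2) = ip mu2 Q F F.
  by rewrite ip.unlock; apply: eq_Rintegral => x _; rewrite expr2.
have energy i : \int[mu2]_(x in Q) ('D_(dir R i) F x ^+ 2) <=
    (kappa ^+ 2)^-1 * \int[mu2]_(x in Omega) ((psi x * 'D_(dir R i) F x) ^+ 2).
  have Ld := test_L2 oO bO (test_derive (dir R i) tF).
  have Lpd := test_L2 oO bO (testMl (test_derive (dir R i) tF) (test_smooth tpsi)).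
  rewrite ler_pdivlMl ?exprn_gt0//.
  have -> : \int[mu2]_(x in Q) ('D_(dir R i) F x ^+ 2) = ip mu2 Q ('D_(dir R i) F) ('D_(dir R i) F).
    by rewrite ip.unlock; apply: eq_Rintegral => x _; rewrite expr2.
  have -> : \int[mu2]_(x in Omega) ((psi x * 'D_(dir R i) F x) ^+ 2) =
      ipO (fun x => psi x * 'D_(dir R i) F x) (fun x => psi x * 'D_(dir R i) F x).
    by rewrite ip.unlock; apply: eq_Rintegral => x _; rewrite expr2.
  apply: le_trans (ip_cell_le Lpd).
  rewrite -(ipZZ mQ kappa (sqint_on_cell Ld)).
  apply: ip_cell_mono => [||x Qx]; [exact: (sqintZ mQ kappa (sqint_on_cell Ld))|exact: (sqint_on_cell Lpd)|].
  rewrite !exprMn ler_wpM2r ?sqr_ge0// lerXn2r ?nnegrE ?kpsi// ?ltW//.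
  by rewrite (lt_le_trans k0)// kpsi.
have hEQ : \int[mu2]_(x in Q) ('D_(dir R false) F x ^+ 2) +
    \int[mu2]_(x in Q) ('D_(dir R true) F x ^+ 2) <= E.
  apply: (le_trans (lerD (energy false) (energy true))).
  by rewrite -mulrDr /E mulrC ler_pM2r// invr_gt0 exprn_gt0.
have s1 := sqint_cell1.
have sm (D : set P) (mD : measurable D) : sqint mu2 Q (\1_D : P -> R).
  by have := sqint_mask mD s1; under eq_fun do rewrite mulr1.
pose G x := \1_Z x * F x.
have sG : sqint mu2 Q G := sqint_mask mZ sF.
have split1 : \int[mu2]_(x in Q) F x = ip mu2 Q G (fun=> 1) + ip mu2 Q F (\1_(Q `\` Z) : P -> R).
  have j1 := sqint_mul mQ sG s1; have j2 := sqint_mul mQ sF (sm _ mZc).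
  rewrite ip.unlock -(RintegralD mQ j1 j2); apply: eq_Rintegral => x /set_mem Qx.
  rewrite /G mulr1 (mulrC (\1_Z x)) -mulrDr !indicE.
  have [Zx|Zx] := pselect (Z x).
    rewrite (mem_set Zx) memNset ?addr0 ?mulr1//; by case.
  by rewrite (memNset Zx) (mem_set (conj Qx Zx : (Q `\` Z) x)) add0r mulr1.
(* On [Z] the function q vanishes, so [half_log (f x)] is at most |f| = |q - f|, which is small in
   L^2. *)
have A2 : ip mu2 Q G (fun=> 1) ^+ 2 <= h ^+ 2.
  apply: (le_trans (cauchy_schwarz mQ sG s1)).
  have -> : ip mu2 Q (fun=> 1 : R) (fun=> 1) = h ^+ 2.
    apply: EFin_inj; rewrite (ip_EFin mQ s1).
    by under eq_integral do rewrite expr1n; rewrite integral_cst// mul1e.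
  rewrite ler_piMl ?sqr_ge0//; apply: le_trans err.
  apply: le_trans (ip_cell_le Wpf.1).
  apply: ip_cell_mono => [||x Qx]; [exact: sG|exact: sqint_on_cell Wpf.1|].
  rewrite /G exprMn indicE; have [Zx|Zx] := pselect (Z x); last first.
    by rewrite memNset// expr0n mul0r sqr_ge0.
  rewrite mem_set// expr1n mul1r qZ// sub0r sqrrN -(real_normK (num_real (f x))).
  by rewrite lerXn2r ?nnegrE ?half_log_ge0 ?half_log_le.
have B2 : ip mu2 Q F (\1_(Q `\` Z) : P -> R) ^+ 2 <= (h ^+ 2 - z) * ip mu2 Q F F.
  apply: (le_trans (cauchy_schwarz mQ sF (sm _ mZc))); rewrite mulrC.
  rewrite (_ : ip mu2 Q (\1_(Q `\` Z) : P -> R) _ = h ^+ 2 - z)//.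
  by apply: EFin_inj; rewrite ip_indic.
have hX : ip mu2 Q F F <= (1 + h ^+ 2 / z + h ^+ 2 * E) * (h ^+ 2 / z) ^+ 2.
  apply: (zero_set_arith h0 _ z0 zh E0 _ A2 B2) => //.
  rewrite -split1 -XE; apply: (le_trans hP); rewrite lerD2l ler_wpM2l ?sqr_ge0//.
have mS : measurable (Q `&` [set x | 2 * N <= q x]).
  have mq := (measurable_funS mO QO (W012_L2 hq).1).
  have := mq mQ _ (measurable_itv `[2 * N, +oo[).
  congr (measurable (_ `&` _)).
  by apply/seteqP; split => x /=; rewrite in_itv/= andbT.
set S := Q `&` _ in mS *.
rewrite -(ip_indic mS (@subIsetl _ _ _)) -EFinM lee_fin.
rewrite -(ipZZ mQ (half_log N) (sm _ mS)).
apply: (@le_trans _ _ (ip mu2 Q F F + ipO (fun x => q x - f x) (fun x => q x - f x))); last exact: lerD.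
apply: (@le_trans _ _ (ip mu2 Q F F + ip mu2 Q (fun x => q x - f x) (fun x => q x - f x))); last first.
  by rewrite lerD2l; exact: ip_cell_le Wpf.1.
have sW := sqint_on_cell Wpf.1.
have i1 := sqint_mul mQ sF sF; have i2 := sqint_mul mQ sW sW.
have i3 := sqint_mul mQ (sqintZ mQ (half_log N) (sm _ mS)) (sqintZ mQ (half_log N) (sm _ mS)).
rewrite ip.unlock -(RintegralD mQ i1 i2); apply: le_Rintegral => //.
  by have := integrableD mQ i1 i2; exact: eq_integrable.
move=> x Qx; rewrite -!expr2 exprMn indicE.
have [Sx|Sx] := pselect (S x); last first.
  by rewrite memNset// expr0n mulr0 addr_ge0// sqr_ge0.
rewrite mem_set// expr1n mulr1; have [_ /= qN] := Sx.
(* Where q >= 2N, either f >= N and its logarithm is large, or q - f >= N >= [half_log N]. *)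
have [fN|fN] := leP N (f x).
  rewrite (@le_trans _ _ (F x ^+ 2))// ?lerDl ?sqr_ge0//.
  by rewrite lerXn2r ?nnegrE ?half_log_ge0// half_log_mono.
rewrite (@le_trans _ _ ((q x - f x) ^+ 2))// ?lerDr ?sqr_ge0//.
have := half_log_le N; rewrite ger0_norm// => hN.
have hNq := le_trans hN (gap_le fN qN).
by rewrite lerXn2r ?nnegrE ?half_log_ge0// (le_trans (half_log_ge0 N)).
Qed.

End on_cell.
End dichotomy.

(** * Strong maximum principle *)

Section strong_maximum_principle.
Variables (R : realType) (Omega : set (R * R)).
Hypotheses (oO : open Omega) (bO : bounded_set Omega).
Local Notation P := (measurableTypeR R * measurableTypeR R)%type.
Local Notation mu2 := (@mu2 R).
Local Notation ipO := (ip mu2 (Omega : set P)).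
Local Notation dO := (dform Omega).
Let mO : measurable (Omega : set P). Proof. exact: open_measurable2. Qed.

Lemma half_log_unbounded (M : R) : exists2 N, 0 < N & M <= half_log N.
Proof.
exists (expR M); first exact: expR_gt0.
have p1 : 0 < 1 + expR M ^+ 2 by rewrite ltr_pwDl ?sqr_ge0.
rewrite /half_log ler_pdivlMr// -(expRK (M * 2)) ler_ln ?posrE ?expR_gt0 ?p1//.
by rewrite mulrC expRM_natl lerDr.
Qed.

Lemma null_of_bounded_multiples (m : \bar R) (K : R) : (0 <= m)%E ->
  (forall N : R, 0 < N -> ((half_log N ^+ 2)%:E * m <= K%:E)%E) -> m = 0%E.
Proof.
move=> m0 h; apply/eqP; apply: contraT => mn.
have {m0 mn} : (0 < m)%E by rewrite lt0e mn.
case: m h => [r| |] h; last by rewrite ltNge leNye.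
  rewrite lte_fin => r0; have [N N0 hN] := half_log_unbounded (`|K| / r + 1).
  have q0 : 0 <= `|K| / r by rewrite divr_ge0// ltW.
  have h1 : 1 <= half_log N by rewrite (le_trans _ hN)// lerDr.
  have := h N N0; rewrite -EFinM lee_fin -ler_pdivlMr// => hK.
  suff : half_log N + 1 <= half_log N by rewrite gerDl ler10.
  have h2 : half_log N <= half_log N ^+ 2 by rewrite expr2 ler_peMr// (le_trans ler01).
  have h3 : K / r <= `|K| / r by rewrite ler_pM2r ?invr_gt0// ler_norm.
  apply: le_trans hN; rewrite lerD2r; exact: le_trans h2 (le_trans hK h3).
move=> _; have [N N0 hN] := half_log_unbounded 1; have := h N N0.
by rewrite gt0_muley ?leye_eq// lte_fin exprn_gt0//; exact: lt_le_trans hN.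
Qed.

Lemma cell_nbhs (x : R * R) (U : set (R * R)) : nbhs x U ->
  exists a c h, [/\ 0 < h, nbhs x (cell a c h : set (R * R)) & cell a c h `<=` U].
Proof.
move=> /nbhs_ballP[r /= r0 rU]; exists (x.1 - r / 2), (x.2 - r / 2), r; split => //.
- apply/nbhs_ballP; exists (r / 2) => /=; first by rewrite divr_gt0.
  move=> y [/= y1 y2]; rewrite /cell /= !in_itv/=.
  by move: y1 y2; rewrite /ball/= !ltr_norml => /andP[? ?] /andP[? ?]; split; apply/andP; split; lra.
- move=> y; rewrite /cell /= !in_itv/= => -[/andP[? ?] /andP[? ?]]; apply: rU.
  by split; rewrite /ball/= ltr_norml; apply/andP; split; lra.
Qed.

Lemma nbhs_pos (x : R * R) (U : set (R * R)) : nbhs x U ->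
  ~ {ae mu2, forall y, ~ U y}.
Proof.
move=> /cell_nbhs[a [c [h [h0 _ QU]]]] [N [mN N0 hN]].
have QN : cell a c h `<=` N by move=> y /QU Uy; apply: hN => /(_ Uy).
have : (mu2 (cell a c h) <= mu2 N)%E.
  by apply: le_measure => //; rewrite inE//; exact: measurable_cell.
by rewrite N0 mu2_cell// lee_fin leNgt exprn_gt0.
Qed.

(** Suppose p vanishes on a part of positive measure of a small cell. The multiples 2N(n+1) p are
    supersolutions with the same zeros, so [zero_set_bound] holds for all of them with one constant;
    letting N grow, the set where p >= 1/(n+1) has measure 0. *)
Lemma local_dichotomy p x : supersolution Omega p -> Omega x ->
  exists2 U, nbhs x U & {ae mu2, forall y, U y -> p y = 0} \/
                        {ae mu2, forall y, U y -> p y != 0}.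
Proof.
move=> sp Ox; have [hp p0 _] := sp.
have [psi tpsi psix] : exists2 psi, test_fun Omega psi & 0 < psi x.
  have [|e /= e0 eO] := (nbhs_ballP x Omega).1; first exact: oO.
  exists (box_bump 1 (x.1 - e / 2) (x.1 + e / 2) (x.2 - e / 2) (x.2 + e / 2)).
    apply: test_box_bump => // -[y1 y2] /= []; rewrite !in_itv/= => /andP[? ?] /andP[? ?].
    by apply: eO; split; rewrite /ball/= ltr_norml; apply/andP; split; lra.
  by apply: box_bump_gt0 => //; apply/andP; split; lra.
have [a [c [h [h0 nQ QU]]]] : exists a c h, [/\ 0 < h, nbhs x (cell a c h : set (R * R)) &
    cell a c h `<=` Omega `&` [set y | psi x / 2 <= psi y]].
  apply: cell_nbhs; apply: filterI; first exact: oO.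
  have cpsi := smooth_continuous (test_smooth tpsi).
  have /cvgr_ge := cpsi x; apply; lra.
have QO : cell a c h `<=` Omega by move=> y /QU[].
have kpsi y : cell a c h y -> psi x / 2 <= psi y by move=> /QU[].
have k0 : 0 < psi x / 2 by lra.
have mQ := measurable_cell a c h.
have mp : measurable_fun (cell a c h) p := measurable_funS mO QO (W012_L2 hp).1.
pose Z := cell a c h `&` [set y | p y = 0].
have mZ : measurable Z.
  have := mp mQ [set 0] (measurable_set1 _); by congr (measurable (_ `&` _)).
exists (cell a c h); first exact: nQ.
have [Z0|] := eqVneq (mu2 Z) 0%E.
  right; exists Z; split => // y /= hy; apply: contrapT => nZ; apply: hy => Qy.
  by apply/eqP => py; apply: nZ.
move=> Zn; have Z0 : (0 < mu2 Z)%E by rewrite lt0e Zn measure_ge0.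
left.
have [K hK] := zero_set_bound oO bO tpsi k0 h0 QO kpsi mZ (@subIsetl _ _ _) Z0.
have S0 (n : nat) : mu2 (cell a c h `&` [set y | n.+1%:R^-1 <= p y]) = 0%E.
  apply: (@null_of_bounded_multiples _ K) => // N N0.
  have s0 : 0 <= 2 * N * n.+1%:R by rewrite mulr_ge0// mulr_ge0// ltW.
  have := hK _ (supersolutionZ oO bO s0 sp) _ N (ltW N0).
  rewrite (_ : [set y | 2 * N <= 2 * N * n.+1%:R * p y] = [set y | n.+1%:R^-1 <= p y]).
    by apply=> y [_ /= ->]; rewrite mulr0.
  apply/funext => y /=; congr is_true.
  rewrite -[X in X <= _ = _]mulr1 -(mulrA (2 * N)) ler_pM2l ?mulr_gt0//.
  by rewrite -[X in _ = (X <= _)]mulr1 ler_pdivrMl.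
have : {ae mu2, forall y, forall n : nat, cell a c h y -> p y < n.+1%:R^-1}.
  apply/ae_foralln => n; exists (cell a c h `&` [set y | n.+1%:R^-1 <= p y]); split => //.
    have := mp mQ _ (measurable_itv `[n.+1%:R^-1, +oo[); congr (measurable (_ `&` _)).
    by apply/seteqP; split => y /=; rewrite in_itv/= andbT.
  move=> y /= hy; apply: contrapT => nS; apply: hy => Qy.
  by rewrite ltNge; apply/negP => h1; apply: nS.
apply: filterS => y hy Qy; apply/eqP; rewrite eq_le p0 ?andbT; last exact: QO.
rewrite leNgt; apply/negP => py.
have [n] := ltr_add_invr py; rewrite add0r => hn.
by have := hy n Qy; rewrite ltNge (ltW hn).
Qed.

(** The two alternatives of [local_dichotomy] define open sets that cover Omega and are disjoint,
    because a neighbourhood has positive measure. Connectedness leaves only one of them. *)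
Lemma strong_maximum_principle p : connected Omega -> supersolution Omega p ->
  {ae mu2, forall x, Omega x -> p x = 0} \/ {ae mu2, forall x, Omega x -> 0 < p x}.
Proof.
move=> cO sp; have [_ p0 _] := sp.
pose A := [set x : R * R | Omega x /\ exists2 U : set (R * R), nbhs x U & {ae mu2, forall y, U y -> p y = 0}].
pose B := [set x : R * R | Omega x /\ exists2 U : set (R * R), nbhs x U & {ae mu2, forall y, U y -> p y != 0}].
have opn (S : R * R -> Prop) : open [set x : R * R | Omega x /\ exists2 U : set (R * R), nbhs x U & {ae mu2, forall y, U y -> S y}].
  set T := [set x | _].
  suff h (x : R * R) : T x -> nbhs x T by rewrite openE => x; exact: h.
  move=> [Ox [U nU hU]]; have [V [oV Vx] VU] : exists2 V, open_nbhs x V & V `<=` U by rewrite nbhsE in nU.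
  have nOV : nbhs x (Omega `&` V) := open_nbhs_nbhs (conj (openI oO oV) (conj Ox Vx)).
  apply: (filterS _ nOV) => y [Oy Vy].
  split => //; exists V; first exact: open_nbhs_nbhs.
  by apply: filterS hU => z hz /VU.
have disj x : A x -> B x -> False.
  move=> [_ [U nU hU]] [_ [V nV hV]]; apply: (nbhs_pos (filterI nU nV)).
  by apply: filterS2 hU hV => z h1 h2 [Uz Vz]; have := h2 Vz; rewrite h1// eqxx.
have cov x : Omega x -> A x \/ B x.
  move=> Ox; have [U nU [h|h]] := local_dichotomy sp Ox.
    by left; split => //; exists U.
  by right; split => //; exists U.
have [A0|nA] := pselect (A !=set0).
  left; have e : A = Omega.
    apply: cO => //; first by exists A; [exact: opn|rewrite setIidr// => x []].
    exists (~` B); first by apply: open_closedC; exact: opn.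
    apply/seteqP; split => [x Ax|x [Ox nB]]; first by split; [case: Ax|exact: disj].
    by have [] := cov x Ox.
  apply: ae_locally => x Ox; have [_ [U nU hU]] : A x by rewrite e.
  by exists U.
right; have : {ae mu2, forall x, Omega x -> p x != 0}.
  apply: ae_locally => x Ox; have [Ax|[_ [U nU hU]]] := cov x Ox; last by exists U.
  by exfalso; apply: nA; exists x.
by apply: filterS => x h Ox; rewrite lt0r h// p0.
Qed.

End strong_maximum_principle.

(** * Symmetric forms and maximisers of compact quotients *)

Section bilinear_forms.
Variables (R : realType) (T : Type).
Implicit Types (V : (T -> R) -> Prop) (B : (T -> R) -> (T -> R) -> R).

Definition linear_set V := (forall u v, V u -> V v -> V (fun x => u x + v x)) /\
  (forall c u, V u -> V (fun x => c * u x)).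

(** Symmetric bilinear forms on a set of functions, without passing to classes; the Dirichlet, L^2
    and weighted forms, and S D - N, are all instances. *)
Definition bilin V B := [/\ forall u v, V u -> V v -> B u v = B v u,
  forall u v w, V u -> V v -> V w -> B (fun x => u x + v x) w = B u w + B v w &
  forall c u w, V u -> V w -> B (fun x => c * u x) w = c * B u w].

Lemma linear_setB V u v : linear_set V -> V u -> V v -> V (fun x => u x - v x).
Proof.
move=> [VD VZ] hu hv; have := VD _ _ hu (VZ (-1) _ hv).
by under eq_fun do rewrite mulN1r.
Qed.

Lemma bilin_expand V B a c u v : linear_set V -> bilin V B -> V u -> V v ->
  B (fun x => a * u x + c * v x) (fun x => a * u x + c * v x) =
  a ^+ 2 * B u u + 2 * (a * c) * B u v + c ^+ 2 * B v v.
Proof.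
move=> [VD VZ] [Bs BD BZ] hu hv.
have hau := VZ a _ hu; have hcv := VZ c _ hv; have h := VD _ _ hau hcv.
rewrite BD// !BZ// (Bs u)// (Bs v _ hv)// !BD// !BZ// (Bs v u)//; ring.
Qed.

Lemma bilinBB V B u v : linear_set V -> bilin V B -> V u -> V v ->
  B (fun x => u x - v x) (fun x => u x - v x) = B u u - 2 * B u v + B v v.
Proof.
move=> hV hB hu hv; have := bilin_expand 1 (-1) hV hB hu hv.
under eq_fun do rewrite mul1r mulN1r; move=> ->; ring.
Qed.

Lemma form_leB V B u v : linear_set V -> bilin V B -> (forall w, V w -> 0 <= B w w) ->
  V u -> V v -> B (fun x => u x - v x) (fun x => u x - v x) <= 2 * B u u + 2 * B v v.
Proof.
move=> hV hB B0 hu hv; have h := B0 _ (hV.1 _ _ hu hv).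
have := bilin_expand 1 1 hV hB hu hv; under eq_fun do rewrite !mul1r.
by rewrite (bilinBB hV hB hu hv) => e; move: h; rewrite e; lra.
Qed.

(** Perturbing v by t u gives a function affine in t that is nonnegative on the whole line, so its
    slope is 0. Applied to S D - N at a maximiser this is the Euler-Lagrange equation. *)
Lemma form_null V B u v : linear_set V -> bilin V B -> (forall w, V w -> 0 <= B w w) ->
  V u -> V v -> B u u = 0 -> B u v = 0.
Proof.
move=> hV hB B0 hu hv u0.
have h t : 0 <= 2 * t * B u v + B v v.
  have := B0 _ (hV.1 _ _ (hV.2 t _ hu) (hV.2 1 _ hv)).
  by rewrite (bilin_expand t 1 hV hB hu hv) u0 mulr1 mulr0 add0r expr1n mul1r.
apply/eqP; apply: contraT => n.
have := h (- (B v v + 1) / (2 * B u v)).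
rewrite (_ : 2 * _ * _ = - (B v v + 1)); last by field.
by rewrite opprD addrAC addNr add0r oppr_ge0 ler10.
Qed.

Lemma bilin_comb V B N (S : R) : bilin V B -> bilin V N ->
  bilin V (fun u v => S * B u v - N u v).
Proof.
move=> [Bs BD BZ] [Ns ND NZ]; split=> [u v hu hv|u v w hu hv hw|c u w hu hw].
- by rewrite Bs// Ns.
- by rewrite BD// ND//; ring.
- by rewrite BZ// NZ//; ring.
Qed.

End bilinear_forms.

(** Bolzano-Weierstrass in dimension [k], stated with sums of squares for use with finitely many
    functionals. *)
Lemma cluster_point (R : realType) k (x : nat -> 'I_k -> R) M :
  (forall n j, `|x n j| <= M) ->
  exists l : 'I_k -> R, forall t, 0 < t -> forall n0, exists2 n, (n0 <= n)%N &
    \sum_(j < k) (x n j - l j) ^+ 2 <= t.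
Proof.
move=> xM; pose y n : 'rV[R]_k := \row_j x n j.
have cK : compact [set z : 'rV[R]_k | forall i, `[- M, M]%classic (z ord0 i)].
  by apply: (@rV_compact R k (fun=> `[- M, M]%classic)) => i; exact: segment_compact.
have [|z [_ cz]] := cK (y @ \oo) _.
  by exists 0%N => // n _ i; rewrite /= mxE in_itv/= -ler_norml xM.
exists (z ord0) => t t0 n0.
have d0 : 0 < Num.sqrt (t / k.+1%:R) by rewrite sqrtr_gt0 divr_gt0.
have [|w [[n nn0 <-] zn]] := cz [set y n | n in [set n | (n0 <= n)%N]] _ _ (nbhsx_ballx z _ d0).
  by exists n0 => // n /= h; exists n.
exists n => //; apply: (@le_trans _ _ (\sum_(j < k) t / k.+1%:R)).
  apply: ler_sum => j _; rewrite -(sqr_sqrtr (ltW (divr_gt0 t0 (ltr0Sn _ k)))).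
  have /(_ ord0 j) : forall i j, ball ((z : 'rV[R]_k) i j) (Num.sqrt (t / k.+1%:R)) (y n i j) by exact: zn.2.
  rewrite /y mxE /ball/= => /ltW h.
  rewrite -(sqrrN (x n j - _)) opprB -(real_normK (num_real (z ord0 j - _))).
  by rewrite lerXn2r ?nnegrE ?sqrtr_ge0.
rewrite sumr_const card_ord -[X in X <= _]mulr_natr -mulrA ler_piMr ?(ltW t0)//.
by rewrite ler_pdivrMl// mulr1 ler_nat.
Qed.

Section maximiser_arithmetic.
Variable R : realFieldType.

Lemma norm_le_of_sqr (x a : R) : x ^+ 2 <= a -> `|x| <= 1 + a.
Proof.
rewrite -(real_normK (num_real x)); move: `|x| => y h.
by have := sqr_ge0 y; have := sqr_ge0 (y - 1); rewrite sqrrB1; lra.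
Qed.

Lemma sqr_dist_le (a b l : R) : (a - b) ^+ 2 <= 2 * (a - l) ^+ 2 + 2 * (b - l) ^+ 2.
Proof.
rewrite -subr_ge0 (_ : _ - _ = (a + b - 2 * l) ^+ 2) ?sqr_ge0//; ring.
Qed.

Lemma step_arith (S c p D N q1 q2 e t t' : R) : 0 < S -> t' <= t ->
  q1 <= t -> q2 <= t' -> S * D - N <= 2 * q2 + 2 * q1 ->
  N <= S / 2 * D + e -> e <= 2 * t' + 2 * t -> S * c / 16 * p = t -> D <= c * p.
Proof.
move=> S0 h1 h2 h3 h4 h5 h6 h7; rewrite -(ler_pM2l S0); move: h1 h2 h3 h4 h5 h6 h7.
rewrite (_ : S / 2 * D = S * D / 2); last by ring.
rewrite (_ : S * c / 16 * p = S * (c * p) / 16); last by ring.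
move: (S * (c * p)) (S * D) => X Y; lra.
Qed.

Lemma null_arith (S r p q D Q t : R) : Q <= S * D -> S * D <= S * (24 * p) ->
  t <= r * p -> q <= t -> 2 * q + 2 * Q <= 2 * r * p + 48 * S * p.
Proof. by move=> h1 h2 h3 h4; move: h1 h2; rewrite mulrCA -!mulrA; lra. Qed.

Lemma pos_arith (S r p D D' N t : R) : S - t <= N -> N <= S * D ->
  S * D <= S * (2 * D') -> S * D' <= S * (24 * p) -> t <= r * p ->
  S <= r * p + 48 * S * p.
Proof. by rewrite (mulrCA S 2) (mulrCA S 24) -!mulrA; lra. Qed.

End maximiser_arithmetic.

(** * Existence of a maximiser *)

Section maximiser.
Variables (R : realType) (Omega : set (R * R)).
Hypotheses (oO : open Omega) (bO : bounded_set Omega).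
Local Notation P := (measurableTypeR R * measurableTypeR R)%type.
Local Notation mu2 := (@mu2 R).
Local Notation ipO := (ip mu2 (Omega : set P)).
Local Notation dO := (dform Omega).
Let mO : measurable (Omega : set P). Proof. exact: open_measurable2. Qed.

Lemma bilin_dform : bilin (W12 Omega) dO.
Proof.
split=> [u v _ _|u v w hu hv hw|c u w hu hw]; first exact: dformC.
- exact: dformDl.
- exact: dformZl.
Qed.

Lemma bilin_ip : bilin (L2 Omega) ipO.
Proof.
split=> [u v _ _|u v w hu hv hw|c u w hu hw]; first exact: ip2C.
- exact: (ipDl mO hu hv hw).
- exact: (ipZl mO c hu hw).
Qed.

Lemma linear_set_W012 : linear_set (W012 Omega).
Proof. by split=> [u v|c u]; [exact: W012D|exact: W012Z]. Qed.

Lemma bilin_sub (V W : (R * R -> R) -> Prop) B : (forall u, V u -> W u) ->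
  bilin W B -> bilin V B.
Proof.
move=> VW [Bs BD BZ]; split=> [u v hu hv|u v w hu hv hw|c u w hu hw].
- by apply: Bs; exact: VW.
- by apply: BD; exact: VW.
- by apply: BZ; exact: VW.
Qed.

(** Compactness of [N] relative to the Dirichlet form, expressed without a weak topology: up to an
    arbitrarily small multiple of the energy, finitely many functionals control [N]. *)
Definition compact_form (V : (R * R -> R) -> Prop) N := forall eps : R, 0 < eps ->
  exists s : seq (R * R -> R), (forall i, L2 Omega (nth (fun=> 0) s i)) /\
  forall v, V v ->
    N v v <= eps * dO v v + \sum_(i < size s) (ipO (nth (fun=> 0) s i) v) ^+ 2.

Section fixed_form.
Variables (V : (R * R -> R) -> Prop) (N : (R * R -> R) -> (R * R -> R) -> R).
Hypotheses (hV : linear_set V) (VW : forall u, V u -> W012 Omega u).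
Hypothesis Vclosed : forall (u_ : nat -> R * R -> R) u, (forall n, V (u_ n)) ->
  W012 Omega u -> (forall n, sob Omega (fun x => u_ n x - u x) <= 24 * 4^-1 ^+ n) -> V u.
Hypotheses (hN : bilin V N) (N0 : forall u, V u -> 0 <= N u u).
Hypothesis cN : compact_form V N.

Lemma functional_le e u : L2 Omega e -> V u ->
  (ipO e u) ^+ 2 <= ipO e e * (4 * fine (mu2 Omega)) * dO u u.
Proof.
move=> Le Vu; have hu := VW Vu.
apply: (le_trans (cauchy_schwarz mO Le (W012_L2 hu))).
by rewrite -mulrA ler_wpM2l ?ip_ge0// poincare.
Qed.

Lemma compact_form_bounded : exists2 C, 0 <= C & forall u, V u -> N u u <= C * dO u u.
Proof.
have [s [Ls hs]] := cN ltr01.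
set E := nth (fun=> 0) s in Ls hs.
have m0 : 0 <= 4 * fine (mu2 Omega) by rewrite mulr_ge0// fine_ge0.
exists (1 + \sum_(i < size s) ipO (E i) (E i) * (4 * fine (mu2 Omega))).
  by rewrite addr_ge0// sumr_ge0// => i _; rewrite mulr_ge0// ip_ge0.
move=> u Vu; apply: (le_trans (hs u Vu)); rewrite mulrDl lerD2l mulr_suml.
by apply: ler_sum => i _; exact: functional_le.
Qed.

(* S D - N is a nonnegative form, so by the parallelogram identity a maximising
   sequence is Cauchy up to finitely many functionals. *)
Lemma maximiser v0 : V v0 -> 0 < N v0 v0 -> exists v S, [/\ V v, 0 < S, 0 < dO v v,
  N v v = S * dO v v & forall w, V w -> N w w <= S * dO w w].
Proof.
move=> Vv0 Nv0; have [C C0 hC] := compact_form_bounded.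
have VW2 u : V u -> W12 Omega u by move=> /VW/W012_W12.
have bD : bilin V dO := bilin_sub VW2 bilin_dform.
pose A := [set N v v | v in [set v | V v /\ dO v v <= 1]].
have ubA : ubound A C.
  move=> _ [v [Vv d1] <-]; apply: (le_trans (hC v Vv)).
  by rewrite ler_piMr.
have dv0 : 0 < dO v0 v0.
  rewrite lt0r dform_ge0 andbT; apply: contraL Nv0 => /eqP d0.
  by rewrite -leNgt (le_trans (hC v0 Vv0))// d0 mulr0.
have scale w : V w -> 0 < dO w w -> A (N w w / dO w w).
  move=> Vw dw; pose c := Num.sqrt (dO w w)^-1.
  have c2 : c ^+ 2 = (dO w w)^-1 by rewrite sqr_sqrtr// invr_ge0 ltW.
  have sq B : bilin V B -> B (fun x => c * w x) (fun x => c * w x) = c ^+ 2 * B w w.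
    by move=> [Bs _ BZ]; have hcw := hV.2 c _ Vw; rewrite BZ// Bs// BZ// mulrA.
  exists (fun x => c * w x); last by rewrite sq// c2 mulrC.
  by split; [exact: hV.2|rewrite sq// c2 mulVf ?gt_eqF].
have supA : has_sup A by split; [exists (N v0 v0 / dO v0 v0); exact: scale|exists C].
pose S := sup A.
have S0 : 0 < S.
  by apply: lt_le_trans (ub_le_sup (ex_intro _ C ubA) (scale v0 Vv0 dv0)); rewrite divr_gt0.
have hS w : V w -> N w w <= S * dO w w.
  move=> Vw; have [dw|dw] := ltP 0 (dO w w).
    rewrite -ler_pdivrMr//; apply: ub_le_sup; [by exists C|exact: scale].
  have d0 : dO w w = 0 by apply/eqP; rewrite eq_le dw dform_ge0.
  by have := hC w Vw; rewrite d0 !mulr0.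
pose q u v := S * dO u v - N u v.
have bq : bilin V q := bilin_comb S bD hN.
have q0 w : V w -> 0 <= q w w by move=> Vw; rewrite subr_ge0 hS.
have S2 : 0 < S / 2 by rewrite divr_gt0.
(* Compactness is used at level S / 2, so that half of S D is left once N has been absorbed. *)
have [s [Ls hs]] := cN S2; set E := nth (fun=> 0) s in Ls hs.
have [c c0 hc] := W012_complete oO bO.
(* For a difference of consecutive terms, S D / 2 is at most 4t from near-maximality plus 4t from
   the functionals; hence S D <= 16 t, and this [r] gives the increments required by
   [W012_complete]. *)
pose r := S * c / 16; have r0 : 0 < r by rewrite divr_gt0 ?mulr_gt0.
pose t n := r * 8^-1 ^+ n.
have t0 n : 0 < t n by rewrite mulr_gt0 ?exprn_gt0.
have near n : exists v, [/\ V v, dO v v <= 1 & S - n.+1%:R^-1 <= N v v].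
  have e0 : 0 < n.+1%:R^-1 :> R by rewrite invr_gt0.
  have [_ [v [Vv d1] <-] /ltW h] := sup_adherent e0 supA.
  by exists v.
have [w_ hw] := choice near.
pose M := \sum_(i < size s) (1 + ipO (E i) (E i) * (4 * fine (mu2 Omega))).
have m0 : 0 <= 4 * fine (mu2 Omega) by rewrite mulr_ge0// fine_ge0.
have E0 i : 0 <= ipO (E i) (E i) * (4 * fine (mu2 Omega)) by rewrite mulr_ge0// ip_ge0.
have xM n (j : 'I_(size s)) : `|ipO (E j) (w_ n)| <= M.
  have [Vw d1 _] := hw n; have := functional_le (Ls j) Vw => h.
  have h2 : ipO (E j) (w_ n) ^+ 2 <= ipO (E j) (E j) * (4 * fine (mu2 Omega)).
    by apply: (le_trans h); rewrite ler_piMr.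
  apply: (@le_trans _ _ (1 + ipO (E j) (E j) * (4 * fine (mu2 Omega)))).
    exact: norm_le_of_sqr.
  rewrite /M (bigD1 j)//= lerDl sumr_ge0// => i _; exact: addr_ge0.
have [l hl] := cluster_point xM.
(* A subsequence that is nearly maximal and on which all functionals are near one cluster point, at
   the rate [t n]. *)
have sel n : exists v, [/\ V v, S - t n <= N v v, dO v v <= 1 &
    \sum_(j < size s) (ipO (E j) v - l j) ^+ 2 <= t n].
  have [n0 hn0] := ltr_add_invr (t0 n).
  have [k kn0 hk] := hl _ (t0 n) n0.
  have [Vw d1 Nw] := hw k; exists (w_ k); split => //.
  apply: le_trans Nw; rewrite lerD2l lerN2 (le_trans _ (ltW hn0))// add0r.
  by rewrite lef_pV2 ?posrE// ler_nat.
have [u_ hu] := choice sel.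
have qu n : q (u_ n) (u_ n) <= t n.
  have [Vu Nu du _] := hu n; rewrite /q lerBlDr -lerBlDl; apply: le_trans Nu.
  by rewrite lerD2r ler_piMr// ltW.
have td n : t n.+1 <= t n by rewrite /t ler_pM2l// exprS ler_piMl ?exprn_ge0// invf_le1// ler1n.
have step n : dO (fun x => u_ n.+1 x - u_ n x) (fun x => u_ n.+1 x - u_ n x) <= c * 8^-1 ^+ n.
  have [Vu _ _ lu] := hu n; have [Vu1 _ _ lu1] := hu n.+1.
  have Vd := linear_setB hV Vu1 Vu.
  have h1 := form_leB hV bq q0 Vu1 Vu.
  have h2 := hs _ Vd.
  have h3 : \sum_(i < size s) ipO (E i) (fun x => u_ n.+1 x - u_ n x) ^+ 2 <=
      2 * t n.+1 + 2 * t n.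
    apply: (@le_trans _ _ (2 * \sum_(j < size s) (ipO (E j) (u_ n.+1) - l j) ^+ 2 +
      2 * \sum_(j < size s) (ipO (E j) (u_ n) - l j) ^+ 2)); last first.
      by rewrite lerD// ler_pM2l.
    rewrite !mulr_sumr -big_split; apply: ler_sum => i _ /=.
    have -> : ipO (E i) (fun x => u_ n.+1 x - u_ n x) = ipO (E i) (u_ n.+1) - ipO (E i) (u_ n).
      rewrite !(ip2C Omega (E i)).
      exact: (ipBl mO (W012_L2 (VW Vu1)) (W012_L2 (VW Vu)) (Ls i)).
    exact: sqr_dist_le.
  exact: (step_arith S0 (td n) (qu n) (qu n.+1) h1 h2 h3 (erefl : r * 8^-1 ^+ n = t n)).
have [v hv uv] := hc u_ (fun n => VW (let: And4 Vu _ _ _ := hu n in Vu)) step.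
have Vv : V v by apply: (Vclosed _ hv uv) => n; have [] := hu n.
have dv n : dO (fun x => u_ n x - v x) (fun x => u_ n x - v x) <= 24 * 4^-1 ^+ n.
  by apply: le_trans (uv n); rewrite /sob lerDr ip_ge0.
have qle w : V w -> q w w <= S * dO w w by move=> Vw; rewrite /q gerBl N0.
have t4 n : t n <= r * 4^-1 ^+ n.
  by rewrite ler_pM2l// lerXn2r ?nnegrE ?invr_ge0// lef_pV2 ?posrE// ler_nat.
(* Splitting v = u_n - (u_n - v), the form q is small on the first part by near-maximality and on
   the second by convergence in energy. *)
have qv : q v v = 0.
  apply/eqP; rewrite eq_le q0// andbT; apply: (@geometric_le0 _ _ (2 * r + 48 * S)) => n.
  have [Vu _ _ _] := hu n; have Vd := linear_setB hV Vu Vv.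
  have := form_leB hV bq q0 Vu Vd.
  rewrite (_ : (fun x => u_ n x - (u_ n x - v x)) = v); last by apply/funext => x; ring.
  move=> h; apply: (le_trans h); have h1 := qle _ Vd; have h2 := ler_wpM2l (ltW S0) (dv n).
  rewrite [leRHS]mulrDl; exact: null_arith h1 h2 (t4 n) (qu n).
exists v, S; split => //.
(* If D(v) were 0, then D(u_n) would tend to 0, while S - t_n <= N(u_n) <= S D(u_n); this
   contradicts S > 0. *)
- rewrite lt0r dform_ge0 andbT; apply/negP => /eqP d0.
  suff : S <= 0 by rewrite leNgt S0.
  apply: (@geometric_le0 _ _ (r + 48 * S)) => n.
  have [Vu Nu _ _] := hu n; have Vd := linear_setB hV Vu Vv.
  have D0 w : V w -> 0 <= dO w w by move=> _; exact: dform_ge0.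
  have := form_leB hV bD D0 Vd (hV.2 (-1) _ Vv).
  rewrite (_ : (fun x => u_ n x - v x - -1 * v x) = u_ n); last by apply/funext => x; ring.
  rewrite (dformZZ oO bO (-1) (VW2 _ Vv)) d0 !mulr0 addr0 => h.
  have h1 := hS _ Vu; have h2 := ler_wpM2l (ltW S0) h; have h3 := ler_wpM2l (ltW S0) (dv n).
  rewrite [leRHS]mulrDl; exact: pos_arith Nu h1 h2 h3 (t4 n).
- by apply/esym/eqP; rewrite -subr_eq0; apply/eqP; exact: qv.
Qed.

End fixed_form.
End maximiser.

(** * Weights dominated by an exponential *)

Section exponential_estimates.
Variable R : realType.
Implicit Types x y s t U b : R.

Lemma sqr_le_expR y : 0 <= y -> y ^+ 2 <= 4 * expR y.
Proof.
move=> y0; have -> : expR y = expR (y / 2) ^+ 2.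
  by rewrite -expRM_natl; congr expR; field.
have h : y / 2 <= expR (y / 2) by apply: le_trans (expR_ge1Dx _); rewrite lerDr.
have h0 : 0 <= y / 2 by rewrite divr_ge0.
have : (y / 2) ^+ 2 <= expR (y / 2) ^+ 2 by rewrite lerXn2r ?nnegrE ?expR_ge0.
by rewrite expr_div_n; lra.
Qed.

(** Young's inequality for exp(bU/2) and z = t^2 / s, followed by z^2 <= (4 / b^2) exp(bz). In
    [exp_weight] the number s bounds the energy of v, so v / sqrt s lies in the unit ball. *)
Lemma exp_mul_le b U t s : 0 < b -> 0 < s -> 0 <= U ->
  expR (b / 2 * U) * t ^+ 2 <=
  s / 2 * expR (b * U) + s / 2 * (4 / b ^+ 2) * expR (b * ((Num.sqrt s)^-1 * t) ^+ 2).
Proof.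
move=> b0 s0 U0.
have -> : expR (b * U) = expR (b / 2 * U) ^+ 2.
  by rewrite -expRM_natl; congr expR; field.
rewrite exprMn exprVn sqr_sqrtr ?(ltW s0)//.
set z := s^-1 * t ^+ 2; have z0 : 0 <= z by rewrite mulr_ge0 ?sqr_ge0// invr_ge0 ltW.
have tz : t ^+ 2 = s * z by rewrite /z mulrA divff ?mul1r// gt_eqF.
have h := sqr_le_expR (mulr_ge0 (ltW b0) z0).
have hz : z ^+ 2 <= 4 / b ^+ 2 * expR (b * z).
  by rewrite mulrAC ler_pdivlMr ?exprn_gt0// mulrC -exprMn.
rewrite tz; move: (expR (b / 2 * U)) => X; have := sqr_ge0 (X - z).
have s2 : 0 <= s / 2 by rewrite divr_ge0// ltW.
have h2 := ler_wpM2l s2 hz; move=> h3.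
apply: (@le_trans _ _ (s / 2 * X ^+ 2 + s / 2 * z ^+ 2)); last by rewrite lerD2l -[leRHS]mulrA.
rewrite -mulrDr (_ : X * (s * z) = s / 2 * (2 * X * z)); last by field.
by rewrite ler_wpM2l//; move: h3; rewrite sqrrB; lra.
Qed.

(** 1 + x <= e^x bounds the linearised weight by exp(3aU); its square has exponent 6a, which
    explains [6 * a <= b]. For the last bound, e^x - 1 <= x e^x with x = 3aU = (6a/b)(bU/2) extracts
    a factor linear in a. *)
Lemma lin_weight_bounds b a U : 0 < a -> 6 * a <= b -> 0 <= U ->
  [/\ 1 <= expR (a * U), expR (a * U) <= (1 + 2 * a * U) * expR (a * U),
      ((1 + 2 * a * U) * expR (a * U)) ^+ 2 <= expR (b * U) &
      (1 + 2 * a * U) * expR (a * U) <= 1 + 6 * a / b * expR (b * U)].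
Proof.
move=> a0 ab U0; have aU : 0 <= a * U by rewrite mulr_ge0// ltW.
have b0 : 0 < b by move: a0 ab; lra.
have e1 : 1 <= expR (a * U) by rewrite -expR0 ler_expR.
have w3 : (1 + 2 * a * U) * expR (a * U) <= expR (3 * a * U).
  have -> : 3 * a * U = 2 * a * U + a * U by ring.
  by rewrite expRD ler_pM2r ?expR_gt0// expR_ge1Dx.
have q0 : 0 <= 2 * a * U by rewrite -mulrA mulr_ge0.
have p0 : 0 <= (1 + 2 * a * U) * expR (a * U) by rewrite mulr_ge0 ?expR_ge0// addr_ge0.
split => //.
- by rewrite ler_peMl ?expR_ge0// lerDl.
- apply: (@le_trans _ _ (expR (3 * a * U) ^+ 2)); first by rewrite lerXn2r ?nnegrE ?expR_ge0.
  rewrite -expRM_natl ler_expR (_ : 2 * (3 * a * U) = 6 * a * U); last by ring.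
  exact: ler_wpM2r.
- apply: (le_trans w3); rewrite -lerBlDl.
  have h1 : expR (3 * a * U) - 1 <= 3 * a * U * expR (3 * a * U).
    have h : 1 - 3 * a * U <= (expR (3 * a * U))^-1.
      by rewrite -expRN; have := expR_ge1Dx (- (3 * a * U)).
    have := ler_wpM2r (expR_ge0 (3 * a * U)) h.
    by rewrite mulVf ?gt_eqF ?expR_gt0// mulrBl mul1r; lra.
  apply: (le_trans h1).
  have h2 : b / 2 * U <= expR (b / 2 * U).
    by apply: le_trans (expR_ge1Dx _); rewrite lerDr.
  have h3 : expR (3 * a * U) <= expR (b / 2 * U).
    by rewrite ler_expR ler_wpM2r//; move: ab; lra.
  have -> : expR (b * U) = expR (b / 2 * U) * expR (b / 2 * U).
    by rewrite -expRD; congr expR; field.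
  have -> : 3 * a * U = 6 * a / b * (b / 2 * U) by field; rewrite gt_eqF.
  rewrite -mulrA ler_wpM2l ?divr_ge0 ?mulr_ge0 ?(ltW a0) ?(ltW b0)//.
  rewrite (_ : 6 * a / b * (b / 2 * U) = 3 * a * U); last by field; rewrite gt_eqF.
  by rewrite ler_pM ?expR_ge0// mulr_ge0// divr_ge0// ltW.
Qed.

End exponential_estimates.

(** * Weighted forms are bounded and compact relative to the energy *)

Section weights.
Variables (R : realType) (Omega : set (R * R)).
Hypotheses (oO : open Omega) (bO : bounded_set Omega).
Local Notation P := (measurableTypeR R * measurableTypeR R)%type.
Local Notation mu2 := (@mu2 R).
Local Notation ipO := (ip mu2 (Omega : set P)).
Local Notation dO := (dform Omega).
Let mO : measurable (Omega : set P). Proof. exact: open_measurable2. Qed.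

(** The class of all weights below exp(beta u^2): the weight of Lambda_1, that of the linearised
    problem, its square, and their difference all belong to it and share one constant. *)
Definition admissible (beta : R) (u w : R * R -> R) :=
  measurable_fun Omega (w : P -> R) /\
  forall x, Omega x -> 0 <= w x <= expR (beta * u x ^+ 2).

(** Attaching the root of the weight to the function turns weighted forms into plain L^2
    products. *)
Definition root_mul (w v : R * R -> R) x := Num.sqrt (w x) * v x.

Definition wip (w u v : R * R -> R) := \int[mu2]_(x in Omega) (w x * u x * v x).

Lemma root_mul_sqr w v x : 0 <= w x -> root_mul w v x ^+ 2 = w x * v x ^+ 2.
Proof. by move=> w0; rewrite /root_mul exprMn sqr_sqrtr. Qed.

Lemma measurable_root_mul w v : measurable_fun Omega (w : P -> R) ->
  measurable_fun Omega (v : P -> R) -> measurable_fun Omega (root_mul w v : P -> R).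
Proof.
move=> mw mv; apply: measurable_funM => //; apply: measurableT_comp => //.
by apply: continuous_measurable_fun; exact: sqrt_continuous.
Qed.

Lemma measurable_exp c (v : R * R -> R) : measurable_fun Omega (v : P -> R) ->
  measurable_fun Omega (fun x : P => expR (c * v x ^+ 2)).
Proof.
move=> mv; apply: measurableT_comp => //; apply: measurable_funM; first exact: measurable_cst.
exact: measurable_funX.
Qed.

(** Both u and v / sqrt s lie in the unit ball, so [exp_W012] applies to each; [exp_mul_le] then
    bounds the weighted norm of v by a multiple of s. *)
Lemma exp_weight : exists beta C, [/\ 0 < beta, 0 < C & forall u, W012 Omega u ->
  dO u u <= 1 -> forall w, admissible beta u w -> forall v, W012 Omega v ->
  L2 Omega (root_mul w v) /\ ipO (root_mul w v) (root_mul w v) <= C * dO v v].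
Proof.
have [b [K [b0 K0 hK]]] := exp_W012 oO bO.
pose C := (1 + 4 / b ^+ 2) * K / 2.
have C0 : 0 <= C by rewrite divr_ge0// mulr_ge0// addr_ge0// divr_ge0// sqr_ge0.
exists (b / 2), (C + 1); split; [by rewrite divr_gt0|by rewrite ltr_wpDl|].
move=> u hu u1 w [mw hw] v hv; have [mu _] := W012_L2 hu; have [mv _] := W012_L2 hv.
have mr := measurable_root_mul mw mv.
(* A positive s above D(v) is used instead of D(v), which may be 0; s is sent to D(v) at the end. *)
have bound s : 0 < s -> dO v v <= s ->
    (\int[mu2]_(x in Omega) ((root_mul w v x) ^+ 2)%:E <= (s * C)%:E)%E.
  move=> s0 vs; pose v' x := (Num.sqrt s)^-1 * v x.
  have hv' : W012 Omega v' by exact: W012Z.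
  have v1 : dO v' v' <= 1.
    rewrite (dformZZ oO bO _ (W012_W12 hv)) exprVn sqr_sqrtr ?(ltW s0)//.
    by rewrite ler_pdivrMl// mulr1.
  have [mv' _] := W012_L2 hv'.
  have s2 : 0 <= s / 2 by rewrite divr_ge0// ltW.
  have s3 : 0 <= s / 2 * (4 / b ^+ 2) by rewrite mulr_ge0// divr_ge0// sqr_ge0.
  have mE c (f : R * R -> R) : measurable_fun Omega (f : P -> R) ->
      measurable_fun Omega (fun x : P => (expR (c * f x ^+ 2))%:E).
    by move=> mf; apply/measurable_EFinP; exact: measurable_exp.
  have E0 c (f : R * R -> R) x : (0 <= (expR (c * f x ^+ 2))%:E)%E by rewrite lee_fin expR_ge0.
  have mZ k c (f : R * R -> R) : measurable_fun Omega (f : P -> R) ->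
      measurable_fun Omega (fun x : P => (k%:E * (expR (c * f x ^+ 2))%:E)%E).
    by move=> mf; apply: emeasurable_funM; [exact: measurable_cst|exact: mE].
  apply: (@le_trans _ _ (\int[mu2]_(x in Omega) ((s / 2)%:E * (expR (b * u x ^+ 2))%:E +
      (s / 2 * (4 / b ^+ 2))%:E * (expR (b * v' x ^+ 2))%:E))%E).
    apply: ge0_le_integral => //.
    - by move=> x _; rewrite lee_fin sqr_ge0.
    - by apply/measurable_EFinP; exact: measurable_funX.
    - by apply: emeasurable_funD; exact: mZ.
    - move=> x Ox; have /andP[w0 wE] := hw x Ox.
      rewrite -!EFinM -EFinD lee_fin (root_mul_sqr _ w0).
      apply: le_trans (exp_mul_le (v x) b0 s0 (sqr_ge0 (u x))).
      by rewrite ler_wpM2r// sqr_ge0.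
  rewrite ge0_integralD//; last 4 first.
  - by move=> x _; rewrite mule_ge0// lee_fin.
  - exact: mZ.
  - by move=> x _; rewrite mule_ge0// lee_fin.
  - exact: mZ.
  rewrite !ge0_integralZl_EFin//; [|exact: mE|exact: mE].
  have -> : (s * C)%:E = ((s / 2)%:E * K%:E + (s / 2 * (4 / b ^+ 2))%:E * K%:E)%E.
    by rewrite -!EFinM -EFinD; congr EFin; rewrite /C; ring.
  by apply: leeD; apply: lee_wpmul2l; rewrite ?lee_fin//; exact: hK.
have Lr : L2 Omega (root_mul w v).
  split => //; have := bound (dO v v + 1) _ _.
  rewrite ltr_wpDl ?dform_ge0// lerDl ler01 => /(_ isT isT) h.
  by apply: (le_lt_trans h); rewrite ltry.
split=> //; apply/ler_addgt0Pr => e e0.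
have C1 : 0 < C + 1 by rewrite ltr_wpDl.
have d0 := dform_ge0 Omega v.
have s0 : 0 < dO v v + e / (C + 1) by rewrite ltr_wpDl// divr_gt0.
have := bound _ s0 _; rewrite -(ip_EFin mO Lr) lee_fin lerDl divr_ge0 ?(ltW e0) ?(ltW C1)//.
move=> /(_ isT) h; apply: (le_trans h); rewrite mulrDl mulrC lerD//.
  by rewrite ler_wpM2r// lerDl.
by rewrite mulrAC ler_pdivrMr// ler_pM2l// lerDl.
Qed.

Section fixed_density.
Variables (beta C : R) (u : R * R -> R).
Hypotheses (C0 : 0 < C).
Hypothesis hC : forall w, admissible beta u w -> forall v, W012 Omega v ->
  L2 Omega (root_mul w v) /\ ipO (root_mul w v) (root_mul w v) <= C * dO v v.

Lemma wipE w f g : admissible beta u w -> wip w f g = ipO (root_mul w f) (root_mul w g).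
Proof.
move=> [_ hw]; rewrite -ip2E; apply: eq_Rintegral => x /set_mem Ox.
have /andP[w0 _] := hw x Ox.
by rewrite /root_mul mulrACA -expr2 sqr_sqrtr// mulrA.
Qed.

Lemma bilin_wip w : admissible beta u w -> bilin (W012 Omega) (wip w).
Proof.
move=> aw; split=> [f g hf hg|f g h hf hg hh|c f h hf hh]; rewrite !wipE//.
- exact: ip2C.
- rewrite -(ipDl mO (hC aw hf).1 (hC aw hg).1 (hC aw hh).1).
  by congr (ipO _ _); apply/funext => x; rewrite /root_mul mulrDr.
- rewrite -(ipZl mO c (hC aw hf).1 (hC aw hh).1).
  by congr (ipO _ _); apply/funext => x; rewrite /root_mul mulrCA.
Qed.

Lemma wip_ge0 w v : admissible beta u w -> 0 <= wip w v v.
Proof. by move=> aw; rewrite wipE// ip_ge0. Qed.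

Lemma wip_le w v : admissible beta u w -> W012 Omega v -> wip w v v <= C * dO v v.
Proof. by move=> aw hv; rewrite wipE//; exact: (hC aw hv).2. Qed.

Lemma wip_EFin w v : admissible beta u w -> W012 Omega v ->
  (wip w v v)%:E = (\int[mu2]_(x in Omega) (w x * v x ^+ 2)%:E)%E.
Proof.
move=> aw hv; rewrite wipE// (ip_EFin mO (hC aw hv).1).
apply: eq_integral => x /set_mem Ox; have /andP[w0 _] := aw.2 x Ox.
by rewrite root_mul_sqr.
Qed.

Lemma wip_integrable w v : admissible beta u w -> W012 Omega v ->
  mu2.-integrable (Omega : set P) (EFin \o (fun x => w x * v x ^+ 2)).
Proof.
move=> aw hv; have L := (hC aw hv).1.
have := sqint_mul mO L L; apply: eq_integrable => // x /set_mem Ox.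
by have /andP[w0 _] := aw.2 x Ox; rewrite /= -expr2 root_mul_sqr.
Qed.

Lemma wip_comb w w' v c d : admissible beta u w -> admissible beta u w' ->
  W012 Omega v -> (forall x, Omega x -> w x <= c + d * w' x) ->
  wip w v v <= c * ipO v v + d * wip w' v v.
Proof.
move=> aw aw' hv h; rewrite !wipE//.
have L := (hC aw hv).1; have L' := (hC aw' hv).1; have Lv := W012_L2 hv.
have := ip_pointwise_le oO bO (C0 := 0) (C1 := c) (C2 := d) L L Lv L'.
rewrite mul0r add0r; apply=> x Ox.
have /andP[w0 _] := aw.2 x Ox; have /andP[w0' _] := aw'.2 x Ox.
rewrite -expr2 !root_mul_sqr//.
rewrite (_ : 0 + c * v x ^+ 2 + d * (w' x * v x ^+ 2) = (c + d * w' x) * v x ^+ 2); last by ring.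
by rewrite ler_wpM2r ?sqr_ge0// h.
Qed.

Lemma ip_le_wip w v : admissible beta u w -> W012 Omega v ->
  (forall x, Omega x -> 1 <= w x) -> ipO v v <= wip w v v.
Proof.
move=> aw hv h; rewrite wipE//.
have L := (hC aw hv).1; have Lv := W012_L2 hv.
have := ip_pointwise_le oO bO (C0 := 0) (C1 := 0) (C2 := 1) Lv Lv Lv L.
rewrite !mul0r !add0r mul1r; apply=> x Ox.
rewrite -expr2 !mul0r !add0r mul1r root_mul_sqr ?(le_trans ler01 (h x Ox))//.
by rewrite ler_peMl ?sqr_ge0// h.
Qed.

Lemma wip_eq0 w v : admissible beta u w -> W012 Omega v -> wip w v v = 0 ->
  {ae mu2, forall x, Omega x -> w x * v x ^+ 2 = 0}.
Proof.
move=> aw hv; rewrite wipE// => /(ip_eq0 mO (hC aw hv).1).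
apply: filterS => x h Ox; have /andP[w0 _] := aw.2 x Ox.
by rewrite -root_mul_sqr// h// expr0n.
Qed.

(** From w <= M + w^2 / M with M = 2C / e: the form with weight w^2 is bounded by C D, so its share
    is e / 2 times the energy, and M times the L^2 form is handled by [finite_rank]. *)
Lemma compact_wip w : admissible beta u w -> admissible beta u (fun x => w x ^+ 2) ->
  compact_form Omega (W012 Omega) (wip w).
Proof.
move=> aw aw2 e e0; pose M := 2 * C / e.
have M0 : 0 < M by rewrite divr_gt0// mulr_gt0.
have [|s [Ls hs]] := finite_rank oO bO (eps := e / (2 * M)); first by rewrite divr_gt0// mulr_gt0.
set E := nth (fun=> 0) s in Ls hs.
exists [seq (fun x => Num.sqrt M * f x) | f <- s].
have En i : nth (fun=> 0) [seq (fun x => Num.sqrt M * f x) | f <- s] i = (fun x => Num.sqrt M * E i x).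
  have [si|si] := ltnP i (size s); first by rewrite (nth_map (fun=> 0))//.
  by rewrite nth_default ?size_map// /E nth_default//; apply/funext => x; rewrite mulr0.
split=> [i|v hv]; first by rewrite En; exact: (sqintZ mO _ (Ls i)).
rewrite size_map.
have -> : \sum_(i < size s) ipO (nth (fun=> 0) [seq (fun x => Num.sqrt M * f x) | f <- s] i) v ^+ 2 =
    M * \sum_(i < size s) (ipO (E i) v) ^+ 2.
  rewrite mulr_sumr; apply: eq_bigr => i _.
  by rewrite En (ipZl mO _ (Ls i) (W012_L2 hv)) exprMn sqr_sqrtr// ltW.
have h1 : wip w v v <= M * ipO v v + M^-1 * wip (fun x => w x ^+ 2) v v.
  apply: wip_comb => // x Ox; rewrite -subr_ge0.
  rewrite (_ : _ - _ = M^-1 * ((w x - M / 2) ^+ 2 + 3 / 4 * M ^+ 2)).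
    by rewrite mulr_ge0 ?invr_ge0 ?(ltW M0)// addr_ge0 ?sqr_ge0// mulr_ge0 ?sqr_ge0.
  by field; rewrite gt_eqF.
have h2 := ler_wpM2l (ltW M0) (hs v hv).
have h3 : M^-1 * wip (fun x => w x ^+ 2) v v <= e / 2 * dO v v.
  have -> : e / 2 = M^-1 * C by rewrite /M; field; rewrite !gt_eqF.
  by rewrite -mulrA ler_pM2l ?invr_gt0// wip_le.
apply: (le_trans h1); apply: (le_trans (lerD h2 h3)).
rewrite le_eqVlt; apply/orP; left; apply/eqP; rewrite mulrDr.
by move: (\sum_(i < _) _) => X; field; rewrite gt_eqF.
Qed.

End fixed_density.
End weights.

(** * Sign of the first Dirichlet eigenfunctions *)

Section absolute_value.
Variables (R : realType) (Omega : set (R * R)).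
Hypotheses (oO : open Omega) (bO : bounded_set Omega).
Local Notation P := (measurableTypeR R * measurableTypeR R)%type.
Local Notation mu2 := (@mu2 R).
Local Notation ipO := (ip mu2 (Omega : set P)).
Local Notation dO := (dform Omega).
Let mO : measurable (Omega : set P). Proof. exact: open_measurable2. Qed.

Definition smooth_abs (e t : R) := Num.sqrt (e ^+ 2 + t ^+ 2) - e.

Section smooth_abs.
Variable e : R.
Hypothesis e0 : 0 < e.
Let pos t : 0 < e ^+ 2 + t ^+ 2. Proof. by rewrite ltr_wpDr ?sqr_ge0// exprn_gt0. Qed.

Lemma smooth_smooth_abs : smooth (smooth_abs e).
Proof.
apply: smoothB; last exact: smooth_cst.
apply: smooth_sqrt => //; apply: smoothD; first exact: smooth_cst.
by apply: smoothX; exact: smooth_id.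
Qed.

Lemma derive_smooth_abs_le t : ('D_1 (smooth_abs e) t) ^+ 2 <= 1.
Proof.
have d1 : is_derive t (1 : R) (fun t : R => e ^+ 2 + t ^+ 2) (2 * t).
  by apply: is_derive_eq; rewrite add0r /GRing.scale /=; ring.
have d2 := is_derive1_sqrt (pos t).
have d3 := @is_derive1_comp _ (@Num.sqrt R) (fun t : R => e ^+ 2 + t ^+ 2) _ _ _ d2 d1.
have d4 := is_deriveB d3 (is_derive_cst e t (1 : R)).
have [_ eq] := d4.
have -> : 'D_1 (smooth_abs e) t = (2 * Num.sqrt (e ^+ 2 + t ^+ 2))^-1 * (2 * t) - 0 by exact: eq.
rewrite subr0 exprMn exprVn !exprMn sqr_sqrtr ?(ltW (pos t))//.
by rewrite ler_pdivrMl ?mulr_gt0// mulr1 ler_pM2l// lerDr sqr_ge0.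
Qed.

Lemma smooth_abs_bounds t : [/\ 0 <= smooth_abs e t, smooth_abs e t <= `|t|,
  `|t| - e <= smooth_abs e t & t ^+ 2 = smooth_abs e t ^+ 2 + 2 * e * smooth_abs e t].
Proof.
have s0 : 0 <= Num.sqrt (e ^+ 2 + t ^+ 2) by exact: sqrtr_ge0.
have s2 := sqr_sqrtr (ltW (pos t)); have t2 := real_normK (num_real t).
have t0 := normr_ge0 t; rewrite /smooth_abs; split; last by move: s2; rewrite sqrrB; lra.
- by rewrite subr_ge0 -[leLHS]ger0_norm ?(ltW e0)// -sqrtr_sqr ler_sqrt ?(ltW (pos t))// lerDl sqr_ge0.
- rewrite lerBlDr -[leRHS]ger0_norm ?addr_ge0 ?(ltW e0)// -sqrtr_sqr ler_sqrt ?sqr_ge0//.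
  by rewrite sqrrD t2; have := mulr_ge0 t0 (ltW e0); lra.
- rewrite lerD2r -sqrtr_sqr ler_sqrt ?(ltW (pos t))//.
  by rewrite lerDr sqr_ge0.
Qed.

End smooth_abs.

Lemma abs_loss_arith (e g F : R) : 0 <= e -> 2 * g <= 1 + F ->
  F = g ^+ 2 + 2 * e * g -> F <= e + g ^+ 2 + e * F.
Proof.
move=> e0 h E; have := ler_wpM2l e0 h; rewrite mulrDr mulr1 => h'.
rewrite [leLHS]E; move: h'; rewrite mulrCA -mulrA; lra.
Qed.

(** [smooth_abs e] has slope at most 1, so it does not increase the energy, and differs from the
    absolute value by at most e; e is taken small compared with r, the measure of Omega and the norm
    of f. *)
Lemma test_abs f r : test_fun Omega f -> 0 < r -> exists g, [/\ test_fun Omega g,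
  dO g g <= dO f f, ipO (fun x => g x - `|f x|) (fun x => g x - `|f x|) <= r &
  ipO f f <= ipO g g + r].
Proof.
move=> tf r0; set m := fine (mu2 Omega); have m0 : 0 <= m by exact: fine_ge0.
set k := ipO f f; have k0 : 0 <= k by exact: ip_ge0.
pose e := r / (r + m + k + 1).
have r0' := ltW r0.
have d0 : 0 < r + m + k + 1 by rewrite ltr_wpDl// !addr_ge0.
have e0 : 0 < e by rewrite divr_gt0.
have e1 : e <= 1 by rewrite ler_pdivrMr// mul1r -!addrA lerDl !addr_ge0.
have er : e * (m + k) <= r.
  by rewrite mulrAC ler_pdivrMr// ler_pM2l// -!addrA [leRHS]addrC -!addrA lerD2l lerDl addr_ge0.
pose g x := smooth_abs e (f x).
have Lf := test_L2 oO bO tf.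
have tg : test_fun Omega g.
  apply: (test_comp (smooth_smooth_abs e0) _ tf).
  by rewrite /smooth_abs expr0n addr0 sqrtr_sqr ger0_norm ?subrr// ltW.
have Lg := test_L2 oO bO tg.
have b x := smooth_abs_bounds e0 (f x).
have La : L2 Omega (fun x => `|f x|).
  have [mf fi] := Lf; split; first by apply: measurableT_comp.
  by under eq_integral do rewrite real_normK ?num_real//.
have Ld := L2B oO Lg La.
exists g; split => //.
- have Lt i := test_L2 oO bO (test_derive (dir R i) tf).
  have Ltg i := test_L2 oO bO (test_derive (dir R i) tg).
  rewrite (dform_test2 oO bO tf tf) (dform_test2 oO bO tg tg).
  have h i : ipO ('D_(dir R i) g) ('D_(dir R i) g) <= ipO ('D_(dir R i) f) ('D_(dir R i) f).
    have := ip_pointwise_le oO bO (C0 := 0) (C1 := 1) (C2 := 0) (Ltg i) (Ltg i) (Lt i) (Lt i).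
    rewrite !mul0r add0r addr0 mul1r; apply=> x Ox.
    rewrite mul0r add0r addr0 mul1r -expr2.
    rewrite (derive_comp1 _ (smooth_differentiable (test_smooth tf) x)
      (smooth_differentiable (smooth_smooth_abs e0) (f x))) exprMn.
    by rewrite ler_piMl ?sqr_ge0// derive_smooth_abs_le.
  exact: lerD.
- have := ip_pointwise_le oO bO (C0 := e ^+ 2) (C1 := 0) (C2 := 0) Ld Ld Lf Lf.
  rewrite !mul0r !addr0 => h.
  have : e ^+ 2 * m <= r.
    apply: le_trans er; rewrite expr2 -mulrA ler_pM2l//.
    by rewrite (le_trans (_ : _ <= m))// ?ler_piMl// lerDl.
  apply: le_trans; apply: h => x Ox; rewrite !mul0r !addr0 -expr2.
  have [_ b1 b2 _] := b x; rewrite -(sqrrN (g x - _)) opprB lerXn2r ?nnegrE ?(ltW e0)//.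
    by rewrite subr_ge0.
  by rewrite lerBlDl -lerBlDr.
- have := ip_pointwise_le oO bO (C0 := e) (C1 := 1) (C2 := e) Lf Lf Lg Lf.
  rewrite mul1r -/m -/k => h.
  have h' : k <= e * m + ipO g g + e * k.
    apply: h => x Ox; have [b0 b1 _ b3] := b x; rewrite -expr2 mul1r.
    have e2 : 2 * g x <= 1 + f x ^+ 2.
      have := sqr_ge0 (`|f x| - 1); rewrite sqrrB1 real_normK ?num_real//; move: b1; rewrite -/(g x); lra.
    exact: abs_loss_arith (ltW e0) e2 b3.
  move: h' er; rewrite mulrDr; lra.
Qed.

Lemma abs_diff_sqr (a b : R) : (`|a| - `|b|) ^+ 2 <= (a - b) ^+ 2.
Proof.
rewrite -(real_normK (num_real (a - b))) -(real_normK (num_real (`|a| - `|b|))).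
by rewrite lerXn2r ?nnegrE// ler_dist_dist.
Qed.

Lemma abs_step_arith (S r r' c p D q1 q2 i1 i2 X Y : R) : 0 < S -> r' <= r ->
  q1 <= (2 * S + 1) * r -> q2 <= (2 * S + 1) * r' -> i1 <= 4 * r -> i2 <= 4 * r' ->
  X = S * D - Y -> X <= 2 * q2 + 2 * q1 -> Y <= 2 * i2 + 2 * i1 ->
  r = S * c / (8 * S + 20) * p -> D <= c * p.
Proof.
move=> S0 h1 h2 h3 h4 h5 h6 h7 h8 h9; rewrite -(ler_pM2l S0).
have d0 : 0 < 8 * S + 20 by rewrite addr_gt0// mulr_gt0.
have -> : S * (c * p) = (8 * S + 20) * r by rewrite h9; field; rewrite gt_eqF.
have h3' : q2 <= (2 * S + 1) * r.
  by apply: (le_trans h3); rewrite ler_wpM2l// addr_ge0// mulr_ge0// ltW.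
rewrite (_ : (8 * S + 20) * r = 4 * ((2 * S + 1) * r) + 16 * r); last by ring.
move: h1 h2 h3' h4 h5 h6 h7 h8; move: (S * D) ((2 * S + 1) * r) => Z W; lra.
Qed.

Lemma abs_limit_arith (S r p k t qg Q D : R) : Q <= S * D -> S * D <= S * (24 * p) ->
  k * t <= k * (r * p) -> qg <= k * t -> 2 * qg + 2 * Q <= (2 * (k * r) + 48 * S) * p.
Proof.
rewrite (_ : (2 * (k * r) + 48 * S) * p = 2 * (k * (r * p)) + 48 * (S * p)); last by ring.
rewrite (mulrCA S 24); move: (S * D) (S * p) (k * t) (k * (r * p)) => X Y Z W; lra.
Qed.

Variables (phi : R * R -> R) (S : R).
Hypotheses (S0 : 0 < S) (hS : forall w, W012 Omega w -> ipO w w <= S * dO w w).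

Let q u v := S * dO u v - ipO u v.

Let bq : bilin (W012 Omega) q.
Proof.
apply: bilin_comb.
  by apply: bilin_sub (bilin_dform oO bO); exact: W012_W12.
by apply: bilin_sub (bilin_ip oO); exact: W012_L2.
Qed.

Let q0 w : W012 Omega w -> 0 <= q w w.
Proof. by move=> hw; rewrite subr_ge0 hS. Qed.

Let sV : linear_set (W012 Omega) := linear_set_W012 oO bO.

Lemma first_eigenfunction u v : W012 Omega u -> W012 Omega v ->
  ipO u u = S * dO u u -> ipO u v = S * dO u v.
Proof.
move=> hu hv e; have := form_null sV bq q0 hu hv; rewrite /q e subrr => /(_ erefl)/eqP.
by rewrite subr_eq0 => /eqP.
Qed.

(* Since D(smooth_abs e f) <= D(f), regularised absolute values of approximants
   of phi form a minimising sequence, hence a Cauchy one. *)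
Lemma abs_minimiser : W012 Omega phi -> ipO phi phi = S * dO phi phi ->
  W012 Omega (fun x => `|phi x|) /\
  ipO (fun x => `|phi x|) (fun x => `|phi x|) = S * dO (fun x => `|phi x|) (fun x => `|phi x|).
Proof.
move=> hp ep; have Lp := W012_L2 hp; set a := fun x => `|phi x|.
have La : L2 Omega a.
  have [mf fi] := Lp; split; first by apply: measurableT_comp.
  by under eq_integral do rewrite real_normK ?num_real//.
have [c c0 hc] := W012_complete oO bO.
(* For consecutive differences S D is the q-part, at most 4(2S + 1) t, plus the L^2 part, at most 16
   t; the sum is (8S + 20) t. *)
pose r := S * c / (8 * S + 20).
have r0 : 0 < r by rewrite divr_gt0 ?mulr_gt0// addr_gt0// mulr_gt0.
pose t n := r * 8^-1 ^+ n.
have t0 n : 0 < t n by rewrite mulr_gt0 ?exprn_gt0.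
have td n : t n.+1 <= t n by rewrite /t ler_pM2l// exprS ler_piMl ?exprn_ge0// invf_le1// ler1n.
have t4 n : t n <= r * 4^-1 ^+ n.
  by rewrite ler_pM2l// lerXn2r ?nnegrE ?invr_ge0// lef_pV2 ?posrE// ler_nat.
have qle w : W012 Omega w -> q w w <= S * dO w w.
  by move=> hw; rewrite /q gerBl ip_ge0.
have qp : q phi phi = 0 by rewrite /q ep subrr.
(* As q vanishes at phi, an approximant f has q(f) <= 2 S t; replacing f by its regularised absolute
   value costs another t. *)
have sel n : exists g, [/\ W012 Omega g, q g g <= (2 * S + 1) * t n &
    ipO (fun x => g x - a x) (fun x => g x - a x) <= 4 * t n].
  have [_ /(_ _ (t0 n))[f tf hf]] := (W012P oO bO phi).1 hp.
  have [g [tg dg ig fg]] := test_abs tf (t0 n).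
  have hfW := test_W012 oO bO tf; have Lf := test_L2 oO bO tf; have Lg := test_L2 oO bO tg.
  have hd := linear_setB sV hp hfW.
  have := form_leB sV bq q0 hp hd.
  rewrite (_ : (fun x => phi x - (phi x - f x)) = f); last by apply/funext => x; ring.
  rewrite qp mulr0 add0r => h1.
  have dd : dO (fun x => phi x - f x) (fun x => phi x - f x) <= t n.
    by apply: le_trans (ltW hf); rewrite /sob lerDr ip_ge0.
  have dd2 : ipO (fun x => phi x - f x) (fun x => phi x - f x) <= t n.
    by apply: le_trans (ltW hf); rewrite /sob lerDl dform_ge0.
  exists g; split; first exact: test_W012.
    have h2 := qle _ hd; have h3 := ler_wpM2l (ltW S0) dd; have h4 := ler_wpM2l (ltW S0) dg.
    rewrite /q in h1 h2 *; rewrite mulrDl mul1r -mulrA; move: h1 h2 h3 h4 fg.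
    move: (_ * dform _ _ _ - _) (S * t n) (S * dO f f) (S * dO g g) => X Y Z W; lra.
  have Laf : L2 Omega (fun x => `|f x|).
    have [mf fi] := Lf; split; first by apply: measurableT_comp.
    by under eq_integral do rewrite real_normK ?num_real//.
  have L1 := L2B oO Lg Laf; have L2' := L2B oO Laf La.
  have := ip_leD oO L1 L2'.
  rewrite (_ : (fun x => g x - `|f x| + (`|f x| - a x)) = (fun x => g x - a x)); last first.
    by apply/funext => x; rewrite addrA subrK.
  have Lpf := L2B oO Lp Lf.
  have := ip_pointwise_le oO bO (C0 := 0) (C1 := 1) (C2 := 0) L2' L2' Lpf Lpf.
  rewrite !mul0r add0r addr0 mul1r => h5.
  have h6 : ipO (fun x => `|f x| - a x) (fun x => `|f x| - a x) <= t n.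
    apply: le_trans dd2; apply: h5 => x Ox; rewrite mul0r add0r addr0 mul1r -expr2.
    by rewrite -(sqrrN (phi x - f x)) opprB abs_diff_sqr.
  by move: ig h6; lra.
have [g_ hg] := choice sel.
have ipe : bilin (L2 Omega) ipO := bilin_ip oO.
have sL : linear_set (L2 Omega) by split=> [u v|k u]; [exact: (sqintD mO)|exact: (sqintZ mO)].
have ip0 w : L2 Omega w -> 0 <= ipO w w by move=> _; exact: ip_ge0.
have step n : dO (fun x => g_ n.+1 x - g_ n x) (fun x => g_ n.+1 x - g_ n x) <= c * 8^-1 ^+ n.
  have [hu qu iu] := hg n; have [hu1 qu1 iu1] := hg n.+1.
  have h1 := form_leB sV bq q0 hu1 hu.
  have L1 := L2B oO (W012_L2 hu1) La; have L2' := L2B oO (W012_L2 hu) La.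
  have := form_leB sL ipe ip0 L1 L2'.
  rewrite (_ : (fun x => g_ n.+1 x - a x - (g_ n x - a x)) = (fun x => g_ n.+1 x - g_ n x)); last first.
    by apply/funext => x; ring.
  by move=> h2; apply: (abs_step_arith S0 (td n) qu qu1 iu iu1 erefl h1 h2).
have [u hu ug] := hc g_ (fun n => let: And3 h _ _ := hg n in h) step.
have Lu := W012_L2 hu.
have du n : dO (fun x => g_ n x - u x) (fun x => g_ n x - u x) <= 24 * 4^-1 ^+ n.
  by apply: le_trans (ug n); rewrite /sob lerDr ip_ge0.
have iu n : ipO (fun x => g_ n x - u x) (fun x => g_ n x - u x) <= 24 * 4^-1 ^+ n.
  by apply: le_trans (ug n); rewrite /sob lerDl dform_ge0.
(* The sequence tends in L^2 to |phi| by construction and to [u] by completeness. *)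
have uz : ipO (fun x => u x - a x) (fun x => u x - a x) = 0.
  apply/eqP; rewrite eq_le ip_ge0 andbT; apply: (@geometric_le0 _ _ (48 + 8 * r)) => n.
  have [hgn qn ign] := hg n.
  have L1 := L2B oO (W012_L2 hgn) La; have L2' := L2B oO (W012_L2 hgn) Lu.
  have := form_leB sL ipe ip0 L1 L2'.
  rewrite (_ : (fun x => g_ n x - a x - (g_ n x - u x)) = (fun x => u x - a x)); last first.
    by apply/funext => x; ring.
  have := iu n; have := t4 n; move: ign.
  rewrite (_ : (48 + 8 * r) * 4^-1 ^+ n = 48 * 4^-1 ^+ n + 8 * (r * 4^-1 ^+ n)); last by ring.
  by move: (r * 4^-1 ^+ n) (4^-1 ^+ n) => X Y; lra.
have qu : q u u = 0.
  apply/eqP; rewrite eq_le q0// andbT; apply: (@geometric_le0 _ _ (2 * ((2 * S + 1) * r) + 48 * S)) => n.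
  have [hgn qn ign] := hg n; have hd := linear_setB sV hgn hu.
  have := form_leB sV bq q0 hgn hd.
  rewrite (_ : (fun x => g_ n x - (g_ n x - u x)) = u); last by apply/funext => x; ring.
  have h1 := qle _ hd; have h2 := ler_wpM2l (ltW S0) (du n).
  have k0 : 0 <= 2 * S + 1 by rewrite addr_ge0// mulr_ge0// ltW.
  have h3 := ler_wpM2l k0 (t4 n).
  by move=> h; apply: (le_trans h); exact: abs_limit_arith h1 h2 h3 qn.
have ae : {ae mu2, forall x, Omega x -> u x = a x}.
  have := ip_eq0 mO (L2B oO Lu La) uz; apply: filterS => x h Ox.
  by apply/eqP; rewrite -subr_eq0 h.
have ha := W012_ae oO bO hu La ae; split; first exact: ha.
have Wa := W012_W12 ha; have Wu := W012_W12 hu.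
rewrite (dform_ae oO bO Wu La Wa ae) dformC (dform_ae oO bO Wu La Wu ae).
rewrite -(ip_ae oO Lu La La ae) ip2C -(ip_ae oO Lu La Lu ae).
by move/eqP: qu; rewrite subr_eq0 => /eqP ->.
Qed.

(** The Euler-Lagrange equation makes S D(p, eta) equal to the L^2 product of p and eta, which is
    nonnegative. *)
Lemma supersolution_of_minimiser p : W012 Omega p -> ipO p p = S * dO p p ->
  (forall x, 0 <= p x) -> supersolution Omega p.
Proof.
move=> hp ep p0; split; [exact: hp|by move=> x _; exact: p0|move=> eta te e0].
rewrite -(ler_pM2l S0) mulr0 -(first_eigenfunction hp (test_W012 oO bO te) ep).
by rewrite ip.unlock; apply: Rintegral_ge0 => x _; rewrite mulr_ge0.
Qed.

(** Both |phi| + phi and |phi| - phi are nonnegative elements of the null space of q, hence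
    supersolutions. If the first is positive then phi > 0, if the second is then phi < 0, and if
    both vanish so does phi. *)
Lemma first_eigenfunction_sign : connected Omega -> W012 Omega phi ->
  ipO phi phi = S * dO phi phi -> [\/ {ae mu2, forall x, Omega x -> phi x = 0},
    {ae mu2, forall x, Omega x -> 0 < phi x} | {ae mu2, forall x, Omega x -> phi x < 0}].
Proof.
move=> cO hp ep; have [ha ea] := abs_minimiser hp ep.
have qa : q (fun x => `|phi x|) (fun x => `|phi x|) = 0 by rewrite /q ea subrr.
have qp : q phi phi = 0 by rewrite /q ep subrr.
have comb c : c ^+ 2 = 1 -> supersolution Omega (fun x => 1 * `|phi x| + c * phi x) \/ ~ (forall x, 0 <= 1 * `|phi x| + c * phi x).
  move=> c2; have [h|h] := pselect (forall x, 0 <= 1 * `|phi x| + c * phi x); last by right.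
  left; have hc : W012 Omega (fun x => 1 * `|phi x| + c * phi x).
    exact: sV.1 _ _ (sV.2 1 _ ha) (sV.2 c _ hp).
  apply: supersolution_of_minimiser; [exact: hc| |exact: h].
  have := bilin_expand 1 c sV bq ha hp.
  rewrite qa qp (form_null sV bq q0 ha hp qa) !mulr0 !addr0 => /eqP.
  by rewrite /q subr_eq0 => /eqP ->.
have [s1|[]] := comb 1 (expr1n _ _); last first.
  by move=> x; rewrite !mul1r -lerBlDr sub0r ler_normr lexx orbT.
have [s2|[]] := comb (-1) (etrans (sqrrN 1) (expr1n _ _)); last first.
  by move=> x; rewrite mul1r mulN1r subr_ge0 ler_norm.
have [z1|p1] := strong_maximum_principle oO bO cO s1; last first.
  apply: Or32; apply: filterS p1 => x h Ox; have := h Ox; rewrite !mul1r.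
  by have [//|n0] := ltP 0 (phi x); rewrite ler0_norm// addNr ltxx.
have [z2|p2] := strong_maximum_principle oO bO cO s2; last first.
  apply: Or33; apply: filterS p2 => x h Ox; have := h Ox; rewrite mul1r mulN1r.
  by have [//|n0] := ltP (phi x) 0; rewrite ger0_norm// subrr ltxx.
apply: Or31; apply: filterS2 z1 z2 => x h1 h2 Ox; move: (h1 Ox) (h2 Ox).
rewrite !mul1r mulN1r; move: `|phi x| => A; lra.
Qed.

End absolute_value.

(** * The gap between the first two Dirichlet eigenvalues *)

Section spectral_gap.
Variables (R : realType) (Omega : set (R * R)).
Hypotheses (oO : open Omega) (bO : bounded_set Omega) (neO : Omega !=set0).
Local Notation P := (measurableTypeR R * measurableTypeR R)%type.
Local Notation mu2 := (@mu2 R).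
Local Notation ipO := (ip mu2 (Omega : set P)).
Local Notation dO := (dform Omega).
Let mO : measurable (Omega : set P). Proof. exact: open_measurable2. Qed.

Lemma domain_not_null : ~ {ae mu2, forall x, Omega x -> False}.
Proof.
have [x Ox] := neO; apply: (nbhs_pos (x := x)).
exact: (open_nbhs_nbhs (conj oO Ox)).
Qed.

Lemma ip_positive u v : L2 Omega u -> L2 Omega v ->
  {ae mu2, forall x, Omega x -> 0 < u x} -> {ae mu2, forall x, Omega x -> 0 < v x} ->
  ipO u v != 0.
Proof.
move=> Lu Lv u0 v0; apply/eqP => uv0; apply: domain_not_null.
(* Its square is u v almost everywhere, so a vanishing product of u and v becomes a vanishing
   norm. *)
pose w x := Num.sqrt `|u x * v x|.
have muv : measurable_fun Omega ((fun x => `|u x * v x|) : P -> R).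
  by apply: measurableT_comp => //; apply: measurable_funM; [exact: Lu.1|exact: Lv.1].
have mw : measurable_fun Omega (w : P -> R).
  by apply: measurableT_comp muv; apply: continuous_measurable_fun; exact: sqrt_continuous.
have w2 x : w x ^+ 2 = `|u x * v x| by rewrite sqr_sqrtr.
have sw : sqint mu2 (Omega : set P) w.
  apply/sqintP; split => //; under eq_fun do rewrite w2.
  by have := integrable_abse (sqint_mul mO Lu Lv); apply: eq_integrable.
have e : ipO w w = ipO u v.
  rewrite -!ip2E; apply: ae_eq_Rintegral => //.
  - exact: measurable_funM.
  - by apply: measurable_funM; [exact: Lu.1|exact: Lv.1].
  - apply: filterS2 u0 v0 => x h1 h2 Ox; rewrite -expr2 w2 ger0_norm//.
    by rewrite mulr_ge0// ltW ?h1 ?h2.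
have := ip_eq0 mO sw (etrans e uv0).
apply: filterS3 u0 v0 => x h1 h2 h3 Ox.
have := w2 x; rewrite h3// expr0n /= => /esym/normr0P.
by rewrite gt_eqF// mulr_gt0 ?h1 ?h2.
Qed.

Lemma exists_test : exists2 f, test_fun Omega f & 0 < ipO f f.
Proof.
have [x Ox] := neO.
have [|e /= e0 eO] := (nbhs_ballP x Omega).1; first exact: (open_nbhs_nbhs (conj oO Ox)).
pose f := box_bump 1 (x.1 - e / 2) (x.1 + e / 2) (x.2 - e / 2) (x.2 + e / 2).
have tf : test_fun Omega f.
  apply: test_box_bump => // -[y1 y2] /= []; rewrite !in_itv/= => /andP[? ?] /andP[? ?].
  by apply: eO; split; rewrite /ball/= ltr_norml; apply/andP; split; lra.
exists f => //; rewrite lt0r ip_ge0 andbT; apply/eqP => f0.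
have := ip_eq0 mO (test_L2 oO bO tf) f0.
have nU : nbhs x [set y | 0 < f y].
  have cf := smooth_continuous (test_smooth tf).
  have /cvgr_gt := cf x; apply; apply: box_bump_gt0 => //; apply/andP; split; lra.
move=> h; apply: (nbhs_pos nU); apply: filterS h => y h fy.
have [Oy|nOy] := pselect (Omega y); first by move: fy; rewrite /= (h Oy) ltxx.
by move: fy; rewrite /= (test_outside tf nOy) ltxx.
Qed.

(** Each has a strict sign almost everywhere; after changes of sign both are positive. *)
Lemma first_eigenfunctions_not_orthogonal (S : R) u v : connected Omega -> 0 < S ->
  (forall w, W012 Omega w -> ipO w w <= S * dO w w) ->
  W012 Omega u -> ipO u u = S * dO u u -> 0 < dO u u ->
  W012 Omega v -> ipO v v = S * dO v v -> 0 < dO v v -> ipO u v != 0.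
Proof.
move=> cO S0 hS hu eu du hv ev dv.
have Lu := W012_L2 hu; have Lv := W012_L2 hv.
have nz w : L2 Omega w -> ipO w w = S * dO w w -> 0 < dO w w ->
    ~ {ae mu2, forall x, Omega x -> w x = 0}.
  by move=> Lw ew dw /(ae0_ip mO Lw); rewrite ew => /eqP; rewrite gt_eqF// mulr_gt0.
have neg (w : R * R -> R) : {ae mu2, forall x, Omega x -> w x < 0} ->
    {ae mu2, forall x, Omega x -> 0 < - 1 * w x}.
  by apply: filterS => x h Ox; rewrite mulN1r oppr_gt0 h.
have Ln w : L2 Omega w -> L2 Omega (fun x => -1 * w x) by exact: (sqintZ mO).
have [zu|pu|nu] := first_eigenfunction_sign oO bO S0 hS cO hu eu; first by case: (nz u).
  have [zv|pv|nv] := first_eigenfunction_sign oO bO S0 hS cO hv ev; first by case: (nz v).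
    exact: ip_positive.
  have := ip_positive Lu (Ln _ Lv) pu (neg _ nv).
  by rewrite ip2C (ipZl mO (-1) Lv Lu) ip2C mulN1r oppr_eq0.
have [zv|pv|nv] := first_eigenfunction_sign oO bO S0 hS cO hv ev; first by case: (nz v).
  have := ip_positive (Ln _ Lu) Lv (neg _ nu) pv.
  by rewrite (ipZl mO (-1) Lu Lv) mulN1r oppr_eq0.
have := ip_positive (Ln _ Lu) (Ln _ Lv) (neg _ nu) (neg _ nv).
rewrite (ipZl mO (-1) Lu (Ln _ Lv)) ip2C (ipZl mO (-1) Lv Lu) ip2C.
by rewrite !mulN1r opprK.
Qed.

(** [S2] is the maximum of the quotient on the orthogonal complement of phi. If it equalled [S1],
    its maximiser would be a first eigenfunction orthogonal to phi. The value 0 is allowed to cover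
    a complement on which the L^2 form vanishes. *)
Lemma spectral_gap : connected Omega -> exists phi (S1 S2 : R),
  [/\ W012 Omega phi /\ 0 < dO phi phi, 0 < S1 /\ ipO phi phi = S1 * dO phi phi,
      0 <= S2 < S1 &
      forall w, W012 Omega w -> ipO phi w = 0 -> ipO w w <= S2 * dO w w].
Proof.
move=> cO; have [f tf f0] := exists_test.
have sV := linear_set_W012 oO bO.
have bI : bilin (W012 Omega) ipO by apply: bilin_sub (bilin_ip oO); exact: W012_L2.
have I0 w : W012 Omega w -> 0 <= ipO w w by move=> _; exact: ip_ge0.
have cI : compact_form Omega (W012 Omega) ipO by move=> e e0; exact: finite_rank.
have [phi [S1 [hp S10 dp ep hS1]]] := maximiser oO bO sV (fun _ h => h)
  (fun _ _ _ h _ => h) bI I0 cI (test_W012 oO bO tf) f0.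
have Lp := W012_L2 hp.
pose V w := W012 Omega w /\ ipO phi w = 0.
have VW w : V w -> W012 Omega w by case.
have lV : linear_set V.
  split=> [u v [hu u0] [hv v0]|c u [hu u0]]; split.
  - exact: sV.1.
  - by rewrite ip2C (ipDl mO (W012_L2 hu) (W012_L2 hv) Lp) !(ip2C Omega _ phi) u0 v0 addr0.
  - exact: sV.2.
  - by rewrite ip2C (ipZl mO c (W012_L2 hu) Lp) (ip2C Omega _ phi) u0 mulr0.
have Vcl (u_ : nat -> R * R -> R) u : (forall n, V (u_ n)) -> W012 Omega u ->
    (forall n, sob Omega (fun x => u_ n x - u x) <= 24 * 4^-1 ^+ n) -> V u.
  move=> hu_ hu hs; split => //; have Lu := W012_L2 hu.
  apply/eqP; rewrite -sqrf_eq0 eq_le sqr_ge0 andbT.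
  apply: (@geometric_le0 _ _ (ipO phi phi * 24)) => n; have [hn n0] := hu_ n.
  have Ld := L2B oO (W012_L2 hn) Lu.
  have e : ipO phi (fun x => u_ n x - u x) = - ipO phi u.
    by rewrite ip2C (ipBl mO (W012_L2 hn) Lu Lp) !(ip2C Omega _ phi) n0 sub0r.
  have := cauchy_schwarz mO Lp Ld; rewrite e sqrrN => h; apply: (le_trans h).
  rewrite -mulrA ler_wpM2l ?ip_ge0//; apply: le_trans (hs n).
  by rewrite /sob lerDl dform_ge0.
have cV : compact_form Omega V ipO.
  move=> e e0; have [s [Ls hs]] := cI e e0; exists s; split => // v /VW; exact: hs.
exists phi, S1.
have [[v0 Vv0 n0]|none] := pselect (exists2 v, V v & 0 < ipO v v); last first.
  exists 0; split => //; first by rewrite lexx.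
  move=> w hw w0; rewrite mul0r leNgt; apply/negP => pw; apply: none.
  by exists w.
have [v [S2 [[hv v0'] S20 dv ev hS2]]] :=
  maximiser oO bO lV VW Vcl (bilin_sub VW bI) (fun w h => I0 w (VW w h)) cV Vv0 n0.
exists S2; split => //; last by move=> w hw w0; exact: hS2.
rewrite (ltW S20) /= lt_neqAle -(ler_pM2r dv) -ev hS1// andbT.
apply/eqP => e; rewrite e in ev.
by have := first_eigenfunctions_not_orthogonal cO S10 hS1 hp ep dp hv ev dv; rewrite v0' eqxx.
Qed.

End spectral_gap.

(** * Comparison of lambda_1, Lambda_1 and lambda_2 for a fixed optimizer *)

Section weighted_eigenvalues.
Variables (R : realType) (Omega : set (R * R)).
Hypotheses (oO : open Omega) (bO : bounded_set Omega).
Local Notation P := (measurableTypeR R * measurableTypeR R)%type.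
Local Notation mu2 := (@mu2 R).
Local Notation ipO := (ip mu2 (Omega : set P)).
Local Notation dO := (dform Omega).
Let mO : measurable (Omega : set P). Proof. exact: open_measurable2. Qed.
Let sV : linear_set (W012 Omega) := linear_set_W012 oO bO.
Let bD : bilin (W012 Omega) dO.
Proof. by apply: bilin_sub (bilin_dform oO bO); exact: W012_W12. Qed.

Lemma dform_ae0 v : W012 Omega v -> ae_zero Omega v -> dO v v = 0.
Proof.
move=> hv v0; have Wv := W012_W12 hv.
have W0 := test_W12 oO bO (test0 Omega).
have z : {ae mu2, forall x, Omega x -> (fun=> 0) x = v x}.
  by apply: filterS v0 => x h Ox; rewrite h.
rewrite (dform_ae oO bO W0 Wv.1 Wv z).
by have := dformZl oO bO 0 W0 Wv; rewrite !mul0r => ->.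
Qed.

Lemma exp_integral_le (c c' : R) (v : R * R -> R) : measurable_fun Omega (v : P -> R) ->
  c <= c' -> (\int[mu2]_(x in Omega) (expR (c * v x ^+ 2))%:E <=
              \int[mu2]_(x in Omega) (expR (c' * v x ^+ 2))%:E)%E.
Proof.
move=> mv cc'; apply: ge0_le_integral; first exact: mO.
- by move=> x _; rewrite lee_fin expR_ge0.
- by apply/measurable_EFinP; exact: measurable_exp.
- by apply/measurable_EFinP; exact: measurable_exp.
- by move=> x _; rewrite lee_fin ler_expR ler_wpM2r ?sqr_ge0.
Qed.

Lemma nonzero_pos v : W012 Omega v -> ~ ae_zero Omega v -> 0 < ipO v v /\ 0 < dO v v.
Proof.
move=> hv nv; have p : 0 < ipO v v.
  rewrite lt0r ip_ge0 andbT; apply/eqP => v0; apply: nv.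
  by have := ip_eq0 mO (W012_L2 hv) v0; apply: filterS => x.
split => //; rewrite lt0r dform_ge0 andbT; apply/eqP => d0.
by have := poincare oO bO hv; rewrite d0 mulr0 leNgt p.
Qed.

Variables (beta C a : R) (u : R * R -> R).
Hypotheses (C0 : 0 < C) (a0 : 0 < a) (a6 : 6 * a <= beta).
Hypothesis hC : forall w, admissible Omega beta u w -> forall v, W012 Omega v ->
  L2 Omega (root_mul w v) /\ ipO (root_mul w v) (root_mul w v) <= C * dO v v.
Hypotheses (hu : W012 Omega u) (u1 : dO u u = 1).
Hypothesis finu : (\int[mu2]_(x in Omega) (expR (a * u x ^+ 2))%:E < +oo)%E.
Hypothesis opt : forall v, W012 Omega v -> dO v v <= 1 ->
  (\int[mu2]_(x in Omega) (expR (a * v x ^+ 2))%:E <=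
   \int[mu2]_(x in Omega) (expR (a * u x ^+ 2))%:E)%E.

Local Notation wip := (wip Omega).
Let om (x : R * R) : R := expR (a * u x ^+ 2).
Let w := lin_weight a u.
Let E (x : R * R) : R := expR (beta * u x ^+ 2).
Let d (x : R * R) : R := 2 * a * u x ^+ 2 * om x.

Let beta0 : 0 < beta. Proof. by move: a0 a6; lra. Qed.
Let mu : measurable_fun Omega (u : P -> R) := (W012_L2 hu).1.
Let mom : measurable_fun Omega (om : P -> R) := measurable_exp a mu.
Let bounds x := lin_weight_bounds a0 a6 (sqr_ge0 (u x)).

Let md : measurable_fun Omega (d : P -> R).
Proof.
apply: measurable_funM mom; apply: measurable_funM; first exact: measurable_cst.
exact: measurable_funX.
Qed.

Let mw : measurable_fun Omega (w : P -> R).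
Proof.
apply: measurable_funM mom; apply: measurable_funD; first exact: measurable_cst.
by apply: measurable_funM; [exact: measurable_cst|exact: measurable_funX].
Qed.

Let om_le x : 1 <= om x <= w x. Proof. by have [h1 h2 _ _] := bounds x; rewrite h1. Qed.
Let w_ge1 x : 1 <= w x. Proof. by have /andP[h] := om_le x; apply: le_trans. Qed.
Let w_leE x : w x <= E x.
Proof.
have [_ _ h _] := bounds x; apply: le_trans h.
by rewrite expr2 ler_peMl ?w_ge1// (le_trans ler01)// w_ge1.
Qed.

Let aE : admissible Omega beta u E.
Proof. by split=> [|x _]; [exact: measurable_exp|rewrite expR_ge0 lexx]. Qed.

Let aom : admissible Omega beta u om.
Proof.
split=> [|x _]; first exact: mom.
by rewrite expR_ge0 /=; have /andP[_ h] := om_le x; exact: le_trans h (w_leE x).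
Qed.

Let aw : admissible Omega beta u w.
Proof. by split=> [|x _]; [exact: mw|rewrite w_leE (le_trans ler01)// w_ge1]. Qed.

Let aw2 : admissible Omega beta u (fun x => w x ^+ 2).
Proof.
split=> [|x _]; first exact: measurable_funX.
by rewrite sqr_ge0 /=; have [_ _ h _] := bounds x.
Qed.

Let dE x : om x + d x = w x.
Proof. by rewrite /w /lin_weight mulrDl mul1r. Qed.

Let ad : admissible Omega beta u d.
Proof.
split=> [|x _]; first exact: md.
have o0 : 0 <= om x by exact: expR_ge0.
apply/andP; split; last by apply: le_trans (w_leE x); rewrite -dE lerDr.
by apply: mulr_ge0 o0; apply: mulr_ge0 (sqr_ge0 _); rewrite mulr_ge0// ltW.
Qed.

Let bw : bilin (W012 Omega) (wip w) := bilin_wip oO hC aw.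
Let bom : bilin (W012 Omega) (wip om) := bilin_wip oO hC aom.

Let wip_add : wip w u u = wip om u u + wip d u u.
Proof.
have i1 := wip_integrable oO hC aom hu; have i2 := wip_integrable oO hC ad hu.
have e (k : R * R -> R) : wip k u u = \int[mu2]_(x in Omega) (k x * u x ^+ 2).
  by apply: eq_Rintegral => x _; rewrite expr2 mulrA.
by rewrite !e -(RintegralD mO i1 i2); apply: eq_Rintegral => x _; rewrite -dE mulrDl.
Qed.

Let T := wip om u u.

Let u_nonzero : ~ ae_zero Omega u.
Proof. by move=> /(dform_ae0 hu); rewrite u1 => /eqP; rewrite oner_eq0. Qed.

Let T0 : 0 < T.
Proof.
have [p _] := nonzero_pos hu u_nonzero; apply: (lt_le_trans p).
by apply: (ip_le_wip oO bO hC aom hu) => x _; have /andP[] := om_le x.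
Qed.

(** The excess of the weight, multiplied by u^2, is 2a u^4 exp(a u^2); its integral vanishes only if
    u does. *)
Lemma wip_lin_weight_gt : T < wip w u u.
Proof.
rewrite wip_add ltrDl lt0r (wip_ge0 _ ad) andbT; apply/eqP => d0; apply: u_nonzero.
have := wip_eq0 oO hC ad hu d0; apply: filterS => x h Ox.
have := h Ox; rewrite (_ : d x * u x ^+ 2 = (2 * a * om x) * (u x ^+ 2) ^+ 2); last by rewrite /d; ring.
have p : 0 < 2 * a * om x by rewrite mulr_gt0 ?expR_gt0// mulr_gt0.
by move=> /eqP; rewrite mulf_eq0 (gt_eqF p) !sqrf_eq0 => /eqP.
Qed.

(* Convexity: exp(a v^2) >= exp(a u^2) (1 + a (v^2 - u^2)). *)
Lemma optimal_wip_le1 v : W012 Omega v -> dO v v <= 1 -> wip om v v <= T.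
Proof.
move=> hv v1; have := opt hv v1.
have mv : measurable_fun Omega (v : P -> R) := (W012_L2 hv).1.
set ev := fun x => expR (a * v x ^+ 2).
have mev : measurable_fun Omega (ev : P -> R) := measurable_exp a mv.
move=> le; have finv := le_lt_trans le finu.
have iv : mu2.-integrable (Omega : set P) (EFin \o ev).
  by apply/ge0_integrable => // x _; exact: expR_ge0.
have io : mu2.-integrable (Omega : set P) (EFin \o om).
  by apply/ge0_integrable => // x _; exact: expR_ge0.
have leR : \int[mu2]_(x in Omega) ev x <= \int[mu2]_(x in Omega) om x.
  by apply: fine_le => //; [exact: (integrable_fin_num mO iv)|exact: (integrable_fin_num mO io)].
have iZ c k : W012 Omega k ->
    mu2.-integrable (Omega : set P) (EFin \o (fun x => c * (om x * k x ^+ 2))).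
  by move=> hk; have := integrableZl mO c (wip_integrable oO hC aom hk); exact: eq_integrable.
have wE k : wip om k k = \int[mu2]_(x in Omega) (om x * k x ^+ 2).
  by apply: eq_Rintegral => x _; rewrite expr2 mulrA.
have i1 := iZ a v hv; have i2 := iZ (- a) u hu.
have i3 : mu2.-integrable (Omega : set P) (EFin \o (fun x => a * (om x * v x ^+ 2) + - a * (om x * u x ^+ 2))).
  by have := integrableD mO i1 i2; exact: eq_integrable.
have i4 : mu2.-integrable (Omega : set P) (EFin \o (fun x => om x + (a * (om x * v x ^+ 2) + - a * (om x * u x ^+ 2)))).
  by have := integrableD mO io i3; exact: eq_integrable.
have : \int[mu2]_(x in Omega) (om x + (a * (om x * v x ^+ 2) + - a * (om x * u x ^+ 2))) <=
    \int[mu2]_(x in Omega) ev x.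
  apply: le_Rintegral => // x _; have := expR_ge1Dx (a * v x ^+ 2 - a * u x ^+ 2).
  move=> h; have := ler_wpM2l (expR_ge0 (a * u x ^+ 2)) h.
  rewrite -expRD (addrC (a * u x ^+ 2)) subrK; apply: le_trans; rewrite le_eqVlt; apply/orP; left; apply/eqP.
  by rewrite /om; ring.
rewrite (RintegralD mO io i3) (RintegralD mO i1 i2).
rewrite (RintegralZl _ mO (wip_integrable oO hC aom hv)) (RintegralZl _ mO (wip_integrable oO hC aom hu)).
rewrite -!wE -/T => h; have := le_trans h leR; rewrite gerDl mulNr subr_le0.
by rewrite ler_pM2l.
Qed.

Lemma optimal_wip_le v : W012 Omega v -> wip om v v <= T * dO v v.
Proof.
move=> hv; have [dv|dv] := ltP 0 (dO v v); last first.
  have d0 : dO v v = 0 by apply/eqP; rewrite eq_le dv dform_ge0.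
  by have := wip_le hC aom hv; rewrite d0 !mulr0.
pose c := Num.sqrt (dO v v)^-1.
have c2 : c ^+ 2 = (dO v v)^-1 by rewrite sqr_sqrtr// invr_ge0 ltW.
have hcv := sV.2 c _ hv.
have sq B : bilin (W012 Omega) B -> B (fun x => c * v x) (fun x => c * v x) = c ^+ 2 * B v v.
  by move=> [Bs _ BZ]; rewrite BZ// Bs// BZ// mulrA.
have := optimal_wip_le1 hcv; rewrite !sq// c2 mulVf ?gt_eqF// lexx => /(_ isT).
by rewrite ler_pdivrMl// mulrC.
Qed.

Lemma Lambda1_quotient v : W012 Omega v -> ~ ae_zero Omega v ->
  0 < wip om v v /\
  (dirichlet Omega v / \int[mu2]_(x in Omega) ((v x) ^+ 2 * expR (a * (u x) ^+ 2))%:E)%E =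
  (dO v v / wip om v v)%:E.
Proof.
move=> hv nv; have [p _] := nonzero_pos hv nv.
have wp : 0 < wip om v v.
  by apply: (lt_le_trans p); apply: (ip_le_wip oO bO hC aom hv) => x _; have /andP[] := om_le x.
split => //; rewrite (dirichletE oO (W012_W12 hv)).
under eq_integral do rewrite mulrC.
by rewrite -(wip_EFin oO hC aom hv) inver gt_eqF.
Qed.

Lemma Lambda1_ge : (T^-1%:E <= Lambda1 a Omega u)%E.
Proof.
apply: le_ereal_inf_tmp => _ [v [hv nv] <-]; have [wp ->] := Lambda1_quotient hv nv.
by rewrite lee_fin ler_pdivlMr// ler_pdivrMl// optimal_wip_le.
Qed.

Lemma Lambda1_le phi S : 0 < S -> W012 Omega phi -> ipO phi phi = S * dO phi phi ->
  0 < dO phi phi -> (Lambda1 a Omega u <= S^-1%:E)%E.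
Proof.
move=> S0 hp ep dp.
have np : ~ ae_zero Omega phi by move=> /(dform_ae0 hp) e; move: dp; rewrite e ltxx.
apply: (@le_trans _ _ (dirichlet Omega phi /
  \int[mu2]_(x in Omega) ((phi x) ^+ 2 * expR (a * (u x) ^+ 2))%:E)%E).
  by apply: ereal_inf_lbound; exists phi.
have [wp ->] := Lambda1_quotient hp np.
rewrite lee_fin ler_pdivrMr// ler_pdivlMl// -ep.
by apply: (ip_le_wip oO bO hC aom hp) => x _; have /andP[] := om_le x.
Qed.

Lemma weak_solutionE l f : weak_solution Omega w l f ->
  W012 Omega f /\ forall g, W012 Omega g -> dO f g = l * wip w f g.
Proof.
move=> [hf h]; split => // g hg.
by rewrite -(grad_dotE oO (W012_W12 hf) (W012_W12 hg)) h.
Qed.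

(** S is the maximum of the form with the linearised weight; testing with u, whose energy is 1,
    gives S >= [wip w u u] > T. The maximiser is an eigenfunction, and it alone forms the
    independent family of size 1 that bounds lambda_1. *)
Lemma lambda1_attained : exists phi S, [/\ 0 < T < S, weak_solution Omega w S^-1 phi,
  0 < dO phi phi & (lambda a Omega u 1 <= S^-1%:E)%E].
Proof.
have [phi [S [hp S0 dp ep hS]]] := maximiser oO bO sV (fun _ h => h)
  (fun _ _ _ h _ => h) bw (fun v _ => wip_ge0 v aw)
  (compact_wip oO bO C0 hC aw aw2) hu (lt_trans T0 wip_lin_weight_gt).
have q0 v : W012 Omega v -> 0 <= S * dO v v - wip w v v by move=> hv; rewrite subr_ge0 hS.
have bq := bilin_comb S bD bw.
have ws : weak_solution Omega w S^-1 phi.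
  split=> [|psi hs]; first exact: hp.
  rewrite (grad_dotE oO (W012_W12 hp) (W012_W12 hs)).
  have := form_null sV bq q0 hp hs; rewrite ep subrr => /(_ erefl)/eqP.
  by rewrite subr_eq0 => /eqP e; rewrite -[X in _ = _ * X]e mulKf// gt_eqF.
exists phi, S; split => //.
  by rewrite T0 /=; apply: (lt_le_trans wip_lin_weight_gt); have := hS u hu; rewrite u1 mulr1.
apply: ereal_inf_lbound; exists S^-1 => //; exists (fun=> phi) => [c h i|i].
  have z : ae_zero Omega (fun x => c i * phi x).
    by apply: filterS h => x + Ox => /(_ Ox); rewrite big_ord1 (ord1 i).
  have hcp := sV.2 (c i) _ hp; have := dform_ae0 hcp z.
  rewrite (dformZZ oO bO _ (W012_W12 hp)) => /eqP; rewrite mulf_eq0 sqrf_eq0.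
  by rewrite (gt_eqF dp) orbF => /eqP.
by exists S^-1.
Qed.

Lemma eigenfunctions_orthogonal l0 l1 f0 f1 : weak_solution Omega w l0 f0 ->
  weak_solution Omega w l1 f1 -> l0 = l1 \/ wip w f0 f1 = 0.
Proof.
move=> /weak_solutionE[h0 e0] /weak_solutionE[h1 e1].
have [bs _ _] := bw; have := e0 _ h1; rewrite dformC e1// (bs _ _ h1 h0) => /eqP.
rewrite -subr_eq0 -mulrBl mulf_eq0 => /orP[/eqP h|/eqP]; last by right.
by left; apply/eqP; rewrite eq_sym -subr_eq0 h.
Qed.

(** For equal eigenvalues the span consists of eigenfunctions; for distinct ones the mixed terms
    vanish. *)
Lemma eigenfunctions_comb t l0 l1 f0 f1 c0 c1 : weak_solution Omega w l0 f0 ->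
  weak_solution Omega w l1 f1 -> l0 <= t -> l1 <= t ->
  dO (fun x => c0 * f0 x + c1 * f1 x) (fun x => c0 * f0 x + c1 * f1 x) <=
  t * wip w (fun x => c0 * f0 x + c1 * f1 x) (fun x => c0 * f0 x + c1 * f1 x).
Proof.
move=> s0 s1 t0 t1; have [h0 e0] := weak_solutionE s0; have [h1 e1] := weak_solutionE s1.
have ort := eigenfunctions_orthogonal s0 s1.
have N := wip_ge0 (fun x => c0 * f0 x + c1 * f1 x) aw; move: N.
rewrite (bilin_expand c0 c1 sV bD h0 h1) (bilin_expand c0 c1 sV bw h0 h1).
rewrite !e0// !e1//; have n0 := wip_ge0 f0 aw; have n1 := wip_ge0 f1 aw.
case: ort => [<-|->] N.
  apply: le_trans (ler_wpM2r N t0); rewrite le_eqVlt; apply/orP; left; apply/eqP; ring.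
rewrite !mulr0 !addr0 mulrDr (mulrCA t (c0 ^+ 2)) (mulrCA t (c1 ^+ 2)).
by apply: lerD; rewrite ler_wpM2l ?sqr_ge0// ler_wpM2r.
Qed.

(** On functions orthogonal to phi, w <= 1 + (6a / beta) E bounds the weighted form by S2 + (6a /
    beta) C times the energy. The smallness assumption keeps this below the midpoint of S2 and S1,
    while a combination of two eigenfunctions up to level t has quotient at least 1/t. *)
Lemma lambda2_ge phi S1 S2 : W012 Omega phi -> 0 < dO phi phi ->
  (forall v, W012 Omega v -> ipO phi v = 0 -> ipO v v <= S2 * dO v v) ->
  6 * a / beta * C <= (S1 - S2) / 2 -> 0 < S1 -> 0 <= S2 < S1 ->
  (((S1 + S2) / 2)^-1%:E <= lambda a Omega u 2)%E.
Proof.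
move=> hp dp hS2 ha S10 /andP[S20 S12].
have m0 : 0 < (S1 + S2) / 2 by rewrite divr_gt0// ltr_wpDr.
apply: le_ereal_inf_tmp => _ [t [f lif hf] <-]; rewrite lee_fin.
have [l0 l0t s0] := hf ord0; have [l1 l1t s1] := hf (lift ord0 ord0).
set f0 := f ord0 in s0; set f1 := f (lift ord0 ord0) in s1.
have [h0 _] := weak_solutionE s0; have [h1 _] := weak_solutionE s1.
(* One linear condition in two unknowns; when f0 is already orthogonal to phi, the other coefficient
   choice could vanish identically, so (1, 0) is taken. *)
have [c0 [c1 [cn co]]] : exists c0 c1, (c0 != 0 \/ c1 != 0) /\
    c0 * ipO phi f0 + c1 * ipO phi f1 = 0.
  have [z|n] := eqVneq (ipO phi f0) 0.
    by exists 1, 0; split; [left; exact: oner_neq0|rewrite z mulr0 mul0r addr0].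
  exists (- ipO phi f1), (ipO phi f0); split; [by right|ring].
pose v x := c0 * f0 x + c1 * f1 x.
have hv : W012 Omega v := sV.1 _ _ (sV.2 c0 _ h0) (sV.2 c1 _ h1).
have ov : ipO phi v = 0.
  have L0 := W012_L2 h0; have L1 := W012_L2 h1; have Lp := W012_L2 hp.
  rewrite ip2C (ipDl mO (sqintZ mO c0 L0) (sqintZ mO c1 L1) Lp).
  by rewrite (ipZl mO c0 L0 Lp) (ipZl mO c1 L1 Lp) !(ip2C Omega _ phi).
have nv : ~ ae_zero Omega v.
  move=> z; pose c (i : 'I_2) := if i == ord0 then c0 else c1.
  have cz : forall i, c i = 0.
    apply: lif; apply: filterS z => x + Ox => /(_ Ox).
    by rewrite /v big_ord_recl big_ord1.
  by have := cz ord0; have := cz (lift ord0 ord0); rewrite /c /= => z1 z0; case: cn; rewrite ?z0 ?z1 eqxx.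
have [_ dv] := nonzero_pos hv nv.
have h := eigenfunctions_comb c0 c1 s0 s1 l0t l1t; rewrite -/v in h.
have hw : wip w v v <= 1 * ipO v v + 6 * a / beta * wip E v v.
  by apply: (wip_comb oO bO hC aw aE hv) => x _; have [_ _ _] := bounds x.
have hE := wip_le hC aE hv; have hI := hS2 _ hv ov.
have th : 0 <= 6 * a / beta by rewrite divr_ge0 ?mulr_ge0// ltW.
have hN : wip w v v <= (S1 + S2) / 2 * dO v v.
  apply: (le_trans hw); rewrite mul1r.
  have := ler_wpM2l th hE; have := ler_wpM2r (ltW dv) ha; move: hI; rewrite mulrA.
  move: (6 * a / beta * C * _) (_ * wip _ _ _) => X Y.
  by rewrite mulrAC mulrBl (mulrAC (S1 + S2)) mulrDl; lra.
(* A nonpositive t would give the nonzero combination nonpositive energy. *)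
have t0 : 0 < t.
  by rewrite ltNge; apply/negP => tn; move: (lt_le_trans dv h); rewrite ltNge mulr_le0_ge0// (wip_ge0 v aw).
have := le_trans h (ler_wpM2l (ltW t0) hN); rewrite mulrA -[leLHS]mul1r ler_pM2r// => tm.
by rewrite -[leLHS]mul1r ler_pdivrMr.
Qed.

(** Here [S] is an eigenvalue itself. Eigenfunctions for S < l are orthogonal in both forms, hence
    independent, so they are counted together at level l. This excludes any eigenvalue strictly
    between lambda_1 and lambda_2. *)
Lemma lambda2_le l S phi psi : weak_solution Omega w S phi -> 0 < dO phi phi -> S < l ->
  weak_solution Omega w l psi -> ~ ae_zero Omega psi -> (lambda a Omega u 2 <= l%:E)%E.
Proof.
move=> s0 d0 Sl s1 np; have [h0 e0] := weak_solutionE s0; have [h1 _] := weak_solutionE s1.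
have [_ d1] := nonzero_pos h1 np.
have o : wip w phi psi = 0.
  by have [e|//] := eigenfunctions_orthogonal s0 s1; rewrite e ltxx in Sl.
apply: ereal_inf_lbound; exists l => //.
exists (fun i : 'I_2 => if i == ord0 then phi else psi); last first.
  by move=> i; case: ifP => _; [exists S => //; exact: ltW|exists l].
move=> c h; pose c0 := c ord0; pose c1 := c (lift ord0 ord0).
have z : ae_zero Omega (fun x => c0 * phi x + c1 * psi x).
  by apply: filterS h => x + Ox => /(_ Ox); rewrite big_ord_recl big_ord1.
have := dform_ae0 (sV.1 _ _ (sV.2 c0 _ h0) (sV.2 c1 _ h1)) z.
rewrite (bilin_expand c0 c1 sV bD h0 h1) (e0 _ h1) o !mulr0 addr0 => /eqP.
rewrite (paddr_eq0 (mulr_ge0 (sqr_ge0 c0) (ltW d0)) (mulr_ge0 (sqr_ge0 c1) (ltW d1))).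
rewrite (mulf_eq0 (c0 ^+ 2)) (mulf_eq0 (c1 ^+ 2)) !sqrf_eq0 (gt_eqF d0) (gt_eqF d1) !orbF => /andP[/eqP z0 /eqP z1] i.
have [i0|i0] := eqVneq i ord0; first by rewrite i0.
suff -> : i = lift ord0 ord0 by [].
by apply/val_inj; case: i i0 => [[|[|k]] hk].
Qed.

End weighted_eigenvalues.

(** * Choice of the threshold and conclusion *)

Lemma small_exponent_arith (R : realFieldType) (a b C d : R) : 0 < b ->
  a * (12 * C) <= b * d -> 6 * a / b * C <= d / 2.
Proof.
move=> b0 h; rewrite (_ : 6 * a / b * C = (6 * a * C) / b); last by ring.
by rewrite ler_pdivrMr//; lra.
Qed.

Theorem lemma12 (R : realType) (Omega : set (R * R))
    (hOmega : smooth_bounded_domain Omega) :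
  exists2 a0 : R, 0 < a0 &
    forall a : R, 0 < a -> a < a0 ->
    forall u : R * R -> R, (optimizers a Omega `&` unit_sphere Omega) u ->
      [/\ (lambda a Omega u 1 < Lambda1 a Omega u)%E,
          (Lambda1 a Omega u < lambda a Omega u 2)%E &
          ~ exists2 l : R, l%:E = Lambda1 a Omega u &
              is_eigenvalue Omega (lin_weight a u) l].
Proof.
have [oO cO neO bO _] := hOmega.
have [beta [C [beta0 C0 hC]]] := exp_weight oO bO.
have [b [K [b0 K0 hK]]] := exp_W012 oO bO.
have [phi [S1 [S2 [[hp dp] [S10 ep] S12 hS2]]]] := spectral_gap oO bO neO cO.
have gap0 : 0 < S1 - S2 by case/andP: S12 => _; rewrite subr_gt0.
(* Below b the maximal energy is finite; below beta / 6 the linearised weight and its square are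
   admissible; the third bound keeps the perturbation of the weight within half of the gap S1 -
   S2. *)
exists (Num.min b (Num.min (beta / 6) (beta * (S1 - S2) / (12 * C)))).
  by rewrite !lt_min b0 !divr_gt0 ?mulr_gt0.
move=> a a0; rewrite !lt_min => /andP[ab /andP[a6 aC]] u [[hu _ eu] [_ gu]].
have a6' : 6 * a <= beta by move: a6; rewrite ltr_pdivlMr// mulrC => /ltW.
have aC' : 6 * a / beta * C <= (S1 - S2) / 2.
  move: aC; rewrite ltr_pdivlMr ?mulr_gt0// => /ltW h.
  exact: small_exponent_arith.
have u1 : dform Omega u u = 1.
  move: gu; rewrite (grad_normE oO (W012_W12 hu)) => -[e].
  by rewrite -(sqr_sqrtr (dform_ge0 Omega u)) e expr1n.
have hu1 : dform Omega u u <= 1 by rewrite u1.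
have finu : (\int[@mu2 R]_(x in Omega) (expR (a * u x ^+ 2))%:E < +oo)%E.
  apply: (@le_lt_trans _ _ K%:E); last exact: ltry.
  apply: (le_trans _ (hK u hu hu1)).
  have h := exp_integral_le oO (W012_L2 hu).1 (ltW ab). exact: h.
have opt v : W012 Omega v -> dform Omega v v <= 1 ->
    (\int[@mu2 R]_(x in Omega) (expR (a * v x ^+ 2))%:E <=
     \int[@mu2 R]_(x in Omega) (expR (a * u x ^+ 2))%:E)%E.
  move=> hv v1; rewrite -[leRHS]/(TM_energy a Omega u) eu; apply: ereal_sup_ubound.
  exists v => //; split; first exact: hv.
  by rewrite (grad_normE oO (W012_W12 hv)) lee_fin -[leRHS]sqrtr1 ler_sqrt.
have hCu := hC u hu hu1.
have [f [S [/andP[T0 TS] ws df l1]]] := lambda1_attained oO bO C0 a0 a6' hCu hu u1.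
have LT := Lambda1_ge oO bO a0 a6' hCu hu u1 finu opt.
have LS := Lambda1_le oO bO a0 a6' hCu hu S10 hp ep dp.
have l2 := lambda2_ge oO bO a0 a6' hCu hu hp dp hS2 aC' S10 S12.
have S0 := lt_trans T0 TS.
have ST : (S^-1%:E < Lambda1 a Omega u)%E.
  by apply: lt_le_trans LT; rewrite lte_fin ltf_pV2 ?posrE.
have L2 : (Lambda1 a Omega u < lambda a Omega u 2)%E.
  apply: (le_lt_trans LS); apply: lt_le_trans l2; have /andP[S20 S21] := S12.
  by rewrite lte_fin ltf_pV2 ?posrE ?divr_gt0 ?ltr_wpDr// ltr_pdivrMr// mulr_natr mulr2n ltrD2l.
split; [exact: le_lt_trans l1 ST|exact: L2|].
(* Lambda_1 lies strictly above the eigenvalue 1/S, so if it were an eigenvalue it would be at least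
   lambda_2. *)
move=> [l lE [psi wpsi npsi]]; rewrite -lE lte_fin in ST.
have := lambda2_le oO bO a0 a6' hCu hu ws df ST wpsi npsi.
by rewrite lE leNgt L2.
Qed.
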